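(* Let $a,b,c>0$ be such that $1/a^{2},1/b^{2},1/c^{2}$ are linearly independent over $\mathbb{Q}$ and such that at least one of the ratios $b^{2}/a^{2},\,c^{2}/a^{2},\,c^{2}/b^{2}$ is an irrational of finite type. Let $\mathcal{L}_{0}=\mathbb{Z}(a,0,0)\oplus\mathbb{Z}(0,b,0)\oplus\mathbb{Z}(0,0,c)$ and $\mathbb{T}^{3}=\mathbb{R}^{3}/2\pi\mathcal{L}_{0}$. Fix $\phi\in(-\pi,\pi)$. Let $\Lambda_\phi$ be the set of perturbed eigenvalues of the point scatterer at $x_0$ with parameter $\phi$, and $g_\lambda$ ($\lambda\in\Lambda_\phi$) the corresponding $L^2$-normalized eigenfunctions. Then there is a subset $\Lambda_{\phi,\infty}\subseteq\Lambda_{\phi}$ of density one such that for all observables $f\in C^{\infty}(\mathbb{T}^{3})$, $$\int_{\mathbb{T}^{3}}f(x)\,|g_{\lambda}(x)|^{2}\,dx\;\to\;\frac{1}{\mathrm{area}(\mathbb{T}^{3})}\int_{\mathbb{T}^{3}}f(x)\,dx$$ as $\lambda\to\infty$ along $\Lambda_{\phi,\infty}$.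
   Context: An irrational $\alpha$ is of finite type $\tau\in\mathbb{R}$ if $\tau$ is the supremum of all $\gamma$ for which $\liminf_{q\to\infty}q^{\gamma}\|q\alpha\|=0$, where $q$ runs through the positive integers and $\|t\|=\min_{n\in\mathbb{Z}}|t-n|$. Fix a point $x_0\in\mathbb{T}^3$; $\mathrm{area}(\mathbb{T}^3)$ denotes the (three-dimensional Lebesgue) volume of the torus. Let $\mathcal{L}=\mathbb{Z}(1/a,0,0)\oplus\mathbb{Z}(0,1/b,0)\oplus\mathbb{Z}(0,0,1/c)$ be the dual lattice. The Laplacian $-\Delta$ on smooth functions on $\mathbb{T}^3$ vanishing near $x_0$ has self-adjoint extensions $-\Delta_{\phi,x_0}$ parametrized by $\phi\in(-\pi,\pi]$ ($\phi=\pi$ is the standard Laplacian); $-\Delta_{\phi,x_0}$ acts on those $f\in L^2(\mathbb{T}^3)$ with $-\Delta f+A\delta_{x_0}\in L^2(\mathbb{T}^3)$ for some $A\in\mathbb{C}$ and $f(x)=\alpha\left(\cos\frac{\phi}{2}\cdot\frac{-1}{4\pi|x-x_0|}+\sin\frac{\phi}{2}\right)+o(1)$ as $x\to x_0$ for some $\alpha\in\mathbb{C}$. For $\phi\in(-\pi,\pi)$, the set $\Lambda_\phi$ of perturbed (new) eigenvalues is the set of real $\lambda\notin\{|\xi|^2:\xi\in\mathcal{L}\}$ solving $$\sum_{\xi\in\mathcal{L}}\left\{\frac{1}{|\xi|^2-\lambda}-\frac{|\xi|^2}{|\xi|^4+1}\right\}=c_0\tan\frac{\phi}{2},\qquad c_0=\sum_{\xi\in\mathcal{L}}\frac{1}{|\xi|^4+1}.$$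 The corresponding eigenfunctions are the multiples of the Green's function $$G_\lambda(x,x_0)=-\frac{1}{8\pi^3}\sum_{\xi\in\mathcal{L}}\frac{\exp(i\xi\cdot(x-x_0))}{|\xi|^2-\lambda}$$ (convergent in $L^2$), and $g_\lambda=G_\lambda/\|G_\lambda\|_2$, where $\|\cdot\|_2$ is the norm of $L^2(\mathbb{T}^3)$. A subset $\Lambda'\subseteq\Lambda_\phi$ has density one if $\#\{\lambda\in\Lambda':\lambda\le X\}/\#\{\lambda\in\Lambda_\phi:\lambda\le X\}\to1$ as $X\to\infty$. *)

(* Defs.v *)
From HB Require Import structures.
From mathcomp Require Import all_boot all_order all_algebra finmap.
From mathcomp Require Import complex.
From mathcomp Require Import all_classical all_reals all_analysis.
From mathcomp.analysis.showcase Require summability.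

Set Implicit Arguments.
Unset Strict Implicit.
Unset Printing Implicit Defensive.
Import Order.TTheory GRing.Theory Num.Theory.
Import numFieldNormedType.Exports.
Local Open Scope classical_set_scope.
Local Open Scope ring_scope.
Local Open Scope complex_scope.

(* The torus is T^3 = R^3 / 2 pi L0 with L0 = a Z (+) b Z (+) c Z: points of T^3 are given by
   representatives in R * R * R, functions on T^3 by 2 pi L0-periodic functions
   when values at points matter, and elements of L^2(T^3) by functions on the
   fundamental box. *)

Section Diophantine.
Context {R : realType}.
Implicit Types (x y z t alpha tau : R).

Definition lin_indep_Q x y z : Prop :=
  forall p q r : rat, ratr p * x + ratr q * y + ratr r * z = 0 ->
    [/\ p = 0, q = 0 & r = 0].

Definition dist_int t : R := inf [set `|t - n%:~R| | n in [set: int]].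

(* The sequence index n stands for the positive integer q = n + 1. *)
Definition type_exponents alpha : set R :=
  [set gamma | limn_einf (fun n : nat =>
     (n.+1%:R `^ gamma * dist_int (n.+1%:R * alpha))%:E) = 0%E].

(* [supremums A] is the set of least upper bounds of [A]. *)
Definition finite_type alpha tau : Prop :=
  irrational alpha /\ supremums (type_exponents alpha) tau.

Definition irrational_of_finite_type alpha : Prop :=
  exists tau, finite_type alpha tau.

End Diophantine.

Section Torus.
Context {R : realType}.
Variables a b c : R.
Implicit Types (x y : R * R * R) (m : int * int * int).

Definition dot x y : R := x.1.1 * y.1.1 + x.1.2 * y.1.2 + x.2 * y.2.

(* L0 and its dual lattice L are indexed by Z^3; for a, b, c > 0 both
   parametrizations are injective, so sums over L are sums over Z^3. *)
Definition period m : R * R * R :=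
  (2 * pi * (a * m.1.1%:~R), 2 * pi * (b * m.1.2%:~R), 2 * pi * (c * m.2%:~R)).

Definition dual_vec m : R * R * R :=
  (m.1.1%:~R / a, m.1.2%:~R / b, m.2%:~R / c).

Definition nsq m : R := dot (dual_vec m) (dual_vec m).

Definition box : set (R * R * R) :=
  (`[0, 2 * pi * a[%classic `*` `[0, 2 * pi * b[%classic)
    `*` `[0, 2 * pi * c[%classic.

Definition volume :
    {measure set (measurableTypeR R * measurableTypeR R * measurableTypeR R)
       -> \bar R} :=
  ((@lebesgue_measure R \x @lebesgue_measure R) \x @lebesgue_measure R)%E.

Definition area : R := fine (volume box).

Definition torus_int (h : R * R * R -> R[i]) : R[i] :=
  (\int[volume]_(x in box) complex.Re (h x)) +i*
  (\int[volume]_(x in box) complex.Im (h x)).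

Definition L2_norm_sq (h : R * R * R -> R[i]) : \bar R :=
  (\int[volume]_(x in box) (ComplexField.Normc.normc (h x) ^+ 2)%:E)%E.

Definition L2_norm (h : R * R * R -> R[i]) : R :=
  Num.sqrt (fine (L2_norm_sq h)).

Definition square_integrable (h : R * R * R -> R[i]) : Prop :=
  [/\ measurable_fun box (fun x => complex.Re (h x)),
      measurable_fun box (fun x => complex.Im (h x)) & (L2_norm_sq h < +oo)%E].

Definition basis_vec (i : 'I_3) : R * R * R :=
  ((val i == 0%N)%:R, (val i == 1%N)%:R, (val i == 2%N)%:R).

Definition iter_partial (s : seq 'I_3) (f : R * R * R -> R) : R * R * R -> R :=
  foldr (fun i g => fun x => 'D_(basis_vec i) g x) f s.

Definition smooth (f : R * R * R -> R) : Prop :=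
  forall s : seq 'I_3, continuous (iter_partial s f) /\
    forall i x, derivable (iter_partial s f) x (basis_vec i).

Definition torus_smooth (f : R * R * R -> R[i]) : Prop :=
  [/\ forall m x, f (x + period m) = f x,
      smooth (fun x => complex.Re (f x)) & smooth (fun x => complex.Im (f x))].

Definition c0 : R :=
  summability.sum (fun m => 1 / (nsq m ^+ 2 + 1)).

Definition new_eigenvalues (phi : R) : set R :=
  [set lambda | (forall m, lambda <> nsq m) /\
    summability.sum (fun m =>
      1 / (nsq m - lambda) - nsq m / (nsq m ^+ 2 + 1)) = c0 * tan (phi / 2)].

Definition expi (t : R) : R[i] := cos t +i* sin t.

Definition green_term x0 (lambda : R) m x : R[i] :=
  (- (1 / (8 * pi ^+ 3)))%:C *
    (expi (dot (dual_vec m) (x - x0)) / (nsq m - lambda)%:C).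

(* [G] is a representative of the L^2 class G_lambda(., x0): the series converges
   to it in L^2, unconditionally (along the net of finite subsets of Z^3).  The
   L^2 limit is unique up to null sets of [box]. *)
Definition is_green x0 (lambda : R) (G : R * R * R -> R[i]) : Prop :=
  square_integrable G /\
  (L2_norm_sq (fun x => G x -
     summability.partial_sum (fun m => green_term x0 lambda m x) F)
    @[F --> summability.totally] --> 0%E).

Definition normalize (G : R * R * R -> R[i]) : R * R * R -> R[i] :=
  fun x => G x / (L2_norm G)%:C.

(* [fset_set A] is the empty set when [A] is infinite; the counting function of
   [new_eigenvalues phi] is finite. *)
Definition count_upto (A : set R) (X : R) : nat :=
  #|` fset_set (A `&` [set lambda | lambda <= X])|%fset.

Definition density_one (A B : set R) : Prop :=
  A `<=` B /\
  ((count_upto A X)%:R / (count_upto B X)%:R : R) @[X --> +oo] --> (1 : R).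

End Torus.

(* Main.v *)
(* Write q(m) = |xi_m|^2, u_m = (q(m) - lambda)^-1 and S = sum u_m^2.  Expanding
   |G_lambda|^2 in Fourier modes, its pairing with a nontrivial mode z is a
   multiple of sum_m u_m u_(m+z), while its total mass is the same multiple of S
   times the volume.  So equidistribution along a set of lambda amounts to
   sum_m |u_m u_(m+z)| = o(S) for every z <> 0, and trigonometric polynomials are
   uniformly dense in the continuous periodic functions (Fejer).

   Put t = lambda^(1/32).  Points m with |q(m) - lambda| >= t^10 contribute at most
   O(t^28) to S, whereas S >= t^30 as soon as some q(m) lies within t^-15 of
   lambda.  If both m and m+z are within t^10 of lambda, then
   |q(m+z) - q(m)| < 2 t^10, so m lies in one of O(t^3) thin slabs around lattice
   planes; these resonant points number only O(t^45), and for most lambda they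
   carry at most the fraction 1/t of S.  In both cases weighted AM-GM bounds
   u_m u_(m+z) by terms whose sum is O(S/t).

   That "most lambda" has density one follows from interlacing: between two
   perturbed eigenvalues there is a value of q and conversely.  If m is fixed and
   lambda_1 < lambda_2 < ... are the perturbed eigenvalues above q(m), then at
   least k values of q are at distance at most lambda_k - q(m) from lambda_k,
   hence u_m(lambda_k)^2 <= S(lambda_k) / k.  Summing over k, a set of N perturbed
   eigenvalues at which the resonant points carry more than the fraction 1/t has
   N / t = O(t^45 log N), so N = O(t^47) = o(lambda^(3/2)); the perturbed
   eigenvalues up to lambda number at least a constant times lambda^(3/2), since
   by linear independence q takes distinct values on the positive octant. *)
Require Import Defs.
From HB Require Import structures.
From mathcomp Require Import all_boot all_order all_algebra finmap.
From mathcomp Require Import complex.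
From mathcomp Require Import all_classical all_reals all_analysis.
Import Order.TTheory GRing.Theory Num.Theory.
Import numFieldNormedType.Exports.
Local Open Scope classical_set_scope.
Local Open Scope ring_scope.
Local Open Scope complex_scope.
From mathcomp Require Import measurable_realfun.
From mathcomp Require Import zify ring lra.
Set Implicit Arguments.
Unset Strict Implicit.
Unset Printing Implicit Defensive.

Notation psum := summability.partial_sum.
Notation totally := summability.totally.
#[global] Existing Instance summability.totally_filter.

(** * Unconditional sums along the net of finite subsets *)

Lemma psumE (I : choiceType) (V : zmodType) (f : I -> V) (F : {fset I}) :
  psum f F = \sum_(i <- F) f i.
Proof. by rewrite /psum big_seq_fsetE. Qed.

Lemma ler_sum_uniq_sub {R : realType} {I : choiceType} (g : I -> R) (s r : seq I) :
  (forall i, 0 <= g i) -> uniq s -> uniq r -> {subset s <= r} ->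
  \sum_(i <- s) g i <= \sum_(i <- r) g i.
Proof.
move=> g0 us ur sr; rewrite [leRHS](bigID (mem s)) /= -[X in X + _]big_filter.
rewrite [X in _ <= X + _](perm_big s); first by rewrite lerDl sumr_ge0.
apply: uniq_perm; rewrite ?filter_uniq // => i; rewrite mem_filter /=.
by case: (boolP (i \in s)) => //= /sr.
Qed.

Section NetSums.
Context {R : realType} {I : choiceType}.
Implicit Types (f g : I -> R) (F A : {fset I}).

Definition has_sum f (l : R) : Prop := psum f F @[F --> totally] --> l.

Lemma ler_sum_fsubset f A F : (forall i, 0 <= f i) -> (A `<=` F)%fset ->
  \sum_(i <- A) f i <= \sum_(i <- F) f i.
Proof.
by move=> f0 /fsubsetP AF; apply: ler_sum_uniq_sub.
Qed.

Lemma has_sumE f l : has_sum f l -> summability.sum f = l.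
Proof. by move=> fl; apply: (@cvg_lim _ (@Rhausdorff R)). Qed.

Lemma has_sumB f g l m : has_sum f l -> has_sum g m ->
  has_sum (fun i => f i - g i) (l - m).
Proof.
move=> fl gm; rewrite /has_sum.
have -> : psum (fun i => f i - g i) = psum f \- psum g.
  by apply/funext => F /=; rewrite !psumE sumrB.
exact: cvgB.
Qed.

Lemma has_sum_ge f l F : (forall i, 0 <= f i) -> has_sum f l ->
  \sum_(i <- F) f i <= l.
Proof.
move=> f0 fl; rewrite leNgt; apply/negP => lF.
move/cvgrPdist_lt : fl => /(_ (\sum_(i <- F) f i - l)).
rewrite subr_gt0 => /(_ lF)[A _ /(_ (A `|` F)%fset (fsubsetUl _ _))] /=.
rewrite psumE ltr_norml => /andP[+ _].
by have := ler_sum_fsubset f0 (fsubsetUr A F); lra.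
Qed.

Lemma has_sum_le f (l B : R) : (forall F, \sum_(i <- F) f i <= B) -> has_sum f l ->
  l <= B.
Proof.
move=> fB fl; rewrite leNgt; apply/negP => Bl.
move/cvgrPdist_lt : fl => /(_ (l - B)).
rewrite subr_gt0 => /(_ Bl)[A _ /(_ A (fsubset_refl _))] /=.
by rewrite psumE ltr_norml => /andP[_ +]; have := fB A; lra.
Qed.

(** Partial sums of a nonnegative family increase along the net, so they converge to their
    supremum. *)
Lemma has_sum_ge0_exists f (B : R) : (forall i, 0 <= f i) ->
  (forall F, \sum_(i <- F) f i <= B) -> exists l, has_sum f l.
Proof.
move=> f0 fB; pose E := range (fun F => \sum_(i <- F) f i).
have E0 : E !=set0 by exists (\sum_(i <- fset0) f i), fset0.
have Eub : has_ubound E by exists B => _ [F _ <-].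
exists (sup E); apply/cvgrPdist_lt => e e0.
have [_ [A _ <-] Ae] := sup_adherent e0 (conj E0 Eub).
exists A => // F /= AF; rewrite psumE.
have := ler_sum_fsubset f0 AF.
have : \sum_(i <- F) f i <= sup E by apply: ub_le_sup => //; exists F.
by rewrite ltr_norml => ? ?; apply/andP; split; lra.
Qed.

(** The family is the difference of [|f| + f] and [|f|], both nonnegative with bounded partial
    sums. *)
Lemma has_sum_exists f (B : R) : (forall F, \sum_(i <- F) `|f i| <= B) ->
  exists l, has_sum f l.
Proof.
move=> fB.
have [k hk] := has_sum_ge0_exists (fun i => normr_ge0 (f i)) fB.
have [|F|l hl] := @has_sum_ge0_exists (fun i => `|f i| + f i) (B + B).
- by move=> i; rewrite -lerBlDr sub0r; have := ler_norm (- f i); rewrite normrN; lra.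
- rewrite big_split lerD //; apply: (le_trans _ (fB F)); apply: ler_sum => i _; exact: ler_norm.
exists (l - k); have := has_sumB hl hk; congr has_sum.
by apply/funext => i; rewrite addrC addKr.
Qed.

End NetSums.

(** * The perturbed spectrum *)

Section FiniteMinima.
Context {R : realType} {I : eqType}.

Lemma exists_argmin (g : I -> R) (s : seq I) x : x \in s ->
  exists2 y, y \in s & forall z, z \in s -> g y <= g z.
Proof.
elim: s x => // a [|b s] IH x.
  by move=> _; exists a; rewrite ?mem_head// => z; rewrite inE => /eqP ->.
move=> _; have [y ys yP] := IH b (mem_head _ _).
have [ay|ya] := leP (g a) (g y).
  by exists a; [exact: mem_head|move=> z; rewrite inE => /predU1P[->//|/yP]; exact: le_trans].
exists y; first by rewrite inE ys orbT.
by move=> z; rewrite inE => /predU1P[->|/yP//]; exact: ltW.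
Qed.

Lemma exists_pos_lb (g : I -> R) (s : seq I) : (forall x, x \in s -> 0 < g x) ->
  exists2 d : R, 0 < d & forall x, x \in s -> d <= g x.
Proof.
case: s => [_|a s gs]; first by exists 1.
have [y ys yP] := exists_argmin g (mem_head a s).
by exists (g y) => //; exact: gs.
Qed.

End FiniteMinima.

Section Spectrum.
Context {R : realType} {I : choiceType} (q : I -> R) (C : R) (level : R -> {fset I}) (i0 : I).
Hypothesis q_ge0 : forall i, 0 <= q i.
Hypothesis levelP : forall (y : R) i, (i \in level y) = (q i <= y).
Hypothesis card_level : forall x : R, 0 <= x -> #|` level (x ^+ 2)|%:R <= C * (1 + x) ^+ 3.
Implicit Types (F A : {fset I}).

Lemma level_const_ge0 : 0 <= C.
Proof. by have := card_level (lexx 0); rewrite addr0 expr1n mulr1; apply: le_trans. Qed.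

(** Passing from x = 2^K to 2x adds at most 27 C x^3 indices, each of weight at most x^-4. The
    geometric series of the gains 27 C / x is the term 54 C (1 - 2^-K), and 8 C covers the level q
    <= 1. *)
Lemma sum_dyadic K : \sum_(i <- level ((2 ^+ K) ^+ 2)) (1 + q i) ^- 2 <=
  8 * C + 54 * C * (1 - 2 ^- K).
Proof.
elim: K => [|K IH].
  rewrite expr0 invr1 subrr mulr0 addr0.
  apply: (@le_trans _ _ (\sum_(i <- level (1 ^+ 2)) 1)).
    rewrite ler_sum// => i _; rewrite invf_le1 ?exprn_gt0 ?ltr_wpDr//.
    by rewrite exprn_ege1// lerDl.
  rewrite big_const_seq count_predT iter_addr_0.
  by have := card_level ler01; lra.
set x : R := 2 ^+ K; have x1 : 1 <= x by rewrite exprn_ege1// ler1n.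
have xE : (2 : R) ^+ K.+1 = 2 * x by rewrite exprS.
have sub : (level (x ^+ 2) `<=` level ((2 ^+ K.+1) ^+ 2))%fset.
  by apply/fsubsetP => i; rewrite !levelP xE => /le_trans -> //; nra.
rewrite (big_fsetID _ (mem (level (x ^+ 2)))) /=.
have -> : [fset i | i in level ((2 ^+ K.+1) ^+ 2) & i \in level (x ^+ 2)]%fset = level (x ^+ 2).
  apply/fsetP => i; rewrite !inE /= andbC.
  by case: (boolP (i \in level (x ^+ 2))) => //= /(fsubsetP sub).
have H : \sum_(i <- [fset i | i in level ((2 ^+ K.+1) ^+ 2) & i \notin level (x ^+ 2)]%fset)
    (1 + q i) ^- 2 <= 27 * C * x^-1.
  apply: (@le_trans _ _ (\sum_(i <- level ((2 * x) ^+ 2)) x ^- 4)); last first.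
    rewrite big_const_seq count_predT iter_addr_0 -[leLHS]mulr_natl.
    have x40 : 0 < x ^- 4 by rewrite invr_gt0 exprn_gt0//; lra.
    apply: (@le_trans _ _ (C * (1 + 2 * x) ^+ 3 * x ^- 4)).
      by apply: ler_wpM2r; [exact: ltW|apply: card_level; lra].
    have h : (1 + 2 * x) ^+ 3 <= (3 * x) ^+ 3 by rewrite lerXn2r ?nnegrE; lra.
    have -> : 27 * C / x = C * (3 * x) ^+ 3 / x ^+ 4 by field; lra.
    by apply: ler_wpM2r; [exact: ltW|apply: ler_wpM2l => //; exact: level_const_ge0].
  rewrite -xE; apply: (@le_trans _ _
    (\sum_(i <- [fset i | i in level ((2 ^+ K.+1) ^+ 2) & i \notin level (x ^+ 2)]%fset) x ^- 4)).
    rewrite big_seq [leRHS]big_seq; apply: ler_sum => i; rewrite !inE /= levelP -ltNge => /andP[_ xi].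
    have qi := q_ge0 i.
    rewrite lef_pV2 ?posrE ?exprn_gt0//; try lra.
    rewrite (exprM x 2 2) lerXn2r ?nnegrE//; nra.
  apply: ler_sum_fsubset; first by move=> _; rewrite invr_ge0 exprn_ge0; lra.
  by apply/fsubsetP => i; rewrite !inE /= => /andP[].
apply: (le_trans (lerD IH H)).
rewrite xE -/x invfM; lra.
Qed.

(** 8 C + 54 C, the limit of the dyadic bounds in [sum_dyadic]. *)
Definition Csum := 62 * C.

Lemma sum_bound F : \sum_(i <- F) (1 + q i) ^- 2 <= Csum.
Proof.
have [n qn] : exists n : nat, forall i, i \in F -> q i <= n%:R.
  exists (Num.trunc (\sum_(i <- F) q i)).+1 => i iF.
  apply: le_trans (ltW (truncnS_gt _)); rewrite (big_fsetD1 i) //= lerDl sumr_ge0 //.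
apply: (@le_trans _ _ (\sum_(i <- level ((2 ^+ n) ^+ 2)) (1 + q i) ^- 2)).
  apply: ler_sum_fsubset => [i|]; first by rewrite invr_ge0 exprn_ge0 // addr_ge0.
  apply/fsubsetP => i /qn qi; rewrite levelP (le_trans qi)//.
  rewrite -exprM -natrX ler_nat (@leq_trans (2 ^ n)%N) ?leq_exp2l ?leq_pmulr//.
  exact/ltnW/ltn_expl.
apply: le_trans (sum_dyadic n) _.
have : 0 < (2 : R) ^- n by rewrite invr_gt0 exprn_gt0.
by have := level_const_ge0; rewrite /Csum; nra.
Qed.

Definition off (l : R) := forall i, l <> q i.

Lemma off_neq0 l i : off l -> q i - l != 0.
Proof. by move=> /(_ i) h; rewrite subr_eq0 eq_sym; apply/eqP. Qed.

(** Finitely many indices have q i <= 2 |l| + 1, and [off] keeps them at a positive distance [d]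
    from [l]; all others satisfy q i - l >= (1 + q i) / 2. *)
Lemma inv_bound l : off l -> exists2 B : R, 0 <= B & forall i, `|q i - l|^-1 <= B * (1 + q i)^-1.
Proof.
move=> ol.
have [|d d0 dP] := @exists_pos_lb _ _ (fun i => `|q i - l|) (level (2 * `|l| + 1)).
  by move=> i _; rewrite normr_gt0 off_neq0.
exists (2 + (2 * `|l| + 2) / d) => [|i].
  by rewrite addr_ge0 // divr_ge0 ?(ltW d0)// addr_ge0// mulr_ge0.
have n0 : 0 < `|q i - l| by rewrite normr_gt0 off_neq0.
have q1 : 0 < 1 + q i by have := q_ge0 i; lra.
rewrite ler_pdivlMr // mulrC ler_pdivrMr //.
have [qi|qi] := leP (q i) (2 * `|l| + 1).
  have /dP di : i \in level (2 * `|l| + 1) by rewrite levelP.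
  have h : (2 * `|l| + 2) / d * d = 2 * `|l| + 2 by rewrite divfK// gt_eqF.
  have h0 : 0 <= (2 * `|l| + 2) / d.
    by rewrite divr_ge0 ?(ltW d0)// addr_ge0// mulr_ge0.
  have := ler_wpM2l h0 di; have := normr_ge0 l; nra.
have := ler_normB (q i - l) (- l); rewrite opprK subrK normrN ger0_norm // => h.
have h0 : 0 <= (2 * `|l| + 2) / d.
  by rewrite divr_ge0 ?(ltW d0)// addr_ge0// mulr_ge0.
nra.
Qed.

(** The sum S of the overview; termwise it is the derivative of [resolvent]. *)
Definition resolvent2 (l : R) : R := summability.sum (fun i => (q i - l) ^- 2).

Lemma has_sum_resolvent2 l : off l -> has_sum (fun i => (q i - l) ^- 2) (resolvent2 l).
Proof.
move=> ol; have [B B0 BP] := inv_bound ol.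
have [|F|s hs] := @has_sum_ge0_exists _ _ (fun i => (q i - l) ^- 2) (B ^+ 2 * Csum).
- by move=> i; rewrite invr_ge0 sqr_ge0.
- apply: (@le_trans _ _ (\sum_(i <- F) B ^+ 2 * (1 + q i) ^- 2)).
    rewrite ler_sum // => i _; rewrite -!exprVn -exprMn -real_normK ?num_real // normfV.
    by rewrite lerXn2r ?nnegrE ?invr_ge0 // mulr_ge0 // invr_ge0 addr_ge0.
  by rewrite -mulr_sumr ler_wpM2l ?sqr_ge0 ?sum_bound.
by rewrite /resolvent2 (has_sumE hs).
Qed.

Lemma resolvent2_ge l F : off l -> \sum_(i <- F) (q i - l) ^- 2 <= resolvent2 l.
Proof. by move=> ol; apply: has_sum_ge (has_sum_resolvent2 ol) => i; rewrite invr_ge0 sqr_ge0. Qed.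

Lemma resolvent2_ge1 l i : off l -> (q i - l) ^- 2 <= resolvent2 l.
Proof. by move=> ol; have := resolvent2_ge [fset i]%fset ol; rewrite big_seq_fset1. Qed.

Lemma resolvent2_gt0 l : off l -> 0 < resolvent2 l.
Proof.
move=> ol; apply: lt_le_trans (resolvent2_ge1 i0 ol).
by rewrite invr_gt0 exprn_even_gt0 //= off_neq0.
Qed.

Definition resolvent_term (l : R) i := 1 / (q i - l) - q i / (q i ^+ 2 + 1).

Definition resolvent (l : R) : R := summability.sum (resolvent_term l).

(** The two fractions combine into (1 + l q) / ((q^2 + 1) (q - l)), which is O((1 + q)^-2), so
    [sum_bound] gives absolute convergence. The factor 2 comes from (1 + q)^2 <= 2 (q^2 + 1). *)
Lemma has_sum_resolvent l : off l -> has_sum (resolvent_term l) (resolvent l).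
Proof.
move=> ol; have [B B0 BP] := inv_bound ol.
have [|s hs] := @has_sum_exists _ _ (resolvent_term l) ((1 + `|l|) * (2 * B) * Csum).
  move=> F.
  apply: (@le_trans _ _ (\sum_(i <- F) (1 + `|l|) * (2 * B) * (1 + q i) ^- 2)); last first.
    rewrite -mulr_sumr ler_wpM2l ?sum_bound //.
    by rewrite !mulr_ge0 // addr_ge0.
  rewrite ler_sum // => i _.
  have qi := q_ge0 i.
  have n0 := off_neq0 i ol.
  have q20 : 0 < q i ^+ 2 + 1 by rewrite ltr_wpDl ?sqr_ge0.
  have -> : resolvent_term l i = (1 + l * q i) / (q i ^+ 2 + 1) * (q i - l)^-1.
    by rewrite /resolvent_term; field; rewrite n0 gt_eqF.
  rewrite normrM normfV.
  apply: (@le_trans _ _ ((1 + `|l|) * (2 * (1 + q i)^-1) * (B * (1 + q i)^-1))); last first.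
    by rewrite le_eqVlt; apply/orP; left; apply/eqP; field; lra.
  apply: ler_pM; rewrite ?invr_ge0 //.
  rewrite normrM normfV (gtr0_norm q20) ler_pdivrMr //.
  apply: (@le_trans _ _ (1 + `|l| * q i)).
    by apply: le_trans (ler_normD _ _) _; rewrite normr1 normrM (ger0_norm qi).
  have l0 := normr_ge0 l.
  rewrite mulrAC mulrA ler_pdivlMr; last lra.
  rewrite -!mulrA; apply: (@le_trans _ _ ((1 + `|l|) * (1 + q i) * (1 + q i))).
    by apply: ler_wpM2r; nra.
  by rewrite -mulrA; apply: ler_wpM2l; [lra|have := sqr_ge0 (q i - 1); lra].
by rewrite /resolvent (has_sumE hs).
Qed.

(** The regularizing terms cancel in the difference. For [m < l] a term is positive unless q i lies
    between [m] and [l], which makes [resolvent] increase between consecutive values of q. *)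
Lemma has_sum_resolventB l m : off l -> off m ->
  has_sum (fun i => (l - m) / ((q i - l) * (q i - m))) (resolvent l - resolvent m).
Proof.
move=> ol om; have := has_sumB (has_sum_resolvent ol) (has_sum_resolvent om).
congr has_sum; apply/funext => i; rewrite /resolvent_term.
have := off_neq0 i ol; have := off_neq0 i om => h1 h2; field.
by rewrite h1 h2 gt_eqF // ltr_wpDl ?sqr_ge0.
Qed.

(* [new_eigenvalues a b c phi] unfolds to [new (nsq a b c) (c0 a b c * tan (phi / 2))]. *)
Definition new (tau : R) : set R := [set l | off l /\ resolvent l = tau].

(** Without a value of q in between, [resolvent] would increase strictly from [l] to [m], yet it
    equals [tau] at both. The index [i0] supplies a strictly positive term. *)
Lemma new_separated tau l m : new tau l -> new tau m -> l < m -> exists i, l < q i < m.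
Proof.
move=> [ol El] [om Em] lm; apply/not_existsP => no.
have pos i : 0 < (m - l) / ((q i - m) * (q i - l)).
  rewrite divr_gt0 ?subr_gt0//.
  have := no i; move/negP; rewrite negb_and -!leNgt => /orP[|] h.
    have h' : q i < l by rewrite lt_neqAle h andbT; apply/eqP => e; exact: (ol i).
    nra.
  have h' : m < q i by rewrite lt_neqAle h andbT; apply/eqP => e; exact: (om i).
  nra.
have := has_sum_ge [fset i0]%fset (fun i => ltW (pos i)) (has_sum_resolventB om ol).
by rewrite big_seq_fset1 Em El subrr leNgt pos.
Qed.

Section Gap.
Variables n1 n2 : R.
Hypothesis gap : forall i, q i <= n1 \/ n2 <= q i.

Lemma gap_off l : n1 < l < n2 -> off l.
Proof. by move=> /andP[h1 h2] i e; case: (gap i); rewrite -e leNgt ?h1 ?h2. Qed.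

(** If q i <= n1, both q i - x and q i - y are at least |q i - l1| in absolute value; if q i >= n2,
    at least |q i - l2|. So each term of the difference is dominated by a term of one of two
    convergent sums. *)
Lemma resolvent_lipschitz l1 l2 x y : n1 < l1 -> l2 < n2 ->
  l1 <= x -> x <= y -> y <= l2 ->
  0 <= resolvent y - resolvent x <= (resolvent2 l1 + resolvent2 l2) * (y - x).
Proof.
move=> nl1 ln2 lx xy yl.
have ox : off x by apply: gap_off; apply/andP; split; lra.
have oy : off y by apply: gap_off; apply/andP; split; lra.
have o1 : off l1 by apply: gap_off; apply/andP; split; lra.
have o2 : off l2 by apply: gap_off; apply/andP; split; lra.
have pos i : 0 < (q i - y) * (q i - x) by case: (gap i) => h; nra.
have := has_sum_resolventB oy ox => hs; apply/andP; split.
  apply: le_trans (has_sum_ge fset0 _ hs); first by rewrite big_seq_fset0.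
  by move=> i; rewrite divr_ge0 ?subr_ge0 // ltW.
apply: (has_sum_le _ hs) => F.
apply: (@le_trans _ _ (\sum_(i <- F) (y - x) * ((q i - l1) ^- 2 + (q i - l2) ^- 2))).
  apply: ler_sum => i _; apply: ler_wpM2l; first lra.
  have p1 : 0 < (q i - l1) ^+ 2 by rewrite exprn_even_gt0 //= off_neq0.
  have p2 : 0 < (q i - l2) ^+ 2 by rewrite exprn_even_gt0 //= off_neq0.
  case: (gap i) => h.
    apply: (@le_trans _ _ ((q i - l1) ^- 2)); last by rewrite lerDl invr_ge0 ltW.
    by rewrite lef_pV2 ?posrE //; nra.
  apply: (@le_trans _ _ ((q i - l2) ^- 2)); last by rewrite lerDr invr_ge0 ltW.
  by rewrite lef_pV2 ?posrE //; nra.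
rewrite -mulr_sumr big_split /= mulrC; apply: ler_wpM2r; first lra.
by apply: lerD; apply: resolvent2_ge.
Qed.

Lemma resolvent_continuous x : n1 < x < n2 -> {for x, continuous resolvent}.
Proof.
move=> /andP[nx xn].
pose l1 := (n1 + x) / 2; pose l2 := (x + n2) / 2.
have o1 : off l1 by apply: gap_off; apply/andP; split; rewrite /l1; lra.
have o2 : off l2 by apply: gap_off; apply/andP; split; rewrite /l2; lra.
pose L := resolvent2 l1 + resolvent2 l2 + 1.
have L0 : 0 < L by have := resolvent2_gt0 o1; have := resolvent2_gt0 o2; rewrite /L; lra.
apply/cvgrPdist_lt => e e0; apply/nbhs_ballP.
exists (Num.min (Num.min (l2 - x) (x - l1)) (e / L)) => /=.
  by rewrite !lt_min divr_gt0 // andbT; apply/andP; split; rewrite /l1 /l2; lra.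
move=> y; rewrite /ball /= !lt_min => /andP[/andP[h1 h2] h3].
have : L * `|x - y| < e by rewrite -ltr_pdivlMl // mulrC.
move: h1 h2; rewrite /L; have [xy|yx] := leP x y.
  rewrite !(distrC _ y) (ger0_norm (_ : 0 <= y - x)); last lra.
  move=> h1 h2 h4; have : 0 <= resolvent y - resolvent x <= (resolvent2 l1 + resolvent2 l2) * (y - x).
    by apply: resolvent_lipschitz; rewrite /l1 /l2 in h1 h2 *; lra.
  by case/andP => h5 h6; rewrite distrC ger0_norm //; nra.
rewrite (gtr0_norm (_ : 0 < x - y)); last lra.
move=> h1 h2 h4; have : 0 <= resolvent x - resolvent y <= (resolvent2 l1 + resolvent2 l2) * (x - y).
  by apply: resolvent_lipschitz; rewrite /l1 /l2 in h1 h2 *; lra.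
by case/andP => h5 h6; rewrite ger0_norm //; nra.
Qed.

(** All terms of the difference are nonnegative inside the gap, so any single one is a lower bound.
    For an index at an end of the gap it forces [resolvent] to be unbounded there. *)
Lemma resolvent_growth i l m : off l -> off m -> n1 < l -> l <= m -> m < n2 ->
  (m - l) / ((q i - m) * (q i - l)) <= resolvent m - resolvent l.
Proof.
move=> ol om nl lm mn.
have := has_sum_ge [fset i]%fset _ (has_sum_resolventB om ol).
rewrite big_seq_fset1; apply => j.
by rewrite divr_ge0 ?subr_ge0 //; case: (gap j) => h; nra.
Qed.

(** By [resolvent_growth], [resolvent] is at most [tau] close to [n1] and at least [tau] close to
    [n2]; the intermediate value theorem does the rest. *)
Lemma new_in_gap tau i j : q i = n1 -> q j = n2 -> n1 < n2 ->
  exists2 l, new tau l & n1 < l < n2.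
Proof.
move=> qi qj n12.
pose m := (n1 + n2) / 2; pose w := (n2 - n1) / 2.
have w0 : 0 < w by rewrite /w; lra.
have om : off m by apply: gap_off; apply/andP; split; rewrite /m; lra.
pose D := `|resolvent m - tau| + 1.
have D1 : 1 <= D by rewrite lerDr.
(* Between the midpoint and a point at distance d from an end, [resolvent] changes by at least (w -
   d) / (w d). This is at least 1 / (2 d) because d <= w / 2, and at least D because d <= 1 / (2
   D). *)
pose d := Num.min (w / 2) (1 / (2 * D)).
have d0 : 0 < d by rewrite lt_min !divr_gt0 //; lra.
have dw : d <= w / 2 by rewrite ge_min lexx.
have dD : D <= 1 / (2 * d).
  have : d <= 1 / (2 * D) by rewrite ge_min lexx orbT.
  rewrite ler_pdivlMr; last lra.
  by move=> h; rewrite ler_pdivlMr; nra.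
have half : 1 / (2 * d) <= (w - d) / (w * d).
  have -> : 1 / (2 * d) = (w / 2) / (w * d) by field; lra.
  by apply: ler_wpM2r; [rewrite invr_ge0 mulr_ge0; lra|lra].
have wE1 : m = n1 + w by rewrite /m /w; lra.
have wE2 : m = n2 - w by rewrite /m /w; lra.
have o1 : off (n1 + d) by apply: gap_off; apply/andP; split; lra.
have o2 : off (n2 - d) by apply: gap_off; apply/andP; split; lra.
have := ler_norm (resolvent m - tau); have := ler_norm (- (resolvent m - tau)).
rewrite normrN -/D => hm1 hm2.
have low : resolvent (n1 + d) <= tau.
  have := @resolvent_growth i (n1 + d) m o1 om.
  have -> : (q i - m) * (q i - (n1 + d)) = w * d by rewrite qi wE1; ring.
  have -> : m - (n1 + d) = w - d by rewrite wE1; ring.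
  by move=> h; have := h ltac:(lra) ltac:(lra) ltac:(lra); rewrite /D in dD; lra.
have high : tau <= resolvent (n2 - d).
  have := @resolvent_growth j m (n2 - d) om o2.
  have -> : (q j - (n2 - d)) * (q j - m) = w * d by rewrite qj wE2; ring.
  have -> : (n2 - d) - m = w - d by rewrite wE2; ring.
  by move=> h; have := h ltac:(lra) ltac:(lra) ltac:(lra); rewrite /D in dD; lra.
have [|||l] := @IVT R resolvent (n1 + d) (n2 - d) tau; [lra| |by rewrite ge_min low le_max high orbT|].
  apply: continuous_in_subspaceT => x; rewrite inE /= in_itv /= => /andP[h1 h2].
  by apply: resolvent_continuous; apply/andP; split; lra.
rewrite in_itv /= => /andP[h1 h2] El.
have h : n1 < l < n2 by apply/andP; split; lra.
by exists l => //; split => //; exact: gap_off.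
Qed.

End Gap.

(** Level sets are finite, so there is a smallest value of q above q i; together with q i it bounds
    a genuine gap, to which [new_in_gap] applies. *)
Lemma new_between tau i j : q i < q j -> exists2 l, new tau l & q i < l < q j.
Proof.
move=> qij.
pose s := [fset k | k in level (q j) & q i < q k]%fset.
have js : j \in s by rewrite !inE /= levelP lexx qij.
have [k + kP] := exists_argmin q js.
rewrite !inE /= levelP => /andP[qkj qik].
have [x|l nl /andP[h1 h2]] := @new_in_gap (q i) (q k) _ tau i k erefl erefl qik.
  have [|h] := leP (q x) (q i); [by left|right].
  have [h'|/ltW//] := leP (q x) (q k).
  by apply: kP; rewrite !inE /= levelP h (le_trans h').
by exists l => //; rewrite h1 (lt_le_trans h2).
Qed.

End Spectrum.

(** * Counting interlacing sets *)

Section Harmonic.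
Context {R : realType}.

Definition harm (n : nat) : R := \sum_(k < n) k.+1%:R^-1.

Lemma harm_ge0 n : 0 <= harm n.
Proof. by apply: sumr_ge0 => k _; rewrite invr_ge0. Qed.

Lemma le_harm m n : (m <= n)%N -> harm m <= harm n.
Proof.
move=> mn; rewrite /harm -!(big_mkord predT (fun k => k.+1%:R^-1)) [leRHS](big_cat_nat (n := m)) //=.
by rewrite lerDl sumr_ge0 // => k _; rewrite invr_ge0.
Qed.

(** Induction with ln (1 - 1 / (n + 2)) <= - 1 / (n + 2). *)
Lemma harm_le_ln n : harm n.+1 <= 1 + ln n.+1%:R.
Proof.
elim: n => [|n IH]; first by rewrite /harm big_ord_recl big_ord0 invr1 addr0 ln1 addr0.
rewrite /harm big_ord_recr /= -/(harm n.+1).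
have n2 : (0 : R) < n.+2%:R by [].
have : ln (1 - (n.+2%:R : R)^-1) <= - (n.+2%:R : R)^-1.
  by rewrite le_ln1Dx // ltrN2 invf_lt1 // ltr1n.
have -> : 1 - (n.+2%:R : R)^-1 = n.+1%:R / n.+2%:R.
  have e : n.+2%:R = n.+1%:R + 1 :> R by rewrite natr1.
  by rewrite e in n2 *; field; rewrite gt_eqF.
rewrite ln_div ?posrE // => h; apply: le_trans (lerD IH (lexx _)) _.
by rewrite -addrA lerD2l -lerBrDl -lerN2 opprB.
Qed.

End Harmonic.

Section Interlacing.
Context {R : realType} {I : choiceType} (q : I -> R) (Lam : set R) (S : R -> R).
Hypothesis separated : forall l m, Lam l -> Lam m -> l < m -> exists i, l < q i < m.
Implicit Types (F A : {fset I}) (s : seq R).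

(** One index is picked in each of the first k gaps of the increasing list; they are distinct
    because their values of q lie in disjoint intervals. *)
Lemma interlaced_chain x s : {in x :: s, forall l, Lam l} -> path <%R x s ->
  forall k, (k <= size s)%N -> exists F : {fset I},
   #|` F| = k /\ {in F, forall i, x < q i < nth 0 (x :: s) k}.
Proof.
move=> sL ps; elim=> [|k IH] ks; first by exists fset0; rewrite cardfs0.
have [F [Fk FP]] := IH (ltnW ks).
have L1 : Lam (nth 0 (x :: s) k) by apply/sL/mem_nth; rewrite ltnS ltnW.
have L2 : Lam (nth 0 (x :: s) k.+1) by apply/sL/mem_nth.
have lt12 : nth 0 (x :: s) k < nth 0 (x :: s) k.+1 by move/pathP : ps; apply.
have [i /andP[i1 i2]] := separated L1 L2 lt12.
exists (i |` F)%fset; split.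
  rewrite cardfsU1 Fk; case: (boolP (i \in F)) => // /FP /andP[_].
  by rewrite ltNge (ltW i1).
move=> j; rewrite !inE => /predU1P[->|/FP/andP[-> h]].
  rewrite i2 andbT; apply: le_lt_trans i1.
  case: k ks {IH Fk FP L1 L2 lt12 i2} => //= k ks.
  have := order_path_min lt_trans ps => /allP/(_ (nth 0 s k)).
  by rewrite mem_nth ?(ltnW ks) // => /(_ isT)/ltW.
exact: lt_trans lt12.
Qed.

(** A list of n members has n - 1 gaps, each containing a value of q below X; hence the successor on
    the right. *)
Lemma size_le_card X (E : {fset I}) s : uniq s ->
  {in s, forall l, Lam l /\ l <= X} -> (forall i, q i <= X -> i \in E) ->
  (size s <= #|` E|.+1)%N.
Proof.
move=> us sP EP.
have := sort_lt_sorted s; rewrite us.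
have := perm_size (permEl (perm_sort <=%R s)) => <-.
case Er : (sort _ s) => [//|x r] /= pr.
have inS l : l \in x :: r -> l \in s by rewrite -Er mem_sort.
have [|F [Fk FP]] := interlaced_chain _ pr (leqnn _); first by move=> l /inS/sP[].
rewrite ltnS -Fk; apply: fsubset_leq_card; apply/fsubsetP => i /FP/andP[_ h].
apply: EP; apply: (le_trans (ltW h)).
have /inS/sP[//] : nth 0 (x :: r) (size r) \in x :: r by rewrite mem_nth.
Qed.

(** Consecutive members are separated by a value of q that is itself at least h above the lower one,
    so they are more than h apart. *)
Lemma size_le_far X h s : 0 <= X -> 0 < h -> uniq s ->
  {in s, forall l, [/\ Lam l, 0 <= l <= X & forall i, h <= `|q i - l|]} ->
  (size s)%:R <= X / h + 1.
Proof.
move=> X0 h0 us sP.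
have [s0|s0] := eqVneq (size s) 0%N.
  by rewrite s0 addr_ge0 // divr_ge0 // ltW.
have := sort_lt_sorted s; rewrite us.
have := perm_size (permEl (perm_sort <=%R s)) => sz.
rewrite -sz in s0 *.
have inS l : l \in sort <=%R s -> l \in s by rewrite mem_sort.
case E : (sort _ s) inS s0 => [//|x r] inS _ /= pr.
have step k : (k <= size r)%N -> k%:R * h <= nth 0 (x :: r) k.
  elim: k => [_|k IH kr].
    by rewrite mul0r; have /inS/sP[_ /andP[]] := mem_head x r.
  have k1 : nth 0 (x :: r) k \in x :: r by rewrite mem_nth // ltnS ltnW.
  have k2 : nth 0 (x :: r) k.+1 \in x :: r by rewrite mem_nth.
  have lt12 : nth 0 (x :: r) k < nth 0 (x :: r) k.+1 by move/pathP : pr; apply.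
  have [L1 _ f1] := sP _ (inS _ k1); have [L2 _ f2] := sP _ (inS _ k2).
  have [i /andP[i1 i2]] := separated L1 L2 lt12.
  have := f1 i; rewrite gtr0_norm ?subr_gt0 // => g1.
  have := IH (ltnW kr); rewrite -natr1 mulrDl mul1r; lra.
have := step _ (leqnn _).
have /inS/sP[_ /andP[_ lX] _] : nth 0 (x :: r) (size r) \in x :: r by rewrite mem_nth.
move=> /le_trans /(_ lX); rewrite -ler_pdivlMr // => hh.
by rewrite -natr1 lerD2r.
Qed.

Hypothesis S_ge : forall l F, Lam l -> \sum_(i <- F) (q i - l) ^- 2 <= S l.
Hypothesis S_gt0 : forall l, Lam l -> 0 < S l.

(** Between the first and the k-th member above q i (counted from 0) there are k values of q.
    Together with q i these are k + 1 values no farther from the k-th member than q i, so each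
    contributes at least the inverse square of that distance to S. *)
Lemma rank_bound i s : {in s, forall l, Lam l} -> path <%R (q i) s ->
  forall k, (k < size s)%N -> k.+1%:R * (q i - nth 0 s k) ^- 2 <= S (nth 0 s k).
Proof.
case: s => // x s sL /= /andP[ix ps] k; rewrite ltnS => ks.
have [F [Fk FP]] := interlaced_chain sL ps ks.
have iF : i \notin F by apply/negP => /FP /andP[]; rewrite ltNge (ltW ix).
have xk : x <= nth 0 (x :: s) k.
  case: k ks {Fk FP} => //= k ks.
  have := order_path_min lt_trans ps => /allP/(_ (nth 0 s k)).
  by rewrite mem_nth // => /(_ isT)/ltW.
have Lk : Lam (nth 0 (x :: s) k) by apply/sL/mem_nth.
apply: le_trans (S_ge (i |` F)%fset Lk).
set l := nth 0 (x :: s) k in FP xk Lk *.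
apply: (@le_trans _ _ (\sum_(j <- (i |` F)%fset) (q i - l) ^- 2)).
  have c : #|` (i |` F)%fset| = k.+1 by rewrite cardfsU1 iF Fk.
  by rewrite big_const_seq count_predT iter_addr_0 c -[leRHS]mulr_natl.
rewrite big_seq [leRHS]big_seq; apply: ler_sum => j; rewrite !inE => /predU1P[->//|/FP/andP[j1 j2]].
rewrite lef_pV2 ?posrE ?exprn_even_gt0 //=; try nra; rewrite subr_eq0 lt_eqF.
Qed.

(** After sorting the members above q i, [rank_bound] bounds the k-th ratio by 1 / (k + 1). *)
Lemma sum_ratio_gt i s : uniq s -> {in s, forall l, Lam l} ->
  \sum_(l <- s | q i < l) (q i - l) ^- 2 / S l <= harm (size s).
Proof.
move=> us sL.
rewrite -big_filter; set s' := seq.filter _ s.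
rewrite -(perm_big _ (permEl (perm_sort <=%R s'))) /=.
have sz : (size s' <= size s)%N by rewrite size_filter count_size.
apply: le_trans (le_harm sz).
rewrite -(perm_size (permEl (perm_sort <=%R s'))).
have srt : sorted <%R (sort <=%R s') by rewrite sort_lt_sorted filter_uniq.
have mem l : l \in sort <=%R s' -> Lam l /\ q i < l.
  by rewrite mem_sort mem_filter => /andP[-> /sL].
set r := sort _ s' in srt mem *.
have pr : path <%R (q i) r.
  by case: r srt mem => //= x r -> /(_ x (mem_head _ _))[_ ->].
rewrite (big_nth 0) /harm big_mkord ler_sum // => k _.
have /mem[Lk ik] : nth 0 r k \in r by rewrite mem_nth.
rewrite ler_pdivrMr ?S_gt0 // mulrC ler_pdivlMr // mulrC.
by apply: rank_bound => // l /mem[].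
Qed.

End Interlacing.

Section InterlacingTwoSided.
Context {R : realType} {I : choiceType} (q : I -> R) (Lam : set R) (S : R -> R).
Hypothesis separated : forall l m, Lam l -> Lam m -> l < m -> exists i, l < q i < m.
Hypothesis S_ge : forall l (F : {fset I}), Lam l -> \sum_(i <- F) (q i - l) ^- 2 <= S l.
Hypothesis S_gt0 : forall l, Lam l -> 0 < S l.
Hypothesis Lam_off : forall l i, Lam l -> l != q i.

(** Reflection of the line: [sum_ratio_gt] is applied to - q and to the negatives of the members. *)
Lemma sum_ratio_lt i s : uniq s -> {in s, forall l, Lam l} ->
  \sum_(l <- s | l < q i) (q i - l) ^- 2 / S l <= harm (size s).
Proof.
move=> us sL.
have := @sum_ratio_gt R I (fun i => - q i) [set l | Lam (- l)] (S \o -%R) _ _ _ i (map -%R s).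
rewrite size_map big_map (map_inj_uniq (@oppr_inj R)).
rewrite (eq_bigl (fun l => l < q i)); last by move=> l; rewrite /= ltrN2.
rewrite (eq_bigr (fun l => (q i - l) ^- 2 / S l)); last first.
  by move=> l _; rewrite /= -opprD sqrrN opprK.
apply => //.
- move=> l m /= Ll Lm lm; have [|j /andP[j1 j2]] := separated Lm Ll; first by rewrite ltrN2.
  by exists j; apply/andP; split; lra.
- move=> l F /= Ll; apply: le_trans (S_ge F Ll).
  by apply: ler_sum => j _; rewrite -opprD sqrrN opprK.
- by move=> l /= /S_gt0.
- by move=> _ /mapP[l /sL Ll ->] /=; rewrite opprK.
Qed.

Lemma sum_ratio i s : uniq s -> {in s, forall l, Lam l} ->
  \sum_(l <- s) (q i - l) ^- 2 / S l <= 2 * harm (size s).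
Proof.
move=> us sL; rewrite (bigID (fun l => q i < l)) /= mulr2n mulrDl mul1r.
apply: lerD; first exact: (sum_ratio_gt separated S_ge S_gt0).
rewrite big_seq_cond (eq_bigl (fun l => (l \in s) && (l < q i))) -?big_seq_cond.
  exact: sum_ratio_lt.
move=> l; case: (boolP (l \in s)) => //= /sL/Lam_off-/(_ i) li.
by rewrite -leNgt le_eqVlt (negbTE li).
Qed.

(** Double counting of the ratios (q i - l)^-2 / S l over [s] and [A]: each [l] collects at least
    [eps], each [i] at most twice a harmonic sum. *)
Lemma size_le_heavy (A : {fset I}) eps s : uniq s ->
  {in s, forall l, Lam l /\ eps * S l <= \sum_(i <- A) (q i - l) ^- 2} ->
  eps * (size s)%:R <= #|` A|%:R * (2 * harm (size s)).
Proof.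
move=> us sP.
have -> : eps * (size s)%:R = \sum_(l <- s) eps.
  by rewrite big_const_seq count_predT iter_addr_0 mulr_natr.
apply: (@le_trans _ _ (\sum_(l <- s) \sum_(i <- A) (q i - l) ^- 2 / S l)).
  rewrite big_seq [leRHS]big_seq; apply: ler_sum => l /sP[Ll h].
  by rewrite -mulr_suml ler_pdivlMr ?S_gt0.
rewrite exchange_big /=.
have -> : #|` A|%:R * (2 * harm (size s)) = \sum_(i <- A) (2 * harm (size s)) :> R.
  by rewrite big_const_seq count_predT iter_addr_0 mulr_natl.
by apply: ler_sum => i _; apply: sum_ratio => // l /sP[].
Qed.

Hypothesis between : forall i j, q i < q j -> exists2 l, Lam l & q i < l < q j.

(** After sorting [v] by [q], one member is placed in each gap between consecutive values. The
    comparison with some q i, i in [v], keeps the members below a given level. *)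
Lemma exists_interlaced v : uniq (map q v) -> exists s, [/\ uniq s,
  (size v <= (size s).+1)%N & {in s, forall l, Lam l /\ exists2 i, i \in v & l <= q i}].
Proof.
move=> uv.
pose leq_ (i j : I) := q i <= q j.
have tot : total leq_ by move=> i j; exact: le_total.
have srt : sorted <%R (map q (sort leq_ v)).
  rewrite lt_sorted_uniq_le (perm_uniq (perm_map q (permEl (perm_sort leq_ v)))) uv /=.
  rewrite sorted_map; exact: sort_sorted.
have szv : size (sort leq_ v) = size v by rewrite size_sort.
have memv i : i \in sort leq_ v -> i \in v by rewrite mem_sort.
rewrite -szv; move: (sort _ v) srt memv => {szv tot leq_ uv} [|x r] srt memv.
  by exists [::].
suff [s [ps sz sP]] : exists s, [/\ path <%R (q x) s, size s = size r &
    {in s, forall l, Lam l /\ exists2 i, i \in r & l <= q i}].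
  exists s; split; [|by rewrite /= sz|].
    exact: (sorted_uniq lt_trans ltxx (path_sorted ps)).
  by move=> l /sP[Ll [i ir li]]; split => //; exists i => //; rewrite memv // inE ir orbT.
elim: r x srt {memv} => [|y r IH] x /=; first by exists [::].
move=> /andP[xy pr]; have [s [ps sz sP]] := IH _ pr.
have [l Ll /andP[xl ly]] := between xy.
exists (l :: s); split; rewrite /= ?sz ?xl //=.
  by case: s ps {sz sP} => //= z s /andP[yz ->]; rewrite (lt_trans ly).
move=> m; rewrite inE => /predU1P[->|/sP[Lm [i ir mi]]].
  by split => //; exists y; rewrite ?mem_head // ltW.
by split => //; exists i; rewrite // inE ir orbT.
Qed.

End InterlacingTwoSided.

(** * Lattice points *)

Section Counting.
Context {R : realType}.

Lemma size_le_fibers (T U : eqType) (f : T -> U) (t : seq U) (K : R) (s : seq T) :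
  0 <= K -> {in s, forall x, f x \in t} ->
  (forall y, (size [seq x <- s | f x == y])%:R <= K) ->
  (size s)%:R <= (size t)%:R * K.
Proof.
move=> K0; elim: t s => [|y t IH] s st sK.
  case: s st {sK} => [|x s] st; first by rewrite mul0r.
  by have := st x (mem_head _ _).
rewrite /= -add1n natrD mulrDl mul1r.
rewrite -(count_predC (fun x => f x == y) s) -!size_filter natrD.
apply: lerD; first exact: sK.
apply: IH => [x|z].
  by rewrite mem_filter /= => /andP[/negbTE fx] /st; rewrite inE fx.
apply: le_trans (sK z); rewrite ler_nat -filter_predI.
rewrite !size_filter; apply: sub_count => x /=.
by case/andP.
Qed.

Lemma size_int_le (s : seq int) (L : R) : 0 <= L -> uniq s ->
  {in s &, forall z w, (z - w)%:~R <= L} -> (size s)%:R <= L + 1.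
Proof.
move=> L0 us sL; case: s us sL => [|z0 s']; first by move=> _ _; rewrite addr_ge0.
set s := z0 :: s'; move=> us sL.
have [z zs zP] : exists2 y, y \in s & forall z, z \in s -> y <= z.
  have [y ys yP] := @exists_argmin R _ (fun z : int => z%:~R) s _ (mem_head z0 s').
  by exists y => // w /yP; rewrite ler_int.
have inj : {in s &, injective (fun w => `|w - z|%N)}.
  move=> w1 w2 /zP h1 /zP h2 /= ; lia.
have : (size (map (fun w : int => `|w - z|%N) s) <= size (iota 0 (Num.truncn L).+1))%N.
  apply: uniq_leq_size; first by rewrite map_inj_in_uniq.
  move=> _ /mapP[w ws ->]; rewrite mem_iota /= add0n ltnS truncn_ge_nat //.
  by rewrite natr_absz ger0_norm ?subr_ge0 ?zP // sL.
rewrite size_map size_iota => h.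
apply: (@le_trans _ _ (Num.truncn L).+1%:R); first by rewrite ler_nat.
by rewrite -natr1 lerD2r truncn_le.
Qed.

(** Once [g x] is fixed, the strip condition confines the integer [f x] to an interval of length 2 M
    / |al|. *)
Lemma size_strip_le (T U : eqType) (f : T -> int) (g : T -> U) (t : seq U)
    (al M : R) (be : U -> R) (s : seq T) :
  al != 0 -> 0 <= M -> uniq s -> {in s &, injective (fun x => (f x, g x))} ->
  {in s, forall x, g x \in t /\ `|al * (f x)%:~R + be (g x)| < M} ->
  (size s)%:R <= (size t)%:R * (2 * M / `|al| + 1).
Proof.
move=> al0 M0 us inj sP.
have a0 : 0 < `|al| by rewrite normr_gt0.
have K0 : 0 <= 2 * M / `|al| by rewrite divr_ge0 // mulr_ge0.
apply: (size_le_fibers (f := g)); [by rewrite addr_ge0|by move=> x /sP[]|move=> y].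
rewrite -(size_map f); apply: size_int_le => //.
  rewrite map_inj_in_uniq ?filter_uniq // => x1 x2.
  rewrite !mem_filter => /andP[/eqP g1 x1s] /andP[/eqP g2 x2s] f12.
  by apply: inj => //; rewrite f12 g1 g2.
move=> _ _ /mapP[x1 + ->] /mapP[x2 + ->].
rewrite !mem_filter => /andP[/eqP g1 /sP[_ h1]] /andP[/eqP g2 /sP[_ h2]].
rewrite ler_pdivlMr //.
have : `|al * (f x1 - f x2)%:~R| <= 2 * M.
  have -> : al * (f x1 - f x2)%:~R = (al * (f x1)%:~R + be (g x1)) - (al * (f x2)%:~R + be (g x2)).
    by rewrite g1 g2 rmorphB /=; ring.
  by apply: le_trans (ler_normB _ _) _; lra.
rewrite normrM mulrC; apply: le_trans; apply: ler_wpM2r; [exact: ltW|exact: ler_norm].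
Qed.

End Counting.

Section Cube.

Definition zrange (n : nat) : seq int := [seq (Posz k - Posz n)%R | k <- iota 0 (2 * n + 1)].

Lemma mem_zrange n (z : int) : (z \in zrange n) = (`|z| <= n)%N.
Proof.
apply/mapP/idP => [[k]|zn]; first by rewrite mem_iota => ? ->; lia.
by exists (absz (z + Posz n)); [rewrite mem_iota; lia|lia].
Qed.

Lemma size_zrange n : size (zrange n) = (2 * n + 1)%N.
Proof. by rewrite size_map size_iota. Qed.

Definition cube n : seq (int * int * int) :=
  [seq (p, z) | p <- [seq (x, y) | x <- zrange n, y <- zrange n], z <- zrange n].

Lemma mem_cube n m : (m \in cube n) = [&& (`|m.1.1| <= n)%N, (`|m.1.2| <= n)%N & (`|m.2| <= n)%N].
Proof.
case: m => [[x y] z]; rewrite -!mem_zrange /=.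
apply/allpairsP/and3P => [[[[x' y'] z'] [/= /allpairsP[[x2 y2] [/= ? ? [-> ->]]] ? [-> -> ->]]]|[xn yn zn]] //.
by exists ((x, y), z); split => //; apply/allpairsP; exists (x, y).
Qed.

Lemma size_cube n : size (cube n) = ((2 * n + 1) ^ 3)%N.
Proof. by rewrite !size_allpairs !size_zrange !expnS expn0 muln1 mulnA. Qed.

End Cube.

Section Lattice.
Context {R : realType} (a b c : R).
Hypotheses (ha : 0 < a) (hb : 0 < b) (hc : 0 < c).
Notation nsq := (nsq a b c).
Notation I := (int * int * int)%type.

Lemma nsqE m : nsq m = (m.1.1%:~R / a) ^+ 2 + (m.1.2%:~R / b) ^+ 2 + (m.2%:~R / c) ^+ 2.
Proof. by rewrite /nsq /dot /= !expr2. Qed.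

Lemma nsq_ge0 m : 0 <= nsq m.
Proof. by rewrite nsqE !addr_ge0 // sqr_ge0. Qed.

Let D := a + b + c.

Let D_gt0 : 0 < D. Proof. by rewrite /D !addr_gt0. Qed.
Let leaD : a <= D. Proof. by rewrite /D -addrA lerDl addr_ge0 // ltW. Qed.
Let lebD : b <= D. Proof. by rewrite /D addrAC lerDr addr_ge0 // ltW. Qed.
Let lecD : c <= D. Proof. by rewrite /D lerDr addr_ge0 // ltW. Qed.

(** If q m <= Y, a coordinate of m belonging to the side e is at most e sqrt Y in absolute value,
    and a + b + c dominates every side. *)
Definition level_size (Y : R) : nat := Num.truncn ((a + b + c) * Num.sqrt Y).

Definition level (Y : R) : {fset I} := [fset m in cube (level_size Y) | nsq m <= Y]%fset.

Lemma coord_bound (e Y : R) (z : int) : 0 < e -> e <= D -> (z%:~R / e) ^+ 2 <= Y ->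
  (`|z| <= level_size Y)%N.
Proof.
move=> e0 eD h; rewrite /level_size truncn_ge_nat; last first.
  by rewrite mulr_ge0 ?sqrtr_ge0 // !addr_ge0 // ltW.
have Y0 : 0 <= Y by apply: le_trans h; exact: sqr_ge0.
have : `|z%:~R / e| <= Num.sqrt Y by rewrite -sqrtr_sqr ler_wsqrtr.
rewrite normrM normfV (gtr0_norm e0) ler_pdivrMr // => h2.
rewrite natr_absz -intr_norm in h2 *.
by apply: le_trans h2 _; rewrite mulrC ler_wpM2r ?sqrtr_ge0.
Qed.

Lemma levelP Y (m : I) : (m \in level Y) = (nsq m <= Y).
Proof.
rewrite !inE /= andb_idl // nsqE => h; rewrite mem_cube.
have := sqr_ge0 (m.1.1%:~R / a); have := sqr_ge0 (m.1.2%:~R / b).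
have := sqr_ge0 (m.2%:~R / c) => h1 h2 h3.
by apply/and3P; split; [apply: (coord_bound ha leaD)|apply: (coord_bound hb lebD)|apply: (coord_bound hc lecD)]; lra.
Qed.

Definition Clev := (1 + 2 * (a + b + c)) ^+ 3.

Lemma level_size_le (x : R) : 0 <= x -> (2 * level_size (x ^+ 2) + 1)%:R <= (1 + 2 * D) * (1 + x).
Proof.
move=> x0; rewrite natrD natrM /level_size sqrtr_sqr ger0_norm // -/D.
have : (Num.truncn (D * x))%:R <= D * x by rewrite truncn_le // mulr_ge0 // ltW.
have := D_gt0; nra.
Qed.

(** The level set lies in an integer cube with 2 [level_size] + 1 points on a side. *)
Lemma card_level (x : R) : 0 <= x -> #|` level (x ^+ 2)|%:R <= Clev * (1 + x) ^+ 3.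
Proof.
move=> x0; rewrite /Clev -exprMn -/D.
have D0 := D_gt0.
apply: (@le_trans _ _ ((2 * level_size (x ^+ 2) + 1)%:R ^+ 3)); last first.
  by rewrite lerXn2r ?nnegrE ?level_size_le // mulr_ge0; lra.
rewrite -natrX -size_cube ler_nat; apply: uniq_leq_size; first exact: fset_uniq.
by move=> m; rewrite !inE /= => /andP[].
Qed.

(** The increment of [nsq] under the shift z. It is affine in m, so bounding it confines m to a slab
    between parallel planes. *)
Definition cross (m z : I) : R := 2 * dot (dual_vec a b c m) (dual_vec a b c z) + nsq z.

Lemma nsqD m z : nsq (m + z) = nsq m + cross m z.
Proof. by rewrite /cross !nsqE /dot /= !rmorphD /=; field; rewrite !gt_eqF. Qed.

Lemma crossN m z : cross (m + z) (- z) = - cross m z.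
Proof. by rewrite /cross !nsqE /dot /= !rmorphD !rmorphN /=; field; rewrite !gt_eqF. Qed.

(** Solve for a coordinate along which z does not vanish: the other two take at most (2 n + 1)^2
    values, and its coefficient 2 w / e^2 is at least 2 / D^2 in absolute value because w is a
    nonzero integer and e <= D. *)
Lemma size_slab1 (s : seq I) (z : I) (M : R) n : 0 <= M -> uniq s -> z != 0 ->
  {in s, forall m, m \in cube n /\ `|cross m z| < M} ->
  (size s)%:R <= (2 * n + 1)%:R ^+ 2 * (D ^+ 2 * M + 1).
Proof.
move=> M0 us z0 sP.
pose t := [seq (x, y) | x <- zrange n, y <- zrange n].
have st : (size t)%:R = (2 * n + 1)%:R ^+ 2 :> R.
  by rewrite size_allpairs size_zrange natrM expr2.
have main (e : R) (w : int) : 0 < e -> e <= D -> w != 0 ->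
    2 * M / `|2 * w%:~R / e ^+ 2| <= D ^+ 2 * M.
  move=> e0 eD w0.
  have w1 : 1 <= `|w%:~R| :> R by rewrite -intr_norm ler1z -gtz0_ge1 normr_gt0.
  have e20 : 0 < e ^+ 2 by rewrite exprn_gt0.
  rewrite !normrM normfV (gtr0_norm e20) ger0_norm //.
  have -> : 2 * M / (2 * `|w%:~R| / e ^+ 2) = e ^+ 2 * M / `|w%:~R| by field; lra.
  rewrite ler_pdivrMr; last lra.
  have : e ^+ 2 <= D ^+ 2 by rewrite lerXn2r ?nnegrE; lra.
  move=> h; apply: (le_trans (ler_wpM2r M0 h)).
  by apply: ler_peMr => //; rewrite mulr_ge0 ?sqr_ge0.
have fin (f : I -> int) (g : I -> int * int) (e : R) w be : 0 < e -> e <= D -> w != 0 ->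
    injective (fun x => (f x, g x)) -> (forall m, m \in cube n -> g m \in t) ->
    (forall m, cross m z = 2 * w%:~R / e ^+ 2 * (f m)%:~R + be (g m)) ->
    (size s)%:R <= (2 * n + 1)%:R ^+ 2 * (D ^+ 2 * M + 1).
  move=> e0 eD w0 inj gt cE.
  apply: (@le_trans _ _ ((size t)%:R * (2 * M / `|2 * w%:~R / e ^+ 2| + 1))).
    apply: (size_strip_le (f := f) (g := g) (be := be)) => //.
    - by rewrite mulf_neq0 ?invr_neq0 ?expf_neq0 ?(gt_eqF e0) // mulf_neq0 ?pnatr_eq0 ?intr_eq0.
    - by move=> x y _ _ /inj.
    - by move=> m /sP[mc]; rewrite cE; split => //; exact: gt.
  by rewrite st ler_wpM2l ?sqr_ge0 // lerD2r main.
have tP x y : ((x, y) \in t) = (`|x| <= n)%N && (`|y| <= n)%N.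
  rewrite -!mem_zrange; apply/allpairsP/andP => [[[x' y'] [/= ? ? [-> ->]]]|[xn yn]] //.
  by exists (x, y).
case: z z0 sP fin => [[z1 z2] z3] z0 sP fin.
have [z1E|z10] := eqVneq z1 0; last first.
  apply: (fin (fun m => m.1.1) (fun m => (m.1.2, m.2)) a z1
    (fun y => 2 * (y.1%:~R * z2%:~R / b ^+ 2 + y.2%:~R * z3%:~R / c ^+ 2) + nsq (z1, z2, z3))) => //.
  - by move=> [[x1 x2] x3] [[y1 y2] y3] /= [-> -> ->].
  - by move=> m; rewrite mem_cube tP => /and3P[_ -> ->].
  - by move=> m; rewrite /cross /dot /=; field; rewrite !gt_eqF.
have [z2E|z20] := eqVneq z2 0; last first.
  apply: (fin (fun m => m.1.2) (fun m => (m.1.1, m.2)) b z2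
    (fun y => 2 * (y.1%:~R * z1%:~R / a ^+ 2 + y.2%:~R * z3%:~R / c ^+ 2) + nsq (z1, z2, z3))) => //.
  - by move=> [[x1 x2] x3] [[y1 y2] y3] /= [-> -> ->].
  - by move=> m; rewrite mem_cube tP => /and3P[-> _ ->].
  - by move=> m; rewrite /cross /dot /=; field; rewrite !gt_eqF.
have z30 : z3 != 0 by apply: contra_neq z0 => ->; rewrite z1E z2E.
apply: (fin (fun m => m.2) (fun m => (m.1.1, m.1.2)) c z3
  (fun y => 2 * (y.1%:~R * z1%:~R / a ^+ 2 + y.2%:~R * z2%:~R / b ^+ 2) + nsq (z1, z2, z3))) => //.
- by move=> [[x1 x2] x3] [[y1 y2] y3] /= [-> -> ->].
- by move=> m; rewrite mem_cube tP => /and3P[-> -> _].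
- by move=> m; rewrite /cross /dot /=; field; rewrite !gt_eqF.
Qed.

Definition resonant (k : nat) (M : R) (m : I) :=
  has (fun z => (z != 0) && (`|cross m z| < M)) (cube k).

Definition slab (k : nat) (M Y : R) : {fset I} := [fset m in level Y | resonant k M m]%fset.

(** Each resonant point is sent to the first shift z in the cube that witnesses its resonance; the
    fibers are slabs, counted by [size_slab1]. *)
Lemma card_slab k (M x : R) : 0 <= M -> 0 <= x ->
  #|` slab k M (x ^+ 2)|%:R <=
    (2 * k + 1)%:R ^+ 3 * (((1 + 2 * D) * (1 + x)) ^+ 2 * (D ^+ 2 * M + 1)).
Proof.
move=> M0 x0; set s : seq I := slab k M (x ^+ 2).
have us : uniq s by exact: fset_uniq.
pose P m z := (z != 0) && (`|cross m z| < M).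
pose f m := nth 0 (cube k) (find (P m) (cube k)).
have sP m : m \in s -> [/\ m \in cube (level_size (x ^+ 2)), f m \in cube k & P m (f m)].
  rewrite !inE /= => /andP[/andP[h _] hm]; split => //; last exact: nth_find.
  by rewrite mem_nth // -has_find.
have D0 := D_gt0.
rewrite -natrX -size_cube; apply: (size_le_fibers (f := f)).
- by rewrite mulr_ge0 ?sqr_ge0 // addr_ge0 // mulr_ge0 // sqr_ge0.
- by move=> m /sP[].
move=> z; set s' := [seq _ <- _ | _].
have [s0|] := eqVneq s' [::].
  by rewrite s0 /= mulr_ge0 ?sqr_ge0 // addr_ge0 // mulr_ge0 // sqr_ge0.
rewrite -has_filter => /hasP[m0 m0s /eqP fm0].
apply: (@le_trans _ _ ((2 * level_size (x ^+ 2) + 1)%:R ^+ 2 * (D ^+ 2 * M + 1))).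
  apply: (@size_slab1 _ z) => //; first exact: filter_uniq.
    by have [_ _ /andP[]] := sP _ m0s; rewrite fm0.
  by move=> m; rewrite mem_filter => /andP[/eqP <- /sP[? _ /andP[]]].
rewrite ler_wpM2r ?addr_ge0 ?mulr_ge0 ?sqr_ge0 ?(ltW D0) //.
by rewrite lerXn2r ?nnegrE ?level_size_le // mulr_ge0; lra.
Qed.

Hypothesis hindep : lin_indep_Q (1 / a ^+ 2) (1 / b ^+ 2) (1 / c ^+ 2).

(** Changing the sign of a coordinate preserves [nsq], so the signs are fixed in order to obtain
    distinct values. *)
Definition octant n : seq I :=
  [seq (p, Posz z) | p <- [seq (Posz x, Posz y) | x <- iota 0 n, y <- iota 0 n], z <- iota 0 n].

Lemma size_octant n : size (octant n) = (n ^ 3)%N.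
Proof. by rewrite !size_allpairs !size_iota !expnS expn0 muln1 mulnA. Qed.

Lemma octantP n m : m \in octant n -> exists x y z : nat, [/\ m = (Posz x, Posz y, Posz z),
  (x < n)%N, (y < n)%N & (z < n)%N].
Proof.
case/allpairsP => [[p z] [/allpairsP[[x y] [/= xn yn ->]] zn ->]].
by exists x, y, z; rewrite !mem_iota /= !add0n in xn yn zn *.
Qed.

(** The differences of the squared coordinates are rational coefficients of a vanishing combination
    of 1/a^2, 1/b^2, 1/c^2, hence they are zero. *)
Lemma nsq_inj (x y z x' y' z' : nat) :
  nsq (Posz x, Posz y, Posz z) = nsq (Posz x', Posz y', Posz z') ->
  [/\ x = x', y = y' & z = z'].
Proof.
rewrite !nsqE /= => h.
have [] := hindep (p := (x ^ 2)%:R - (x' ^ 2)%:R) (q := (y ^ 2)%:R - (y' ^ 2)%:R)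
  (r := (z ^ 2)%:R - (z' ^ 2)%:R).
  rewrite !rmorphB /= !ratr_nat !natrX.
  move/eqP : h; rewrite -subr_eq0 => /eqP h; rewrite -[RHS]h.
  by rewrite -!pmulrn; field; rewrite !gt_eqF.
move=> /eqP + /eqP + /eqP; rewrite !subr_eq0 !eqr_nat !eqn_exp2r // => /eqP ? /eqP ? /eqP ?.
by split.
Qed.

Lemma uniq_nsq_octant n : uniq (map nsq (octant n)).
Proof.
have uo : uniq (octant n).
  apply: allpairs_uniq; [apply: allpairs_uniq| |]; rewrite ?iota_uniq //.
  - by move=> [x y] [x' y'] _ _ /= [-> ->].
  - by move=> [[x y] z] [[x' y'] z'] _ _ /= [-> -> ->].
rewrite map_inj_in_uniq // => m m' /octantP[x [y [z [-> _ _ _]]]] /octantP[x' [y' [z' [-> _ _ _]]]].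
by move=> /nsq_inj[-> -> ->].
Qed.

Lemma nsq_octant n m : m \in octant n -> nsq m <= (n%:R * (1 / a + 1 / b + 1 / c)) ^+ 2.
Proof.
move=> /octantP[x [y [z [-> xn yn zn]]]]; rewrite nsqE /= -!pmulrn.
have xn' : x%:R <= n%:R :> R by rewrite ler_nat ltnW.
have yn' : y%:R <= n%:R :> R by rewrite ler_nat ltnW.
have zn' : z%:R <= n%:R :> R by rewrite ler_nat ltnW.
have p (e : R) (w : nat) : 0 < e -> w%:R <= n%:R :> R -> 0 <= w%:R / e <= n%:R / e.
  by move=> e0 wn; rewrite divr_ge0 ?(ltW e0) //= ler_wpM2r // invr_ge0 ltW.
have /andP[? ?] := p a x ha xn'; have /andP[? ?] := p b y hb yn'.
have /andP[? ?] := p c z hc zn'.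
rewrite !mulrDr !mul1r; nra.
Qed.

End Lattice.

(** * Regular eigenvalues have density one *)

Section Root32.
Context {R : realType}.
Implicit Types x y T : R.

(** With t the 32nd root of lambda, all scales become integer powers: lambda^(1/2) = t^16 and
    lambda^(3/2) = t^48. *)
Definition root32 x : R := x `^ 32%:R^-1.

Lemma root32_ge0 x : 0 <= root32 x.
Proof. exact: powR_ge0. Qed.

Lemma root32X x : 0 <= x -> root32 x ^+ 32 = x.
Proof. by move=> x0; rewrite -powR_mulrn ?powR_ge0 // -powRrM mulVf ?pnatr_eq0 // powRr1. Qed.

Lemma root32_le x T : 0 <= x -> 0 <= T -> (root32 x <= T) = (x <= T ^+ 32).
Proof. by move=> x0 T0; rewrite -{2}(root32X x0) ler_pXn2r ?nnegrE ?root32_ge0. Qed.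

Lemma root32_ge x T : 0 <= x -> 0 <= T -> (T <= root32 x) = (T ^+ 32 <= x).
Proof. by move=> x0 T0; rewrite -{2}(root32X x0) ler_pXn2r ?nnegrE ?root32_ge0. Qed.

End Root32.

Section Density.
Context {R : realType} (a b c : R).
Hypotheses (ha : 0 < a) (hb : 0 < b) (hc : 0 < c).
Variable tau : R.
Notation q := (nsq a b c).
Notation I := (int * int * int)%type.
Notation Lam := (new q tau).
Notation S := (resolvent2 q).
Implicit Types (l T : R) (s : seq R).

Let D := a + b + c.
Let D_gt0 : 0 < D. Proof. by rewrite /D !addr_gt0. Qed.

Let q_ge0 := nsq_ge0 a b c.
Let lvl := levelP ha hb hc.
Let crd := card_level ha hb hc.
Let sep : forall l m, Lam l -> Lam m -> l < m -> exists i, l < q i < m :=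
  fun l m => new_separated (0 : I) q_ge0 lvl crd (tau := tau) (l := l) (m := m).
Let SLam l (F : {fset I}) : Lam l -> \sum_(i <- F) (q i - l) ^- 2 <= S l.
Proof. by case=> ol _; exact: (resolvent2_ge q_ge0 lvl crd). Qed.
Let SLam0 l : Lam l -> 0 < S l.
Proof. by case=> ol _; exact: (resolvent2_gt0 (0 : I) q_ge0 lvl crd). Qed.
Let offLam l (i : I) : Lam l -> l != q i.
Proof. by case=> ol _; apply/eqP. Qed.

Definition near_spectrum l := exists m : I, `|q m - l| < root32 l ^- 15.

(** At t = [root32 l] the level (2 t^16)^2 is 4 l, and 2 t^10 bounds |q (m + z) - q m| when m and m
    + z both lie within t^10 of l. *)
Definition resonant_points (t : R) : {fset I} :=
  slab a b c (Num.truncn t) (2 * t ^+ 10) ((2 * t ^+ 16) ^+ 2).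

Definition light l :=
  \sum_(m <- resonant_points (root32 l)) (q m - l) ^- 2 <= S l / root32 l.

(** The condition 1 <= l gives t >= 1, so that powers of t compare by their exponents. *)
Definition regular : set R :=
  [set l | [/\ Lam l, 1 <= l, near_spectrum l & light l]].

Lemma slabE k M Y m : (m \in slab a b c k M Y) = (q m <= Y) && resonant a b c k M m.
Proof. by have e := lvl Y m; rewrite /slab /level !inE /= in e *; rewrite e. Qed.

(** Monotonicity lets the single set at scale T serve for all l <= T^32. *)
Lemma resonant_points_sub (t T : R) : 0 <= t -> t <= T ->
  (resonant_points t `<=` resonant_points T)%fset.
Proof.
move=> t0 tT; apply/fsubsetP => m; rewrite !slabE => /andP[qm /hasP[z]].
rewrite mem_cube => /and3P[z1 z2 z3] /andP[z0 zM].
have kK : (Num.truncn t <= Num.truncn T)%N by rewrite le_truncn.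
apply/andP; split.
  apply: le_trans qm _; rewrite lerXn2r ?nnegrE ?mulr_ge0 ?exprn_ge0 //; try lra.
  by rewrite ler_wpM2l // lerXn2r ?nnegrE //; lra.
apply/hasP; exists z; first by rewrite mem_cube !(leq_trans _ kK).
rewrite z0 (lt_le_trans zM) // ler_wpM2l // lerXn2r ?nnegrE //; lra.
Qed.

Definition Cres := 27 * ((1 + 2 * D) ^+ 2 * (9 * (2 * D ^+ 2 + 1))).

(** The exponent is 45 = 3 + 2 * 16 + 10: the choice of the shift, the two free coordinates of the
    slab, and its thickness. *)
Lemma card_resonant_points T : 1 <= T -> #|` resonant_points T|%:R <= Cres * T ^+ 45.
Proof.
move=> T1; have T0 : 0 <= T by lra.
have [T10 T16] : 1 <= T ^+ 10 /\ 1 <= T ^+ 16 by rewrite !exprn_ege1.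
have M0 : 0 <= 2 * T ^+ 10 by rewrite mulr_ge0 ?exprn_ge0.
have x0 : 0 <= 2 * T ^+ 16 by rewrite mulr_ge0 ?exprn_ge0.
apply: le_trans (card_slab ha hb hc _ M0 x0) _; rewrite -/D.
have D0 := D_gt0.
have -> : Cres * T ^+ 45 = (3 * T) ^+ 3 * (((1 + 2 * D) * (3 * T ^+ 16)) ^+ 2 *
   ((2 * D ^+ 2 + 1) * T ^+ 10)) by rewrite /Cres; ring.
apply: ler_pM; rewrite ?exprn_ge0 //.
- by rewrite mulr_ge0 ?sqr_ge0 // addr_ge0 // mulr_ge0 ?sqr_ge0.
- rewrite lerXn2r ?nnegrE ?mulr_ge0 // natrD natrM.
  have : (Num.truncn T)%:R <= T by rewrite truncn_le.
  lra.
apply: ler_pM; rewrite ?sqr_ge0 //.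
- by rewrite addr_ge0 // mulr_ge0 ?sqr_ge0.
- rewrite lerXn2r ?nnegrE ?mulr_ge0 //; try lra.
  by rewrite ler_wpM2l; lra.
rewrite mulrDl mul1r; have := sqr_ge0 D; nra.
Qed.

Lemma size_low s : uniq s -> {in s, forall l, Lam l /\ l <= 1} ->
  (size s <= #|` level a b c 1|.+1)%N.
Proof. by move=> us sP; apply: (size_le_card sep us sP) => i; rewrite lvl. Qed.

(** Being far at the scale of l <= T^32 implies distance at least T^-15 from every q i, and
    [size_le_far] then gives T^32 / T^-15 + 1. *)
Lemma size_far T s : 1 <= T -> uniq s ->
  {in s, forall l, [/\ Lam l, 1 <= l <= T ^+ 32 & ~ near_spectrum l]} ->
  (size s)%:R <= T ^+ 47 + 1.
Proof.
move=> T1 us sP; have T0 : 0 < T by lra.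
have -> : T ^+ 47 = T ^+ 32 / T ^- 15 by rewrite invrK -exprD.
apply: (size_le_far sep _ _ us); rewrite ?invr_gt0 ?exprn_gt0 ?exprn_ge0 ?(ltW T0) //.
move=> l /sP[Ll /andP[l1 lT] nf]; split => //; first by rewrite lT andbT; lra.
move=> i; rewrite leNgt; apply/negP => h; apply: nf; exists i; apply: (lt_le_trans h).
have l0 : 0 <= l by lra.
have t1 : 1 <= root32 l by rewrite root32_ge // expr1n.
rewrite lef_pV2 ?posrE ?exprn_gt0 //; last lra.
by rewrite lerXn2r ?nnegrE ?root32_ge0 ?(ltW T0) // root32_le ?(ltW T0).
Qed.

Let C1 := 8 * Clev a b c + 2.

Let C1_ge1 : 1 <= C1.
Proof.
have : 0 <= Clev a b c by rewrite /Clev exprn_ge0 // addr_ge0 // mulr_ge0 // ltW.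
rewrite /C1; lra.
Qed.

(** A crude count for use inside a logarithm; the successor matches the form of [harm_le_ln]. *)
Lemma size_all T s : 1 <= T -> uniq s ->
  {in s, forall l, Lam l /\ l <= T ^+ 32} -> (size s).+1%:R <= C1 * T ^+ 48.
Proof.
move=> T1 us sP.
have T16 : 1 <= T ^+ 16 by rewrite exprn_ege1.
have T48 : 1 <= T ^+ 48 by rewrite exprn_ege1.
apply: (@le_trans _ _ (#|` level a b c ((T ^+ 16) ^+ 2)|.+2)%:R).
  by rewrite ler_nat ltnS; apply: (size_le_card sep us sP) => i; rewrite lvl -exprM.
rewrite -2!natr1 /C1.
have := crd (le_trans ler01 T16).
have : (1 + T ^+ 16) ^+ 3 <= 8 * T ^+ 48.
  rewrite (_ : 8 * T ^+ 48 = (2 * T ^+ 16) ^+ 3); last by ring.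
  by rewrite lerXn2r ?nnegrE; lra.
have C0 : 0 <= Clev a b c by rewrite /Clev exprn_ge0 // addr_ge0 // mulr_ge0 // ltW.
move=> /(ler_wpM2l C0); lra.
Qed.

Definition Charm := 49 + ln C1.

(** The harmonic sum is at most 1 + ln C1 + 48 ln T, and ln T <= T - 1 turns the logarithm into one
    factor T. *)
Lemma harm_size T s : 1 <= T -> uniq s ->
  {in s, forall l, Lam l /\ l <= T ^+ 32} -> harm (size s) <= Charm * T.
Proof.
move=> T1 us sP; have T0 : 0 < T by lra.
apply: (le_trans (le_harm (leqnSn _))); apply: (le_trans (harm_le_ln _)).
have C1_1 := C1_ge1.
apply: (@le_trans _ _ (1 + ln (C1 * T ^+ 48))).
  rewrite lerD2l ler_ln ?posrE ?ltr0n //; first exact: size_all.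
  by rewrite mulr_gt0 ?exprn_gt0 //; lra.
rewrite lnM ?posrE ?exprn_gt0 //; last lra.
rewrite lnXn // -mulr_natl.
have := le_ln1Dx (_ : -1 < T - 1); rewrite addrCA subrr addr0 => /(_ ltac:(lra)).
have := ln_ge0 C1_1; rewrite /Charm; nra.
Qed.

(** If l is not light at its own scale, the larger set at scale T carries at least the fraction 1 /
    T of S. Then [size_le_heavy] with eps = 1 / T gives the exponent 47 = 1 + 45 + 1. *)
Lemma size_heavy T s : 1 <= T -> uniq s ->
  {in s, forall l, [/\ Lam l, 1 <= l <= T ^+ 32 & ~ light l]} ->
  (size s)%:R <= 2 * Cres * Charm * T ^+ 47.
Proof.
move=> T1 us sP; have T0 : 0 < T by lra.
have hh : harm (size s) <= Charm * T by apply: harm_size => // l /sP[? /andP[]].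
have h : T^-1 * (size s)%:R <= #|` resonant_points T|%:R * (2 * harm (size s)).
  apply: (size_le_heavy sep SLam SLam0 offLam us) => l /sP[Ll /andP[l1 lT] nl]; split => //.
  have l0 : 0 <= l by lra.
  have tT : root32 l <= T by rewrite root32_le // ltW.
  have t1 : 1 <= root32 l by rewrite root32_ge // expr1n.
  apply: (@le_trans _ _ (S l / root32 l)).
    rewrite mulrC ler_wpM2l ?(ltW (SLam0 Ll)) // lef_pV2 ?posrE //; lra.
  move/negP : nl; rewrite -ltNge => /ltW /le_trans; apply.
  apply: ler_sum_fsubset; first by move=> i; rewrite invr_ge0 sqr_ge0.
  by apply: resonant_points_sub => //; lra.
move: h; rewrite ler_pdivrMl // => /le_trans; apply.
have := card_resonant_points T1 => hA.
have -> : 2 * Cres * Charm * T ^+ 47 = T * ((Cres * T ^+ 45) * (2 * (Charm * T))) by ring.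
by rewrite ler_wpM2l ?(ltW T0) // ler_pM ?mulr_ge0 ?harm_ge0 // ler_wpM2l.
Qed.

(** The [.+3] collects the [.+1] of [size_low] and the 2 in T^47 + 1 <= 2 T^47. *)
Definition Cbad := #|` level a b c 1|.+3%:R + 2 * Cres * Charm.

Lemma size_irregular T s : 1 <= T -> uniq s ->
  {in s, forall l, [/\ Lam l, l <= T ^+ 32 & ~ regular l]} ->
  (size s)%:R <= Cbad * T ^+ 47.
Proof.
move=> T1 us sP.
pose s0 := [seq l <- s | l < 1].
pose s1 := [seq l <- s | 1 <= l & ~~ `[< near_spectrum l >]].
pose s2 := [seq l <- s | 1 <= l & ~~ `[< light l >]].
have h0 : (size s0 <= #|` level a b c 1|.+1)%N.
  apply: size_low; first exact: filter_uniq.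
  by move=> l; rewrite mem_filter => /andP[/ltW l1 /sP[]].
have h1 : (size s1)%:R <= T ^+ 47 + 1.
  apply: size_far => //; first exact: filter_uniq.
  by move=> l; rewrite mem_filter => /andP[/andP[l1 /asboolP nf] /sP[? ? _]]; split => //; apply/andP.
have h2 : (size s2)%:R <= 2 * Cres * Charm * T ^+ 47.
  apply: size_heavy => //; first exact: filter_uniq.
  by move=> l; rewrite mem_filter => /andP[/andP[l1 /asboolP nf] /sP[? ? _]]; split => //; apply/andP.
have : (size s <= size s0 + size s1 + size s2)%N.
  rewrite -!size_cat; apply: uniq_leq_size => // l ls; rewrite !mem_cat !mem_filter ls !andbT.
  have [Ll lT nr] := sP _ ls.
  have [//|l1] /= := ltP l 1.
  rewrite -negb_and; apply/negP => /andP[/asboolP h3 /asboolP h4]; apply: nr; split => //.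
rewrite -(ler_nat R) !natrD => /le_trans; apply.
have T47 : 1 <= T ^+ 47 by rewrite exprn_ege1.
move: h0; rewrite -(ler_nat R) => h0.
have -> : Cbad = (#|` level a b c 1|.+1)%:R + 2 + 2 * Cres * Charm.
  by rewrite /Cbad -2!natr1 -natr1; ring.
have : (0 : R) <= (#|` level a b c 1|.+1)%:R by [].
nra.
Qed.

(** Gives meaning to [count_upto], since [fset_set] sends infinite sets to the empty set. Too large
    a finite subset would contradict [size_le_card]. *)
Lemma finite_new X : finite_set (Lam `&` [set l | l <= X]).
Proof.
apply: contrapT => /(infinite_set_fset #|` level a b c X|.+2)[B BL].
apply/negP; rewrite -ltnNge ltnS.
apply: (size_le_card (Lam := Lam) (X := X) sep (fset_uniq B)) => [l lB|i].
  by have [] := BL l lB.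
by rewrite lvl.
Qed.

Hypothesis hindep : lin_indep_Q (1 / a ^+ 2) (1 / b ^+ 2) (1 / c ^+ 2).

Let K := 1 / a + 1 / b + 1 / c.
Let K_gt0 : 0 < K. Proof. by rewrite /K !addr_gt0 // divr_gt0. Qed.

(** With n the integer part of x = T^16 / K, the octant of side n has n^3 distinct values of q, all
    at most T^32, hence at least n^3 - 1 interlaced members. As x >= 4, n >= x / 2 and x^3 / 8 - 1
    >= x^3 / 16. *)
Lemma count_new_ge T : 1 <= T -> 4 * K <= T ^+ 16 ->
  T ^+ 48 / (16 * K ^+ 3) <= (count_upto Lam (T ^+ 32))%:R.
Proof.
move=> T1 TK; have K0 := K_gt0.
pose x := T ^+ 16 / K; pose n := Num.truncn x.
have x4 : 4 <= x by rewrite ler_pdivlMr.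
have nx : n%:R <= x by rewrite truncn_le //; lra.
have xn : x < n.+1%:R by rewrite truncnS_gt.
have [s [us sz sP]] := exists_interlaced (fun i j => new_between (0 : I) q_ge0 lvl crd tau (i := i) (j := j))
   (uniq_nsq_octant ha hb hc hindep n).
have : (size s <= count_upto Lam (T ^+ 32))%N.
  apply: uniq_leq_size => // l /sP[Ll [i /(nsq_octant ha hb hc) qi li]].
  rewrite in_fset_set; last exact: finite_new.
  rewrite inE; split => //=; apply: (le_trans li); apply: (le_trans qi).
  have nK : n%:R * K <= T ^+ 16 by rewrite -ler_pdivlMr.
  have T0 : 0 <= T by lra.
  by rewrite -/K (exprM T 16 2) lerXn2r // nnegrE ?mulr_ge0 ?exprn_ge0 // ltW.
rewrite -(ler_nat R); apply: le_trans.
move: sz; rewrite size_octant -(ler_nat R) natrX -natr1 => sz.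
have -> : T ^+ 48 / (16 * K ^+ 3) = x ^+ 3 / 16 by rewrite /x; field; lra.
move: xn; rewrite -natr1 => xn.
have hn : x / 2 <= n%:R by lra.
have : (x / 2) ^+ 3 <= n%:R ^+ 3 by rewrite lerXn2r ?nnegrE //; lra.
have : 64 <= x ^+ 3.
  by rewrite (_ : 64 = 4 ^+ 3); [rewrite lerXn2r ?nnegrE //; lra|ring].
have -> : (x / 2) ^+ 3 = x ^+ 3 / 8 by field.
move: sz; move: (n%:R ^+ 3) (x ^+ 3) (size s)%:R => u v w; lra.
Qed.

(** The irregular members are O(T^47) among at least a constant times T^48, so their proportion is
    O(1 / T). *)
Lemma regular_density : density_one regular Lam.
Proof.
split; first by move=> l [].
have K0 := K_gt0.
have sub X : regular `&` [set l | l <= X] `<=` Lam `&` [set l | l <= X].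
  by move=> l [[? _ _ _] ?].
have finr X : finite_set (regular `&` [set l | l <= X]).
  by apply: sub_finite_set (finite_new X); exact: sub.
apply/cvgrPdist_lt => e e0.
pose C := Cbad * (16 * K ^+ 3).
(* The three summands ensure T >= 1, 4 K <= T^16 and C / T < e for every T above T0. *)
pose T0 := 1 + 4 * K + `|C| / e.
exists (T0 ^+ 32); split; first exact: num_real.
move=> X TX.
have Ce : 0 <= `|C| / e by rewrite divr_ge0 // ltW.
have T01 : 1 <= T0 by rewrite /T0; lra.
have X0 : 0 <= X by apply: le_trans (ltW TX); rewrite exprn_ge0 //; lra.
set T := root32 X.
have TT0 : T0 < T.
  rewrite ltNge root32_le //; last lra.
  by rewrite -ltNge.
have XE : X = T ^+ 32 by rewrite root32X.
clear TX; have T1 : 1 <= T by lra.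
have Tp : 0 < T := lt_le_trans ltr01 T1.
have TK : 4 * K <= T ^+ 16.
  apply: (@le_trans _ _ T); first by rewrite /T0 in TT0 T01; lra.
  by rewrite -[leLHS]expr1 ler_weXn2l.
have hN := count_new_ge T1 TK; rewrite -XE in hN.
set FB := fset_set (Lam `&` [set l | l <= X]).
set FA := fset_set (regular `&` [set l | l <= X]).
have AB : (FA `<=` FB)%fset.
  apply/fsubsetP => l; rewrite !in_fset_set ?inE //; [exact: sub|exact: finite_new].
have hbad : #|` (FB `\` FA)%fset|%:R <= Cbad * T ^+ 47.
  apply: size_irregular => //; first exact: fset_uniq.
  move=> l; rewrite in_fsetD !in_fset_set //; last exact: finite_new.
  move=> /andP[/negP h /set_mem[Ll lX]]; split => //; first by rewrite -XE.
  by move=> rl; apply: h; apply/mem_set.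
have cardE : #|` FB|%:R = #|` (FB `\` FA)%fset|%:R + #|` FA|%:R :> R.
  by rewrite -natrD cardfsD (fsetIidPr AB) subnK // fsubset_leq_card.
have T480 : 0 < T ^+ 48 / (16 * K ^+ 3) by rewrite divr_gt0 ?mulr_gt0 ?exprn_gt0.
have B0 : 0 < #|` FB|%:R :> R by apply: lt_le_trans hN.
have -> : 1 - (count_upto regular X)%:R / (count_upto Lam X)%:R =
    #|` (FB `\` FA)%fset|%:R / #|` FB|%:R :> R.
  have -> : #|` (FB `\` FA)%fset|%:R = #|` FB|%:R - #|` FA|%:R :> R by rewrite cardE addrK.
  by rewrite mulrBl divff ?gt_eqF.
rewrite ger0_norm ?divr_ge0 // ltr_pdivrMr //.
apply: (le_lt_trans hbad); apply: (@lt_le_trans _ _ (e * (T ^+ 48 / (16 * K ^+ 3)))); last by rewrite ler_pM2l.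
rewrite (mulrA e) ltr_pdivlMr ?mulr_gt0 ?exprn_gt0 //.
have -> : Cbad * T ^+ 47 * (16 * K ^+ 3) = C * T ^+ 47 by rewrite /C; ring.
rewrite (exprS T 47) (mulrA e) ltr_pM2r ?exprn_gt0 //.
apply: le_lt_trans (ler_norm C) _; rewrite mulrC -ltr_pdivrMr //.
by rewrite /T0 in TT0; lra.
Qed.

End Density.

(** * Off-diagonal sums at regular eigenvalues *)

Section CrossTerms.
Context {R : realType} (a b c : R).
Hypotheses (ha : 0 < a) (hb : 0 < b) (hc : 0 < c).
Variable tau : R.
Notation q := (nsq a b c).
Notation I := (int * int * int)%type.
Notation S := (resolvent2 q).

Let q_ge0 := nsq_ge0 a b c.
Let lvl := levelP ha hb hc.
Let crd := card_level ha hb hc.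

(** 1019 = 27 + 16 * 62: the points with q m <= 2 l, and the tail estimated through [Csum]. *)
Definition Cfar := 1019 * Clev a b c.
(** The 2 accounts for the two parts of the majorant that are bounded by S / t. *)
Definition Ccross := Cfar + 2.

Lemma Clev_ge0 : 0 <= Clev a b c.
Proof. by rewrite /Clev exprn_ge0 // addr_ge0 // mulr_ge0 // !addr_ge0 // ltW. Qed.

Lemma Ccross_ge0 : 0 <= Ccross.
Proof. by have := Clev_ge0; rewrite /Ccross /Cfar; lra. Qed.

Section Regular.
Variable l : R.
Hypothesis regl : regular a b c tau l.

Let t := root32 l.
Let u (m : I) := (q m - l)^-1.

Let ol : off q l. Proof. by case: regl => -[]. Qed.
Let l1 : 1 <= l. Proof. by case: regl. Qed.
Let t1 : 1 <= t. Proof. by rewrite /t root32_ge ?expr1n // (le_trans ler01). Qed.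
Let t_gt0 : 0 < t. Proof. exact: lt_le_trans t1. Qed.
Let lE : l = t ^+ 32. Proof. by rewrite root32X // (le_trans ler01). Qed.

(** The one value of q within t^-15 of l already contributes this much. *)
Lemma resolvent2_regular : t ^+ 30 <= S l.
Proof.
case: regl => _ _ [m hm] _; apply: le_trans (resolvent2_ge1 q_ge0 lvl crd m ol).
have d0 : 0 < `|q m - l| by rewrite normr_gt0 off_neq0.
rewrite -[(q m - l) ^+ 2]real_normK ?num_real // -[t ^+ 30]invrK.
rewrite lef_pV2 ?posrE ?invr_gt0 ?exprn_gt0 //.
by rewrite (exprM t 15 2) -exprVn lerXn2r ?nnegrE ?invr_ge0 ?exprn_ge0 // ltW.
Qed.

(** At most 27 [Clev] t^48 points have q m <= 2 l, each of weight at most t^-20; the points beyond 2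
    l contribute a bounded tail. *)
Lemma far_sum (F : {fset I}) :
  \sum_(m <- F | t ^+ 10 <= `|q m - l|) u m ^+ 2 <= Cfar * t ^+ 28.
Proof.
have C0 := Clev_ge0.
have t16 : 1 <= t ^+ 16 by rewrite exprn_ege1.
have t28 : 1 <= t ^+ 28 by rewrite exprn_ege1.
have l4 : (2 * t ^+ 16) ^+ 2 = 4 * l by rewrite lE; ring.
rewrite (bigID (fun m => q m <= 2 * l)) /=.
have -> : Cfar * t ^+ 28 = 27 * Clev a b c * t ^+ 28 + 992 * Clev a b c * t ^+ 28.
  by rewrite /Cfar; ring.
apply: lerD.
  apply: (@le_trans _ _ (\sum_(m <- F | q m <= 2 * l) t ^- 20)).
    rewrite big_mkcond [leRHS]big_mkcond; apply: ler_sum => m _.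
    have [q2|_] := leP (q m) (2 * l); rewrite ?andbF // andbT.
    case: ifP => [h|_]; last by rewrite invr_ge0 exprn_ge0 // ltW.
    have nz : 0 < (q m - l) ^+ 2 by rewrite exprn_even_gt0 //= off_neq0.
    rewrite /u exprVn lef_pV2 ?posrE ?nz ?exprn_gt0 //.
    rewrite -[leRHS]real_normK ?num_real // (exprM t 10 2).
    by rewrite lerXn2r ?nnegrE ?exprn_ge0 // ltW.
  apply: (@le_trans _ _ (\sum_(m <- level a b c ((2 * t ^+ 16) ^+ 2)) t ^- 20)).
    rewrite -big_filter; apply: ler_sum_uniq_sub.
    - by move=> _; rewrite invr_ge0 exprn_ge0 // ltW.
    - by rewrite filter_uniq ?fset_uniq.
    - exact: fset_uniq.
    - by move=> m; rewrite mem_filter /= lvl l4 => /andP[h _]; move: h l1; lra.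
  rewrite big_const_seq count_predT iter_addr_0 -[leLHS]mulr_natl.
  rewrite ler_pdivrMr ?exprn_gt0 //.
  have -> : 27 * Clev a b c * t ^+ 28 * t ^+ 20 = Clev a b c * (3 * t ^+ 16) ^+ 3 by ring.
  apply: (@le_trans _ _ (Clev a b c * (1 + 2 * t ^+ 16) ^+ 3)); first by apply: crd; lra.
  by rewrite ler_wpM2l // lerXn2r ?nnegrE //; lra.
(* For q m > 2 l and l >= 1 one has q m - l >= (1 + q m) / 4. *)
apply: (@le_trans _ _ (\sum_(m <- F) 16 * (1 + q m) ^- 2)).
  rewrite big_mkcond /=; apply: ler_sum => m _.
  have q0 := q_ge0 m.
  have q1 : 0 <= 16 * (1 + q m) ^- 2 by rewrite mulr_ge0 // invr_ge0 sqr_ge0.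
  case: ifP => // /andP[_]; rewrite -ltNge => h.
  have -> : 16 * (1 + q m) ^- 2 = (((1 + q m) / 4) ^+ 2)^-1 by field; lra.
  rewrite /u exprVn lef_pV2 ?posrE ?exprn_gt0 //; try lra.
  by rewrite lerXn2r ?nnegrE //; move: q0 h l1; lra.
rewrite -mulr_sumr.
have := sum_bound q_ge0 lvl crd F; rewrite /Csum => h.
apply: (@le_trans _ _ (992 * Clev a b c * 1)); first by lra.
by apply: ler_wpM2l; [rewrite mulr_ge0 ?ler0n|exact: t28].
Qed.

(** The share charged to m by the AM-GM inequalities: factor t if m is far from l, 1 / t always, and
    1 if m is resonant. *)
Let g (m : I) : R := (if t ^+ 10 <= `|q m - l| then t * u m ^+ 2 else 0) +
  u m ^+ 2 / t + (if m \in resonant_points a b c t then u m ^+ 2 else 0).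

Let u2_ge0 m : 0 <= u m ^+ 2. Proof. exact: sqr_ge0. Qed.

Let if_ge0 (B : bool) (x : R) : 0 <= x -> 0 <= if B then x else 0.
Proof. by case: B. Qed.

Let tu_ge0 m : 0 <= t * u m ^+ 2. Proof. exact: mulr_ge0 (ltW t_gt0) (u2_ge0 m). Qed.
Let ut_ge0 m : 0 <= u m ^+ 2 / t. Proof. exact: divr_ge0 (u2_ge0 m) (ltW t_gt0). Qed.

Let majorant_ge0 m : 0 <= g m.
Proof. exact: addr_ge0 (addr_ge0 (if_ge0 _ (tu_ge0 m)) (ut_ge0 m)) (if_ge0 _ (u2_ge0 m)). Qed.

(** The far part is at most t * Cfar t^28 = (Cfar / t) t^30, and t^30 <= S by [resolvent2_regular].
    The second part is at most S / t by definition of S, the third because l is light. *)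
Lemma majorant_sum (F : {fset I}) : \sum_(m <- F) g m <= Ccross / t * S l.
Proof.
rewrite !big_split /=.
have -> : Ccross / t * S l = Cfar / t * S l + S l / t + S l / t by rewrite /Ccross; ring.
have uE m : u m ^+ 2 = (q m - l) ^- 2 by rewrite /u exprVn.
have uS : \sum_(m <- F) u m ^+ 2 <= S l.
  under eq_bigr do rewrite uE; exact: (resolvent2_ge q_ge0 lvl crd F ol).
apply: lerD; first apply: lerD.
- rewrite -big_mkcond /= -mulr_sumr.
  apply: (@le_trans _ _ (t * (Cfar * t ^+ 28))); first by rewrite ler_wpM2l ?(ltW t_gt0) ?far_sum.
  have -> : t * (Cfar * t ^+ 28) = Cfar / t * t ^+ 30 by field; rewrite gt_eqF.
  apply: ler_wpM2l; last exact: resolvent2_regular.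
  by apply: divr_ge0 (ltW t_gt0); rewrite mulr_ge0 ?ler0n ?Clev_ge0.
- by rewrite -mulr_suml ler_wpM2r ?invr_ge0 ?(ltW t_gt0).
- rewrite -big_mkcond /=.
  case: regl => _ _ _ lt; apply: le_trans lt.
  under eq_bigr do rewrite uE.
  rewrite -big_filter; apply: ler_sum_uniq_sub; rewrite ?filter_uniq ?fset_uniq //.
    by move=> i; rewrite invr_ge0 sqr_ge0.
  by move=> m; rewrite mem_filter => /andP[].
Qed.

Let amgm x y : x * y <= (t * x ^+ 2 + y ^+ 2 / t) / 2.
Proof.
have : 0 <= (t * x - y) ^+ 2 / t by rewrite divr_ge0 ?sqr_ge0 // ltW.
have -> : (t * x - y) ^+ 2 / t = t * x ^+ 2 + y ^+ 2 / t - 2 * (x * y).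
  by field; rewrite gt_eqF.
lra.
Qed.

(** If m or m + z is far from l, weighted AM-GM puts the factor t on the far point and 1 / t on the
    other. If both are near, m is resonant through z and m + z through - z, and unweighted AM-GM
    suffices. *)
Lemma cross_pointwise (m z : I) : z != 0 -> z \in cube (Num.truncn t) ->
  `|u m * u (m + z)| <= (g m + g (m + z)) / 2.
Proof.
move=> z0 zc; rewrite normrM.
have n2 k : `|u k| ^+ 2 = u k ^+ 2 by rewrite real_normK ?num_real.
have low k : u k ^+ 2 / t <= g k.
  by rewrite /g -addrA addrCA lerDl addr_ge0 ?if_ge0 ?tu_ge0 ?ut_ge0 ?u2_ge0 //.
have [h1|h1] := leP (t ^+ 10) `|q m - l|.
  apply: (le_trans (amgm _ _)); rewrite !n2 ler_pM2r ?invr_gt0 //.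
  apply: lerD (low _); rewrite /g h1 -addrA lerDl addr_ge0 ?if_ge0 ?tu_ge0 ?ut_ge0 ?u2_ge0 //.
have [h2|h2] := leP (t ^+ 10) `|q (m + z) - l|.
  rewrite mulrC; apply: (le_trans (amgm _ _)); rewrite !n2 ler_pM2r ?invr_gt0 // [leRHS]addrC.
  apply: lerD (low _); rewrite /g h2 -addrA lerDl addr_ge0 ?if_ge0 ?tu_ge0 ?ut_ge0 ?u2_ge0 //.
have t10 : t ^+ 10 <= l by rewrite lE ler_weXn2l.
have l4 : (2 * t ^+ 16) ^+ 2 = 4 * l by rewrite lE; ring.
have cr : `|cross a b c m z| < 2 * t ^+ 10.
  have -> : cross a b c m z = (q (m + z) - l) - (q m - l) by rewrite (nsqD ha hb hc); ring.
  by apply: le_lt_trans (ler_normB _ _) _; lra.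
have res k : `|q k - l| < t ^+ 10 ->
    resonant a b c (Num.truncn t) (2 * t ^+ 10) k -> u k ^+ 2 <= g k.
  move=> hk rk; have kr : k \in resonant_points a b c t.
    rewrite /resonant_points (slabE ha hb hc) rk andbT l4.
    by move: hk t10 l1; rewrite ltr_norml => /andP[_]; lra.
  by rewrite /g kr lerDr addr_ge0 ?if_ge0 ?tu_ge0 ?ut_ge0 ?u2_ge0.
have r1 : u m ^+ 2 <= g m.
  by apply: res => //; apply/hasP; exists z => //; rewrite z0.
have r2 : u (m + z) ^+ 2 <= g (m + z).
  apply: res => //; apply/hasP; exists (- z).
    by rewrite mem_cube /= !abszN -mem_cube.
  by rewrite oppr_eq0 z0 (crossN ha hb hc) normrN.
have := sqr_ge0 (`|u m| - `|u (m + z)|); rewrite sqrrB !n2 -mulr_natr; lra.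
Qed.

(** Both m and m + z stay in F and translation by z is injective, so each half of the pointwise
    bound sums to at most the full majorant. *)
Lemma cross_sum (F : {fset I}) (z : I) : z != 0 -> z \in cube (Num.truncn t) ->
  \sum_(m <- F | m + z \in F) `|u m * u (m + z)| <= Ccross / t * S l.
Proof.
move=> z0 zc; apply: le_trans (majorant_sum F).
apply: (@le_trans _ _ (\sum_(m <- F | m + z \in F) (g m + g (m + z)) / 2)).
  by apply: ler_sum => m _; exact: cross_pointwise.
rewrite -mulr_suml big_split /= ler_pdivrMr // mulr_natr mulr2n; apply: lerD.
  by rewrite big_mkcond; apply: ler_sum => m _; case: ifP => // _; exact: majorant_ge0.
rewrite -big_filter -(big_map (fun m => m + z) predT g) /=.
apply: ler_sum_uniq_sub; rewrite ?fset_uniq //.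
  by rewrite map_inj_uniq ?filter_uniq ?fset_uniq //; exact: addIr.
by move=> _ /mapP[m + ->]; rewrite mem_filter => /andP[].
Qed.

End Regular.
End CrossTerms.

(** * Integrals of trigonometric functions *)

(* In the library the canonical sigma-finite structure of a product measure is
   shadowed by the one for subprobabilities, hence this renaming. *)
Definition plane_measure (R : realType) :
    set (measurableTypeR R * measurableTypeR R) -> \bar R :=
  (@lebesgue_measure R \x @lebesgue_measure R)%E.

HB.instance Definition _ (R : realType) := Measure.on (@plane_measure R).

(** Squares exhaust the plane; this allows Fubini with the plane as first factor. *)
Lemma sigma_finite_plane (R : realType) : sigma_finite setT (@plane_measure R).
Proof.
pose J n : set R := `[- n%:R, n%:R]%classic.
exists (fun n => J n `*` J n) => [|n].
  apply/seteqP; split => // -[x y] _; exists (Num.truncn (`|x| + `|y|)).+1 => //.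
  have := truncnS_gt (`|x| + `|y|); have := normr_ge0 x; have := normr_ge0 y => y0 x0 h.
  by split; rewrite /J /= in_itv /= -ler_norml; lra.
split; first by apply: measurableX; exact: measurable_itv.
rewrite [X in (X < _)%E](_ : _ = (lebesgue_measure (J n) * lebesgue_measure (J n))%E).
  by rewrite /J !lebesgue_measure_itv /=; case: ifP => _; rewrite ?mul0e ?ltry // -EFinN -EFinD -EFinM ltry.
by apply: product_measure1E; exact: measurable_itv.
Qed.

HB.instance Definition _ (R : realType) :=
  Measure_isSigmaFinite.Build _ _ _ (@plane_measure R) (sigma_finite_plane R).

Section TrigIntegrals.
Context {R : realType}.
Notation mu1 := (@lebesgue_measure R).
Notation T1 := (measurableTypeR R).
Notation T2 := (measurableTypeR R * measurableTypeR R)%type.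
Notation mu2 := ((mu1 \x mu1)%E).
Notation T3 := (measurableTypeR R * measurableTypeR R * measurableTypeR R)%type.

Lemma sinD_int (k : int) (th : R) : sin (k%:~R * (2 * pi) + th) = sin th.
Proof.
have P n (x : R) : sin (x + n%:R * (2 * pi)) = sin x.
  by rewrite [2 * pi]mulr_natl [n%:R * _]mulr_natl; exact: (periodicn (@sinD2pi R)).
case: k => n; first by rewrite addrC -pmulrn P.
rewrite NegzE mulrNz mulNr -pmulrn.
by rewrite -[LHS](P n.+1) addrAC addNr add0r.
Qed.

Lemma is_derive_affine_sin (w th x : R) :
  is_derive x 1 (fun y : R => sin (w * y + th)) (cos (w * x + th) * w).
Proof.
apply: (@is_derive1_comp _ sin (fun y : R => w * y + th)).
by apply: is_derive_eq; rewrite /GRing.scale /= mulr1 ?mulr0 ?addr0 ?add0r.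
Qed.

Lemma continuous_affine_cos (w th : R) : continuous (fun y : R => cos (w * y + th)).
Proof.
move=> y; apply: (continuous_comp (f := fun y : R => w * y + th)); last exact: continuous_cos.
by apply: cvgD; [apply: cvgMr; exact: cvg_id|exact: cvg_cst].
Qed.

(** The antiderivative sin (w y + th) / w takes equal values at both ends, since w (2 pi e) = 2 pi
    k. *)
Lemma integral_cos (e : R) (k : int) (th : R) : 0 < e -> k != 0 ->
  (\int[mu1]_(y in `[0%R, (2 * pi * e)%R[%classic) (cos (k%:~R / e * y + th))%:E = 0)%E.
Proof.
move=> e0 k0; set w := k%:~R / e.
have w0 : w != 0 by apply: mulf_neq0; [rewrite intr_eq0|apply: invr_neq0; rewrite gt_eqF].
have L0 : 0 < 2 * pi * e by rewrite !mulr_gt0 // pi_gt0.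
rewrite integral_itv_bndo_bndc; last first.
  apply: measurableT_comp => //; apply: measurable_funTS.
  by apply: continuous_measurable_fun; exact: continuous_affine_cos.
have der (x : R) : is_derive x 1 (fun y : R => w^-1 * sin (w * y + th)) (cos (w * x + th)).
  have h := is_derive_affine_sin w th x.
  have := @is_deriveZ _ _ _ _ w^-1 _ _ _ h.
  by rewrite /GRing.scale /= mulrCA mulVf // mulr1.
have cF : continuous (fun y : R => w^-1 * sin (w * y + th)).
  by move=> x; apply: differentiable_continuous; apply/derivable1_diffP; case: (der x).
rewrite (continuous_FTC2 (F := fun y : R => w^-1 * sin (w * y + th)) L0).
- rewrite mulr0 add0r.
  have -> : w * (2 * pi * e) = k%:~R * (2 * pi) by rewrite /w; field; rewrite gt_eqF.
  by rewrite sinD_int -EFinD subrr.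
- exact/continuous_subspaceT/continuous_affine_cos.
- split; first by move=> x _; case: (der x).
    exact/cvg_at_right_filter/cF.
  exact/cvg_at_left_filter/cF.
- by move=> x _; rewrite derive1E; apply: derive_val.
Qed.

Notation mu3 := (@plane_measure R \x mu1)%E.

Variables (a b c : R).
Hypotheses (ha : 0 < a) (hb : 0 < b) (hc : 0 < c).

Notation B2 := (`[0, 2 * pi * a[%classic `*` `[0, 2 * pi * b[%classic : set T2).
Notation B3 := (box a b c : set T3).

Lemma measurable_B2 : measurable B2.
Proof. by apply: measurableX; exact: measurable_itv. Qed.

Lemma measurable_box : measurable B3.
Proof. by apply: measurableX; [exact: measurable_B2|exact: measurable_itv]. Qed.

Lemma mu1_itv (e : R) : 0 < e -> mu1 `[0, 2 * pi * e[%classic = (2 * pi * e)%:E.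
Proof.
by move=> e0; rewrite lebesgue_measure_itv /= lte_fin !mulr_gt0 ?pi_gt0 // oppr0 adde0.
Qed.

Lemma mu2_B2 : mu2 B2 = ((2 * pi * a) * (2 * pi * b))%:E.
Proof.
rewrite product_measure1E; [|exact: measurable_itv|exact: measurable_itv].
by rewrite EFinM; congr (_ * _)%E; exact: mu1_itv.
Qed.

Lemma mu3_box : mu3 B3 = ((2 * pi * a) * (2 * pi * b) * (2 * pi * c))%:E.
Proof.
rewrite product_measure1E; [|exact: measurable_B2|exact: measurable_itv].
by rewrite EFinM; congr (_ * _)%E; [exact: mu2_B2|exact: mu1_itv].
Qed.

(** [volume] is convertible to the product built on [plane_measure]; the later statements about
    [volume] are transferred in the same way. *)
Lemma volume_box : volume B3 = ((2 * pi * a) * (2 * pi * b) * (2 * pi * c))%:E.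
Proof. exact: mu3_box. Qed.

Definition lin (al be ga th : R) (x : R * R * R) := al * x.1.1 + be * x.1.2 + ga * x.2 + th.

Lemma measurable_cos_lin2 (al be th : R) (D : set T2) :
  measurable_fun D (fun p : T2 => cos (al * p.1 + be * p.2 + th)).
Proof.
apply: measurable_funTS; apply: (measurableT_comp (f := @cos R)).
  by apply: continuous_measurable_fun; exact: continuous_cos.
apply: measurable_funD => //; apply: measurable_funD; apply: measurable_funM => //.
Qed.

Lemma measurable_cos_lin (al be ga th : R) (D : set T3) :
  measurable_fun D (fun x : T3 => cos (lin al be ga th x)).
Proof.
apply: measurable_funTS; apply: (measurableT_comp (f := @cos R)).
  by apply: continuous_measurable_fun; exact: continuous_cos.
apply: measurable_funD => //; apply: measurable_funD; last by apply: measurable_funM.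
apply: measurable_funD; apply: measurable_funM => //.
  exact: (measurableT_comp (f := @fst R R)).
exact: (measurableT_comp (f := @snd R R)).
Qed.

Lemma integrable_cos_lin2 (al be th : R) :
  mu2.-integrable B2 (fun p : T2 => (cos (al * p.1 + be * p.2 + th))%:E).
Proof.
apply: measurable_bounded_integrable; first exact: measurable_B2.
- by rewrite [X in (X < _)%E]mu2_B2 ltry.
- exact: measurable_cos_lin2.
- exists 1; split => // M M1 p _ /=; apply: le_trans (ltW M1).
  by rewrite ler_norml cos_geN1 cos_le1.
Qed.

Lemma integrable_cos_lin_mu3 (al be ga th : R) :
  mu3.-integrable B3 (fun x : T3 => (cos (lin al be ga th x))%:E).
Proof.
apply: measurable_bounded_integrable; first exact: measurable_box.
- by rewrite [X in (X < _)%E]mu3_box ltry.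
- exact: measurable_cos_lin.
- exists 1; split => // M M1 p _ /=; apply: le_trans (ltW M1).
  by rewrite ler_norml cos_geN1 cos_le1.
Qed.

Lemma integrable_cos_lin (al be ga th : R) :
  volume.-integrable B3 (fun x : T3 => (cos (lin al be ga th x))%:E).
Proof. exact: integrable_cos_lin_mu3. Qed.

(** After extension by zero outside the box, Fubini is used in the order that first integrates a
    variable of nonzero frequency. *)
Lemma integral_cos2 (k1 k2 : int) (th : R) : (k1 != 0) || (k2 != 0) ->
  (\int[mu2]_(p in B2) (cos (k1%:~R / a * p.1 + k2%:~R / b * p.2 + th))%:E = 0)%E.
Proof.
move=> k0; rewrite integral_mkcond.
have := integrable_cos_lin2 (k1%:~R / a) (k2%:~R / b) th.
move=> /(integrable_mkcond _ measurable_B2); set f := (_ \_ _) => intf.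
have fE x y : f (x, y) = if (x \in `[0, 2 * pi * a[%classic) && (y \in `[0, 2 * pi * b[%classic)
   then (cos (k1%:~R / a * x + k2%:~R / b * y + th))%:E else 0%E.
  by rewrite /f patchE /= in_setX.
case/orP : k0 => k0.
  rewrite -(integral21_prod_meas1 intf); apply: integral0_eq => y _.
  rewrite /fubini_G.
  have [yB|yB] := boolP (y \in `[0, 2 * pi * b[%classic); last first.
    by apply: integral0_eq => x _; rewrite fE (negbTE yB) andbF.
  rewrite -[RHS](integral_cos (k2%:~R / b * y + th) ha k0) [RHS]integral_mkcond.
  apply: eq_integral => x _; rewrite fE yB andbT patchE.
  by case: ifP => // _; rewrite addrA.
rewrite -(integral12_prod_meas1 intf); apply: integral0_eq => x _.
rewrite /fubini_F.
have [xB|xB] := boolP (x \in `[0, 2 * pi * a[%classic); last first.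
  by apply: integral0_eq => y _; rewrite fE (negbTE xB).
rewrite -[RHS](integral_cos (k1%:~R / a * x + th) hb k0) [RHS]integral_mkcond.
apply: eq_integral => y _; rewrite fE xB patchE /=.
by case: ifP => // _; rewrite addrCA addrA.
Qed.

(** The inner integral is over the third coordinate if k3 is nonzero, and otherwise over the plane,
    where [integral_cos2] applies. *)
Lemma integral_cos3_mu3 (k1 k2 k3 : int) (th : R) : [|| k1 != 0, k2 != 0 | k3 != 0] ->
  (\int[mu3]_(x in B3) (cos (lin (k1%:~R / a) (k2%:~R / b) (k3%:~R / c) th x))%:E = 0)%E.
Proof.
move=> k0; rewrite integral_mkcond.
have := integrable_cos_lin_mu3 (k1%:~R / a) (k2%:~R / b) (k3%:~R / c) th.
move=> /(integrable_mkcond _ measurable_box); set f := (_ \_ _) => intf.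
have fE p y : f (p, y) = if (p \in B2) && (y \in `[0, 2 * pi * c[%classic)
   then (cos (k1%:~R / a * p.1 + k2%:~R / b * p.2 + k3%:~R / c * y + th))%:E else 0%E.
  by rewrite /f patchE /= in_setX.
have [k30|k30] := boolP (k3 != 0).
  rewrite -(integral12_prod_meas1 (m1 := @plane_measure R) (m2 := mu1) intf); apply: integral0_eq => p _.
  rewrite /fubini_F.
  have [pB|pB] := boolP (p \in B2); last first.
    by apply: integral0_eq => y _; rewrite fE (negbTE pB).
  rewrite -[RHS](integral_cos (k1%:~R / a * p.1 + k2%:~R / b * p.2 + th) hc k30) [RHS]integral_mkcond.
  apply: eq_integral => y _; rewrite fE pB patchE /=.
  by case: ifP => // _; rewrite [in RHS]addrA [in RHS](addrC (_ * y)).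
rewrite (negbTE k30) orbF in k0.
rewrite -(integral21_prod_meas1 (m1 := @plane_measure R) (m2 := mu1) intf); apply: integral0_eq => y _.
rewrite /fubini_G.
have [yB|yB] := boolP (y \in `[0, 2 * pi * c[%classic); last first.
  by apply: integral0_eq => p _; rewrite fE (negbTE yB) andbF.
rewrite -[RHS](integral_cos2 (k3%:~R / c * y + th) k0) [RHS]integral_mkcond.
apply: eq_integral => p _; rewrite fE yB andbT patchE.
by case: ifP => // _; rewrite addrA.
Qed.

Lemma integral_cos3 (k1 k2 k3 : int) (th : R) : [|| k1 != 0, k2 != 0 | k3 != 0] ->
  (\int[volume]_(x in B3) (cos (lin (k1%:~R / a) (k2%:~R / b) (k3%:~R / c) th x))%:E = 0)%E.
Proof. exact: integral_cos3_mu3. Qed.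

End TrigIntegrals.

(** * The density of the Green function *)

Lemma sqr_normc (R : rcfType) (z : R[i]) :
  ComplexField.Normc.normc z ^+ 2 = complex.Re z ^+ 2 + complex.Im z ^+ 2.
Proof. by case: z => x y /=; rewrite sqr_sqrtr // addr_ge0 ?sqr_ge0. Qed.

(** The squared modulus of an exponential sum in real form; it serves both the Green function and
    the Fejer kernel. *)
Lemma sqr_sum_cos_sin (R : realType) (I : Type) (s : seq I) (v al : I -> R) :
  (\sum_(m <- s) v m * cos (al m)) ^+ 2 + (\sum_(m <- s) v m * sin (al m)) ^+ 2 =
  \sum_(m <- s) \sum_(n <- s) v m * v n * cos (al m - al n).
Proof.
rewrite !expr2 !big_distrlr -big_split /=; apply: eq_bigr => m _.
rewrite -big_split /=; apply: eq_bigr => n _; rewrite cosB; ring.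
Qed.

Lemma big_eq_seq (R : nmodType) (I : eqType) (s : seq I) (k : I) (g : I -> R) :
  uniq s -> \sum_(m <- s) (if m == k then g m else 0) = if k \in s then g k else 0.
Proof.
move=> us; case: ifPn => ks.
  rewrite (bigD1_seq k) //= eqxx big1 ?addr0 // => m /negbTE -> //.
rewrite big1_seq // => m /andP[_ ms]; case: eqP => // mk.
by rewrite -mk ms in ks.
Qed.

Lemma cosM (R : realType) (x y : R) : cos x * cos y = (cos (x - y) + cos (x + y)) / 2.
Proof. by rewrite cosB cosD; field. Qed.

Lemma Re_sum (R : rcfType) (I : Type) (s : seq I) (f : I -> R[i]) :
  complex.Re (\sum_(m <- s) f m) = \sum_(m <- s) complex.Re (f m).
Proof. by elim/big_rec2: _ => // m x y _ <-; case: (f m) y => ? ? [? ?]. Qed.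

Lemma Im_sum (R : rcfType) (I : Type) (s : seq I) (f : I -> R[i]) :
  complex.Im (\sum_(m <- s) f m) = \sum_(m <- s) complex.Im (f m).
Proof. by elim/big_rec2: _ => // m x y _ <-; case: (f m) y => ? ? [? ?]. Qed.

(** * Integration over the fundamental box and Fourier modes *)

Section BoxIntegral.
Context {R : realType} (a b c : R).
Hypotheses (ha : 0 < a) (hb : 0 < b) (hc : 0 < c).
Notation T1 := (measurableTypeR R).
Notation T3 := (measurableTypeR R * measurableTypeR R * measurableTypeR R)%type.
Notation B3 := (box a b c : set T3).
Notation I := (int * int * int)%type.
Implicit Types (f g h : R * R * R -> R) (x : R * R * R).

Let mB : measurable B3. Proof. exact: measurable_box. Qed.

Definition box_integrable h := volume.-integrable B3 (EFin \o h).
Definition box_int h : R := \int[volume]_(x in B3) h x.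

Lemma area_gt0 : 0 < area a b c.
Proof. by rewrite /area [volume _]volume_box //= !mulr_gt0 ?pi_gt0. Qed.

Lemma volume_boxE : volume B3 = (area a b c)%:E.
Proof. by rewrite /area [volume _]volume_box. Qed.

Lemma box_integrableD f g : box_integrable f -> box_integrable g -> box_integrable (fun x => f x + g x).
Proof. by move=> hf hg; have := integrableD mB hf hg. Qed.

Lemma box_integrableZ k f : box_integrable f -> box_integrable (fun x => k * f x).
Proof. by move=> hf; have := integrableZl mB k hf. Qed.

Lemma box_integrableN f : box_integrable f -> box_integrable (fun x => - f x).
Proof. by move=> /(box_integrableZ (-1)); congr box_integrable; apply/funext => x; rewrite mulN1r. Qed.

Lemma box_integrable_cst k : box_integrable (fun=> k).
Proof.
apply: (measurable_bounded_integrable mB); first by rewrite [X in (X < _)%E]volume_boxE ltry.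
  exact: measurable_cst.
by exists `|k|; split => // M kM x _; exact: ltW.
Qed.

Lemma box_integrable_sum (K : Type) (s : seq K) (f : K -> R * R * R -> R) :
  (forall k, box_integrable (f k)) -> box_integrable (fun x => \sum_(k <- s) f k x).
Proof.
move=> hf; elim: s => [|k s IH].
  by under eq_fun do rewrite big_nil; exact: box_integrable_cst.
by under eq_fun do rewrite big_cons; exact: box_integrableD.
Qed.

Lemma box_intD f g : box_integrable f -> box_integrable g -> box_int (fun x => f x + g x) = box_int f + box_int g.
Proof. by move=> hf hg; exact: (RintegralD mB hf hg). Qed.

Lemma box_intZ k f : box_integrable f -> box_int (fun x => k * f x) = k * box_int f.
Proof. by move=> hf; exact: (RintegralZl k mB hf). Qed.

Lemma box_int_cst k : box_int (fun=> k) = k * area a b c.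
Proof. by rewrite /box_int (Rintegral_cst volume mB). Qed.

Lemma box_int_sum (K : Type) (s : seq K) (f : K -> R * R * R -> R) :
  (forall k, box_integrable (f k)) -> box_int (fun x => \sum_(k <- s) f k x) = \sum_(k <- s) box_int (f k).
Proof.
move=> hf; elim: s => [|k s IH].
  by under eq_fun do rewrite big_nil; rewrite box_int_cst mul0r big_nil.
under eq_fun do rewrite big_cons.
by rewrite box_intD ?IH ?big_cons //; exact: box_integrable_sum.
Qed.

Lemma box_int_le f g : box_integrable f -> box_integrable g -> (forall x, B3 x -> f x <= g x) -> box_int f <= box_int g.
Proof. by move=> hf hg fg; exact: (le_Rintegral mB hf hg). Qed.

Lemma box_int_norm f : box_integrable f -> `|box_int f| <= box_int (fun x => `|f x|).
Proof. by move=> hf; exact: (le_normr_Rintegral mB hf). Qed.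

Lemma box_integrable_norm f : box_integrable f -> box_integrable (fun x => `|f x|).
Proof. by move=> hf; have := integrable_abse hf. Qed.

Lemma box_integrable_dominated f g : measurable_fun B3 f -> box_integrable g ->
  (forall x, B3 x -> `|f x| <= g x) -> box_integrable f.
Proof.
move=> mf hg fg; apply: (le_integrable mB _ _ hg); first exact/measurable_EFinP.
by move=> x /fg h; rewrite /= lee_fin (le_trans h) // ler_norm.
Qed.

Lemma box_integrable_mul f g : measurable_fun B3 f -> (forall x, `|f x| <= 1) -> box_integrable g ->
  box_integrable (fun x => f x * g x).
Proof.
move=> mf f1 hg; apply: (box_integrable_dominated _ (box_integrable_norm hg)).
  apply: measurable_funM => //; apply/measurable_EFinP; exact: measurable_int hg.
by move=> x _; rewrite normrM ler_piMl.
Qed.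

(** A real Fourier mode; the phase [th] makes cosines and sines one family closed under products up
    to sums. *)
Definition trig (z : I) (th : R) x : R := cos (dot (dual_vec a b c z) x + th).

Lemma trig_le1 z th x : `|trig z th x| <= 1.
Proof. by rewrite ler_norml cos_geN1 cos_le1. Qed.

Lemma trigE z th : trig z th = (fun x => cos (lin (z.1.1%:~R / a) (z.1.2%:~R / b) (z.2%:~R / c) th x)).
Proof. by []. Qed.

Lemma measurable_trig z th : measurable_fun B3 (trig z th).
Proof. exact: measurable_cos_lin. Qed.

Lemma box_integrable_trig z th : box_integrable (trig z th).
Proof. exact: integrable_cos_lin. Qed.

Lemma box_int_trig z th : z != 0 -> box_int (trig z th) = 0.
Proof.
move=> z0; rewrite /box_int /Rintegral trigE integral_cos3 //.
case: z z0 => [[z1 z2] z3]; apply: contraR; rewrite !negb_or !negbK /=.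
by case/and3P => /eqP -> /eqP -> /eqP ->.
Qed.

Lemma trig0 th x : trig 0 th x = cos th.
Proof. by rewrite /trig /dot /= !mul0r !addr0 add0r. Qed.

Lemma box_int_trig0 th : box_int (trig 0 th) = cos th * area a b c.
Proof. by rewrite -box_int_cst; congr box_int; apply/funext => x; exact: trig0. Qed.

Lemma box_int_trig_le z th : `|box_int (trig z th)| <= (z == 0)%:R * area a b c.
Proof.
have [->|z0] := eqVneq z 0; last by rewrite box_int_trig // normr0 mul0r.
rewrite box_int_trig0 normrM (gtr0_norm area_gt0) ler_pM2r ?area_gt0 //.
by rewrite ler_norml cos_geN1 cos_le1.
Qed.

Lemma dual_vecD z w x : dot (dual_vec a b c (z + w)) x =
  dot (dual_vec a b c z) x + dot (dual_vec a b c w) x.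
Proof. by rewrite /dot /= !rmorphD /=; ring. Qed.

Lemma dual_vecN z x : dot (dual_vec a b c (- z)) x = - dot (dual_vec a b c z) x.
Proof. by rewrite /dot /= !rmorphN /=; ring. Qed.

Lemma dotDr z x y : dot (dual_vec a b c z) (x + y) =
  dot (dual_vec a b c z) x + dot (dual_vec a b c z) y.
Proof. by rewrite /dot /=; ring. Qed.

Lemma dotNr z x : dot (dual_vec a b c z) (- x) = - dot (dual_vec a b c z) x.
Proof. by rewrite /dot /=; ring. Qed.

Lemma trigM z w th om x :
  trig z th x * trig w om x = (trig (z - w) (th - om) x + trig (z + w) (th + om) x) / 2.
Proof.
by rewrite /trig cosM !dual_vecD dual_vecN; congr ((cos _ + cos _) / 2); ring.
Qed.

(** Product-to-sum: the two resulting modes z - w and z + w have nonzero mean only for w = z and w =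
    - z. *)
Lemma box_int_trigM_le z w th om :
  `|box_int (fun x => trig z th x * trig w om x)| <= ((w == z)%:R + (w == - z)%:R) / 2 * area a b c.
Proof.
have -> : box_int (fun x => trig z th x * trig w om x) =
    2^-1 * (box_int (trig (z - w) (th - om)) + box_int (trig (z + w) (th + om))).
  rewrite -box_intD; [|exact: box_integrable_trig|exact: box_integrable_trig].
  rewrite -box_intZ; last by apply: box_integrableD; exact: box_integrable_trig.
  by congr box_int; apply/funext => x; rewrite trigM mulrC.
rewrite [leRHS](_ : _ = 2^-1 * (((w == z)%:R + (w == - z)%:R) * area a b c)); last by field.
rewrite normrM ger0_norm // ler_pM2l //.
apply: (le_trans (ler_normD _ _)); rewrite mulrDl; apply: lerD.
  by apply: (le_trans (box_int_trig_le _ _)); rewrite subr_eq0 eq_sym.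
by apply: (le_trans (box_int_trig_le _ _)); rewrite addrC addr_eq0.
Qed.

(** * Fourier modes of squared finite trigonometric sums *)

Section Weights.
Variables (x0 : R * R * R) (u : I -> R).
Implicit Type F : {fset I}.

(** The squared modulus of the sum over F of u m exp (i xi_m . (x - x0)), written with cosines. *)
Definition weight F x : R := \sum_(m <- F) \sum_(n <- F)
  u m * u n * trig (m - n) (- dot (dual_vec a b c (m - n)) x0) x.

Lemma box_integrable_weight F : box_integrable (weight F).
Proof. by apply: box_integrable_sum => m; apply: box_integrable_sum => n; apply: box_integrableZ; exact: box_integrable_trig. Qed.

(** Parseval: only the diagonal terms m = n have a nonzero mean. *)
Lemma box_int_weight F : box_int (weight F) = (\sum_(m <- F) u m ^+ 2) * area a b c.
Proof.
rewrite box_int_sum; last by move=> m; apply: box_integrable_sum => n; apply: box_integrableZ; exact: box_integrable_trig.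
rewrite mulr_suml [LHS]big_seq [RHS]big_seq; apply: eq_bigr => m mF.
rewrite box_int_sum; last by move=> n; apply: box_integrableZ; exact: box_integrable_trig.
transitivity (\sum_(n <- F) if n == m then u n ^+ 2 * area a b c else 0); last first.
  by rewrite big_eq_seq ?fset_uniq // mF.
apply: eq_bigr => n _; rewrite box_intZ; last exact: box_integrable_trig.
case: eqP => [->|/eqP nm]; last by rewrite box_int_trig ?mulr0 // subr_eq0 eq_sym.
rewrite subrr box_int_trig0 (_ : - dot _ _ = 0); first by rewrite cos0 mul1r expr2.
by rewrite /dot /= !mul0r !addr0 oppr0.
Qed.

(** Only pairs with m - n = z or m - n = - z survive, each with factor 1/2; exchanging m and n shows
    that the two families have the same sum. *)
Lemma box_int_trig_weight z th F : `|box_int (fun x => trig z th x * weight F x)| <=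
  (\sum_(m <- F | m + z \in F) `|u m * u (m + z)|) * area a b c.
Proof.
set A := area a b c; have A0 : 0 < A := area_gt0.
have E : (fun x => trig z th x * weight F x) = (fun x => \sum_(m <- F) \sum_(n <- F)
    u m * u n * (trig z th x * trig (m - n) (- dot (dual_vec a b c (m - n)) x0) x)).
  apply/funext => x; rewrite /weight mulr_sumr; apply: eq_bigr => m _.
  by rewrite mulr_sumr; apply: eq_bigr => n _; rewrite mulrCA.
have itt w om : box_integrable (fun x => trig z th x * trig w om x).
  by apply: box_integrable_mul; [exact: measurable_trig|exact: trig_le1|exact: box_integrable_trig].
rewrite E box_int_sum; last by move=> m; apply: box_integrable_sum => n; apply: box_integrableZ; exact: itt.
apply: (le_trans (ler_norm_sum _ _ _)).
pose g m n : R := `|u m * u n|.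
have gC m n : g m n = g n m by rewrite /g mulrC.
have eqz (m n : I) : (m - n == z) = (m == n + z) by rewrite subr_eq addrC.
have eqNz (m n : I) : (m - n == - z) = (n == m + z).
  by rewrite -(eqr_opp (m - n)) opprK opprB subr_eq addrC.
have bound m n : `|box_int (fun x => u m * u n * (trig z th x *
    trig (m - n) (- dot (dual_vec a b c (m - n)) x0) x))| <=
    ((if m == n + z then g m n else 0) + (if n == m + z then g m n else 0)) / 2 * A.
  rewrite box_intZ; last exact: itt.
  rewrite normrM -/(g m n).
  apply: (le_trans (ler_wpM2l _ (box_int_trigM_le _ _ _ _))); first exact: normr_ge0.
  rewrite eqz eqNz -/A [leLHS]mulrA; apply: ler_wpM2r; first exact: ltW.
  by rewrite mulrA ler_pM2r ?invr_gt0 // mulrDr; do 2!case: eqP => _; rewrite ?mulr1 ?mulr0.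
have g1 : \sum_(m <- F) \sum_(n <- F) (if n == m + z then g m n else 0) =
    \sum_(m <- F | m + z \in F) g m (m + z).
  by rewrite [RHS]big_mkcond; apply: eq_bigr => m _; rewrite big_eq_seq ?fset_uniq.
have g2 : \sum_(m <- F) \sum_(n <- F) (if m == n + z then g m n else 0) =
    \sum_(m <- F | m + z \in F) g m (m + z).
  rewrite exchange_big /= -g1; apply: eq_bigr => m _; apply: eq_bigr => n _.
  by rewrite gC.
apply: (@le_trans _ _ (\sum_(m <- F) \sum_(n <- F)
    ((if m == n + z then g m n else 0) + (if n == m + z then g m n else 0)) / 2 * A)).
  apply: ler_sum => m _.
  rewrite box_int_sum; last by move=> n; apply: box_integrableZ; exact: itt.
  by apply: (le_trans (ler_norm_sum _ _ _)); apply: ler_sum => n _; exact: bound.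
rewrite le_eqVlt; apply/orP; left; apply/eqP.
under eq_bigr do rewrite -!mulr_suml big_split.
by rewrite -!mulr_suml big_split /= g1 g2 -mulr2n -[_ *+ 2]mulr_natr mulfK // pnatr_eq0.
Qed.

End Weights.

(** * The Green function as the L2 limit of its partial sums *)

Section GreenWeight.
Variables (x0 : R * R * R) (l : R).
Notation q := (nsq a b c).

Let kap : R := 1 / (8 * pi ^+ 3).
Let u (m : I) : R := (q m - l)^-1.

Definition gsum (F : {fset I}) x : R[i] :=
  psum (fun m => green_term a b c x0 l m x) F.

Lemma Re_green_term m x : complex.Re (green_term a b c x0 l m x) =
  - kap * (u m * cos (dot (dual_vec a b c m) (x - x0))).
Proof.
by rewrite /green_term /expi -fmorphV /= -/(u m) !mul0r !mulr0 !subr0 (mulrC (u m)).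
Qed.

Lemma Im_green_term m x : complex.Im (green_term a b c x0 l m x) =
  - kap * (u m * sin (dot (dual_vec a b c m) (x - x0))).
Proof.
by rewrite /green_term /expi -fmorphV /= -/(u m) !mul0r !mulr0 ?addr0 ?add0r (mulrC (u m)).
Qed.

Lemma sqr_gsum F x : ComplexField.Normc.normc (gsum F x) ^+ 2 = kap ^+ 2 * weight x0 u F x.
Proof.
rewrite sqr_normc /gsum psumE Re_sum Im_sum.
under eq_bigr do rewrite Re_green_term.
under [X in _ + X ^+ 2]eq_bigr do rewrite Im_green_term.
rewrite -!mulr_sumr !(exprMn _ (- kap)) -mulrDr sqrrN; congr (_ * _).
rewrite sqr_sum_cos_sin; apply: eq_bigr => m _; apply: eq_bigr => n _; congr (_ * cos _).
by rewrite !dotDr !dual_vecD !dual_vecN !dotNr; ring.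
Qed.

Section L2Limit.
Hypothesis ol : off q l.
Variable G : R * R * R -> R[i].
Hypothesis greenG : is_green a b c x0 l G.

Let S := resolvent2 q l.
Let A := area a b c.
Let sumS : has_sum (fun m => (q m - l) ^- 2) S :=
  has_sum_resolvent2 (nsq_ge0 a b c) (levelP ha hb hc) (card_level ha hb hc) ol.

Definition density x : R := ComplexField.Normc.normc (G x) ^+ 2.

Let kw F x : R := kap ^+ 2 * weight x0 u F x.
Let box_integrable_kw F : box_integrable (kw F). Proof. exact/box_integrableZ/box_integrable_weight. Qed.

Let mRe : measurable_fun B3 (fun x => complex.Re (G x)). Proof. by case: greenG => -[]. Qed.
Let mIm : measurable_fun B3 (fun x => complex.Im (G x)). Proof. by case: greenG => -[]. Qed.

Lemma box_integrable_sq (h : R * R * R -> R[i]) : measurable_fun B3 (fun x => complex.Re (h x)) ->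
  measurable_fun B3 (fun x => complex.Im (h x)) -> (L2_norm_sq a b c h < +oo)%E ->
  box_integrable (fun x => ComplexField.Normc.normc (h x) ^+ 2).
Proof.
move=> mr mi hoo; apply/integrableP; split.
  apply/measurable_EFinP; under eq_fun do rewrite sqr_normc.
  by apply: measurable_funD; apply: measurable_funX.
apply: le_lt_trans hoo; rewrite le_eqVlt; apply/orP; left; apply/eqP.
by apply: eq_integral => x _; rewrite /= ger0_norm // sqr_ge0.
Qed.

Lemma box_integrable_density : box_integrable density.
Proof. by apply: box_integrable_sq => //; case: greenG => -[]. Qed.

Let mReg F : measurable_fun B3 (fun x => complex.Re (gsum F x)).
Proof.
have -> : (fun x => complex.Re (gsum F x)) = (fun x => \sum_(m <- F)
    - kap * (u m * trig m (- dot (dual_vec a b c m) x0) x)).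
  apply/funext => x; rewrite /gsum psumE Re_sum; apply: eq_bigr => m _.
  by rewrite Re_green_term /trig dotDr dotNr.
suff : box_integrable (fun x => \sum_(m <- F) - kap * (u m * trig m (- dot (dual_vec a b c m) x0) x)).
  by move=> /measurable_int/measurable_EFinP.
by apply: box_integrable_sum => m; do 2!apply: box_integrableZ; exact: box_integrable_trig.
Qed.

Let mImg F : measurable_fun B3 (fun x => complex.Im (gsum F x)).
Proof.
(* Sines are [trig] modes with the phase lowered by pi / 2. *)
have -> : (fun x => complex.Im (gsum F x)) = (fun x => \sum_(m <- F)
    - kap * (u m * trig m (- dot (dual_vec a b c m) x0 - pi / 2) x)).
  apply/funext => x; rewrite /gsum psumE Im_sum; apply: eq_bigr => m _.
  by rewrite Im_green_term /trig addrA cosBpihalf dotDr dotNr.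
suff : box_integrable (fun x => \sum_(m <- F) - kap * (u m * trig m (- dot (dual_vec a b c m) x0 - pi / 2) x)).
  by move=> /measurable_int/measurable_EFinP.
by apply: box_integrable_sum => m; do 2!apply: box_integrableZ; exact: box_integrable_trig.
Qed.

(* For [g = p + e] one has [||g|^2 - |p|^2| <= |e|^2 + 2|p||e|], and AM-GM
   splits the last term. *)
Let sqr_diff (d : R) (g p : R[i]) : 0 < d ->
  `|ComplexField.Normc.normc g ^+ 2 - ComplexField.Normc.normc p ^+ 2| <=
  (1 + d^-1) * ComplexField.Normc.normc (g - p) ^+ 2 + d * ComplexField.Normc.normc p ^+ 2.
Proof.
move=> d0; rewrite !sqr_normc; case: g p => [g1 g2] [p1 p2] /=.
have am (e p : R) : `|2 * (p * e)| <= d^-1 * e ^+ 2 + d * p ^+ 2.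
  have h1 : 0 <= d^-1 * (e - d * p) ^+ 2 by rewrite mulr_ge0 ?sqr_ge0 // invr_ge0 ltW.
  have h2 : 0 <= d^-1 * (e + d * p) ^+ 2 by rewrite mulr_ge0 ?sqr_ge0 // invr_ge0 ltW.
  have e1 : d^-1 * (e - d * p) ^+ 2 = d^-1 * e ^+ 2 + d * p ^+ 2 - 2 * (p * e).
    by field; rewrite gt_eqF.
  have e2 : d^-1 * (e + d * p) ^+ 2 = d^-1 * e ^+ 2 + d * p ^+ 2 + 2 * (p * e).
    by field; rewrite gt_eqF.
  by rewrite ler_norml; apply/andP; split; lra.
have := am (g1 - p1) p1; have := am (g2 - p2) p2.
rewrite !ler_norml => /andP[h1 h2] /andP[h3 h4].
have s1 := sqr_ge0 (g1 - p1); have s2 := sqr_ge0 (g2 - p2).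
rewrite !mulrDl !mul1r !mulrDr.
have -> : g1 ^+ 2 + g2 ^+ 2 - (p1 ^+ 2 + p2 ^+ 2) =
  (g1 - p1) ^+ 2 + (g2 - p2) ^+ 2 + 2 * (p1 * (g1 - p1)) + 2 * (p2 * (g2 - p2)) by ring.
by apply/andP; split; lra.
Qed.

Lemma sum_u2_le (F : {fset I}) : \sum_(m <- F) u m ^+ 2 <= S.
Proof.
under eq_bigr do rewrite exprVn.
by apply: (has_sum_ge F _ sumS) => m; rewrite invr_ge0 sqr_ge0.
Qed.

Lemma S_ge0 : 0 <= S.
Proof. by have := sum_u2_le fset0; rewrite big_seq_fset0. Qed.

(** L2 convergence of the partial sums gives L1 convergence of their squared moduli, through
    [sqr_diff]. Intersecting two eventual conditions yields one F that serves both estimates. *)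
Lemma weight_approx (e : R) : 0 < e -> exists F : {fset I},
  S - e <= \sum_(m <- F) u m ^+ 2 /\
  box_int (fun x => `|density x - kw F x|) <= e.
Proof.
move=> e0.
have k0 : 0 <= kap ^+ 2 := sqr_ge0 kap.
pose K := kap ^+ 2 * (S * A).
have K0 : 0 <= K by rewrite mulr_ge0 // mulr_ge0 ?S_ge0 // ltW // area_gt0.
(* K bounds the mass of [kw F] uniformly in F. The choices of [d] and [eta] make d K <= e / 2 and (1
   + 1 / d) eta = e / 2; adding 1 to K keeps the denominator positive. *)
pose d := e / (2 * (K + 1)).
have d0 : 0 < d by rewrite divr_gt0 // mulr_gt0 // ltr_wpDl.
pose eta := e / (2 * (1 + d^-1)).
have d1 : 0 < 1 + d^-1 by rewrite addr_gt0 // invr_gt0.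
have eta0 : 0 < eta by rewrite divr_gt0 // mulr_gt0.
have /cvgrPdist_lt/(_ _ e0) cS := sumS.
case: greenG => _ cG.
have cE : \forall F \near (totally : set_system {fset I}), (L2_norm_sq a b c (fun x => (G x - gsum F x)%R) < eta%:E)%E.
  exact: cG (nbhs_open_ereal_lt (f := fun=> eta) eta0).
have [F [FS FE]] := filter_ex (filterI cS cE).
exists F; split.
  move: FS; rewrite psumE ltr_norml => /andP[_].
  by under eq_bigr do rewrite -exprVn; rewrite -/u; lra.
have foo : (L2_norm_sq a b c (fun x => (G x - gsum F x)%R) < +oo)%E by exact: (lt_trans FE (ltry _)).
have mr : measurable_fun B3 (fun x => complex.Re (G x - gsum F x)).
  have -> : (fun x => complex.Re (G x - gsum F x)) =
      (fun x => complex.Re (G x) - complex.Re (gsum F x)).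
    by apply/funext => x; case: (G x) (gsum F x) => ? ? [].
  exact: measurable_funB.
have mi : measurable_fun B3 (fun x => complex.Im (G x - gsum F x)).
  have -> : (fun x => complex.Im (G x - gsum F x)) =
      (fun x => complex.Im (G x) - complex.Im (gsum F x)).
    by apply/funext => x; case: (G x) (gsum F x) => ? ? [].
  exact: measurable_funB.
have iE := box_integrable_sq mr mi foo.
have JE : box_int (fun x => ComplexField.Normc.normc (G x - gsum F x) ^+ 2) <= eta.
  rewrite -lee_fin /box_int /Rintegral fineK; first exact: ltW.
  exact: integral_fune_fin_num.
have Jk : box_int (kw F) <= K.
  rewrite box_intZ; last exact: box_integrable_weight.
  by rewrite box_int_weight ler_wpM2l // ler_wpM2r ?sum_u2_le // ltW // area_gt0.
apply: (@le_trans _ _ ((1 + d^-1) * eta + d * K)).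
  apply: (@le_trans _ _ (box_int (fun x => (1 + d^-1) * ComplexField.Normc.normc (G x - gsum F x) ^+ 2
      + d * kw F x))).
    apply: box_int_le; first by apply: box_integrable_norm; apply: box_integrableD; [exact: box_integrable_density|exact: box_integrableN].
      by apply: box_integrableD; [exact: (box_integrableZ _ iE)|exact: (box_integrableZ _ (box_integrable_kw F))].
    by move=> x _; rewrite /kw -sqr_gsum; exact: sqr_diff.
  rewrite (box_intD (box_integrableZ _ iE) (box_integrableZ _ (box_integrable_kw F))) (box_intZ _ iE) (box_intZ _ (box_integrable_kw F)).
  by apply: lerD; rewrite ler_pM2l.
have -> : (1 + d^-1) * eta = e / 2 
  by rewrite /eta; move: (1 + d^-1) d1 => w w0; field; rewrite gt_eqF.
have : d * K <= e / 2.
  rewrite /d mulrAC ler_pdivrMr; last by rewrite mulr_gt0 // ltr_wpDl.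
  by rewrite (_ : e / 2 * (2 * (K + 1)) = e * K + e); [rewrite lerDl ltW|field].
lra.
Qed.

(** Parseval for finite sums, carried to the limit by [weight_approx]. *)
Lemma box_int_density : box_int density = kap ^+ 2 * (S * A).
Proof.
have k0 : 0 <= kap ^+ 2 := sqr_ge0 kap.
have A0 : 0 < A := area_gt0.
apply/eqP; rewrite -subr_eq0 -normr_le0; apply/ler_addgt0Pr => e e0; rewrite add0r.
(* Chosen so that the two errors e' and kap^2 (e' A) add up to e. *)
pose e' := e / (1 + kap ^+ 2 * A).
have c0 : 0 < 1 + kap ^+ 2 * A by rewrite ltr_pwDl // mulr_ge0 // ltW.
have e'0 : 0 < e' by rewrite divr_gt0.
have [F [FS FJ]] := weight_approx e'0.
have -> : box_int density - kap ^+ 2 * (S * A) =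
    box_int (fun x => density x - kw F x) - kap ^+ 2 * ((S - \sum_(m <- F) u m ^+ 2) * A).
  rewrite (box_intD box_integrable_density (box_integrableN (box_integrable_kw F))).
  have -> : box_int (fun x => - kw F x) = - box_int (kw F).
    rewrite -mulN1r -box_intZ //; by congr box_int; apply/funext => x; rewrite mulN1r.
  rewrite box_intZ; last exact: box_integrable_weight.
  by rewrite box_int_weight -/A; ring.
apply: (le_trans (ler_normB _ _)).
have -> : e = e' + kap ^+ 2 * (e' * A) by rewrite /e'; field; rewrite gt_eqF.
apply: lerD.
  apply: le_trans FJ; apply: box_int_norm; apply: box_integrableD; [exact: box_integrable_density|exact: box_integrableN].
have h := sum_u2_le F.
rewrite ger0_norm; last by rewrite mulr_ge0 // mulr_ge0 ?(ltW A0) // subr_ge0.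
by rewrite ler_wpM2l // ler_pM2r //; lra.
Qed.

(** The hypothesis is uniform in F, and a mode is bounded by 1, so the L1 error of [weight_approx]
    controls the passage to the limit. *)
Lemma box_int_trig_density z th (C : R) :
  (forall F : {fset I}, \sum_(m <- F | m + z \in F) `|u m * u (m + z)| <= C * S) ->
  `|box_int (fun x => trig z th x * density x)| <= C * box_int density.
Proof.
move=> CP.
have k0 : 0 <= kap ^+ 2 := sqr_ge0 kap.
apply/ler_addgt0Pr => e e0.
have [F [_ FJ]] := weight_approx e0.
have it h : box_integrable h -> box_integrable (fun x => trig z th x * h x).
  by apply: box_integrable_mul; [exact: measurable_trig|exact: trig_le1].
have iD : box_integrable (fun x => density x - kw F x) by apply: box_integrableD; [exact: box_integrable_density|exact: box_integrableN].
have -> : box_int (fun x => trig z th x * density x) =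
    box_int (fun x => trig z th x * kw F x) + box_int (fun x => trig z th x * (density x - kw F x)).
  rewrite -box_intD; [|exact: it|exact: it].
  by congr box_int; apply/funext => x; rewrite -mulrDr addrC subrK.
apply: (le_trans (ler_normD _ _)); apply: lerD.
  have -> : (fun x => trig z th x * kw F x) = (fun x => kap ^+ 2 * (trig z th x * weight x0 u F x)).
    by apply/funext => x; rewrite mulrCA.
  rewrite box_intZ; last by apply: it; exact: box_integrable_weight.
  rewrite normrM (ger0_norm k0) box_int_density mulrCA ler_wpM2l //.
  apply: (le_trans (box_int_trig_weight _ _ _ _ _)).
  by rewrite mulrA ler_wpM2r // ltW // area_gt0.
apply: (le_trans (box_int_norm (it _ iD))); apply: le_trans FJ.
apply: box_int_le; [by apply: box_integrable_norm; exact: it|exact: box_integrable_norm|].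
by move=> x _; rewrite normrM ler_piMl // trig_le1.
Qed.

End L2Limit.
End GreenWeight.
End BoxIntegral.

(** * Uniform approximation by trigonometric polynomials *)

Section Fejer.
Context {R : realType}.
Implicit Types (t h al : R) (N : nat).

Lemma cosD_int (k : int) (th : R) : cos (k%:~R * (2 * pi) + th) = cos th.
Proof.
by rewrite -[LHS](sinDpihalf) -addrA sinD_int sinDpihalf.
Qed.

(** Telescoping of 2 sin h cos y = sin (y + h) - sin (y - h). *)
Lemma sum_cos_progression al h N :
  2 * sin h * (\sum_(k < N) cos (al + k%:R * (2 * h))) =
  sin (al + N%:R * (2 * h) - h) - sin (al - h).
Proof.
rewrite -(big_mkord xpredT (fun k => cos (al + k%:R * (2 * h)))) mulr_sumr.
rewrite (@telescope_sumr_eq _ 0 N (fun k : nat => sin (al + k%:R * (2 * h) - h))) //.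
  by rewrite mul0r addr0.
move=> k _; set y := al + k%:R * (2 * h).
have -> : al + k.+1%:R * (2 * h) - h = y + h by rewrite /y -natr1; ring.
by rewrite sinD sinB; ring.
Qed.

(** The squared modulus of the sum of exp (i k t) over k < N, divided by N^2 so that the N
    translates by [node] add up to 1. *)
Definition fejer N t : R := N%:R ^- 2 * \sum_(k < N) \sum_(l < N) cos (k%:R * t - l%:R * t).

Lemma fejer_sqr N t : fejer N t = N%:R ^- 2 *
  ((\sum_(k < N) cos (k%:R * t)) ^+ 2 + (\sum_(k < N) sin (k%:R * t)) ^+ 2).
Proof.
have := sqr_sum_cos_sin (index_enum 'I_N) (fun=> 1 : R) (fun k : 'I_N => k%:R * t).
rewrite /fejer; under eq_bigr do rewrite mul1r.
under [X in _ + X ^+ 2]eq_bigr do rewrite mul1r.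
move=> ->; congr (_ * _); apply: eq_bigr => k _; apply: eq_bigr => l _.
by rewrite !mul1r.
Qed.

Lemma fejer_ge0 N t : 0 <= fejer N t.
Proof. by rewrite fejer_sqr mulr_ge0 ?invr_ge0 ?exprn_ge0 // addr_ge0 ?sqr_ge0. Qed.

(** With h = t / 2 one has (2 sin h)^2 = 2 (1 - cos t). Multiplying the exponential sum by 2 sin h
    telescopes it to a quantity of squared modulus 2 - 2 cos (b + h) <= 4. *)
Lemma vers_fejer N t : (1 - cos t) * fejer N t <= 2 * N%:R ^- 2.
Proof.
rewrite fejer_sqr mulrCA mulrC; apply: ler_wpM2r; first by rewrite invr_ge0 exprn_ge0.
pose h := t / 2; pose b := N%:R * t - h.
have tE : t = 2 * h by rewrite /h; field.
have C : 2 * sin h * (\sum_(k < N) cos (k%:R * t)) = sin b + sin h.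
  have := sum_cos_progression 0 h N; under eq_bigr do rewrite add0r -tE.
  by rewrite add0r sub0r sinN opprK -tE.
have D : 2 * sin h * (\sum_(k < N) sin (k%:R * t)) = cos h - cos b.
  have := sum_cos_progression (- (pi / 2)) h N.
  have e (x : R) : cos (- (pi / 2) + x) = sin x by rewrite addrC cosBpihalf.
  have e' (x : R) : sin (- (pi / 2) + x) = - cos x by rewrite addrC sinBpihalf.
  under eq_bigr do rewrite e -tE.
  by move=> ->; rewrite -tE -addrA !e' opprK cosN [LHS]addrC.
have : (2 * sin h) ^+ 2 * ((\sum_(k < N) cos (k%:R * t)) ^+ 2 +
    (\sum_(k < N) sin (k%:R * t)) ^+ 2) <= 4.
  rewrite mulrDr -!exprMn C D.
  have -> : (sin b + sin h) ^+ 2 + (cos h - cos b) ^+ 2 =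
    (cos b ^+ 2 + sin b ^+ 2) + (cos h ^+ 2 + sin h ^+ 2) - 2 * (cos b * cos h - sin b * sin h) by ring.
  by rewrite !cos2Dsin2 -cosD; have := cos_geN1 (b + h); lra.
have -> : (2 * sin h) ^+ 2 = 2 * (1 - cos t).
  have := cos2Dsin2 h; have -> : cos t = cos h ^+ 2 - sin h ^+ 2.
    by rewrite [in LHS]tE mulr_natl mulr2n cosD !expr2.
  by move=> e; rewrite exprMn; lra.
by rewrite -mulrA -ler_pdivlMl // => /le_trans; apply; lra.
Qed.

Definition node N (j : nat) : R := j%:R * (2 * pi / N%:R).

(** The ends of the telescoping sum differ by a multiple of 2 pi, while 0 < d < N keeps sin h away
    from zero. *)
Lemma sum_cos_nodes N d t : (0 < d < N)%N ->
  \sum_(j < N) cos (d%:R * (t - node N j)) = 0.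
Proof.
move=> /andP[d0 dN]; have N0 : (0 : R) < N%:R by rewrite ltr0n (ltn_trans d0).
pose h : R := - (d%:R * pi / N%:R).
have := sum_cos_progression (d%:R * t) h N.
have -> : d%:R * t + N%:R * (2 * h) - h = (- (Posz d))%:~R * (2 * pi) + (d%:R * t - h).
  by rewrite mulrNz -pmulrn /h; field; rewrite gt_eqF.
rewrite sinD_int subrr.
have sh : 2 * sin h != 0.
  rewrite mulf_neq0 ?pnatr_eq0 // /h sinN oppr_eq0 gt_eqF //; apply: sin_gt0_pi.
  apply/andP; split; first by rewrite divr_gt0 // mulr_gt0 ?pi_gt0 ?ltr0n.
  by rewrite ltr_pdivrMr // mulrC ltr_pM2l ?pi_gt0 // ltr_nat.
move/eqP; rewrite mulf_eq0 (negbTE sh) /= => /eqP s0; rewrite -[RHS]s0.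
apply: eq_bigr => j _; congr cos; rewrite /node /h; field; rewrite gt_eqF //.
Qed.

(** Off-diagonal pairs k != l vanish by [sum_cos_nodes] with d = |k - l| < N; the diagonal
    contributes N^2. *)
Lemma sum_fejer_nodes N t : (0 < N)%N -> \sum_(j < N) fejer N (t - node N j) = 1.
Proof.
move=> N0; rewrite /fejer -mulr_sumr exchange_big /=.
have Nn0 : (N%:R : R) != 0 by rewrite pnatr_eq0 -lt0n.
rewrite [X in _ * X](_ : _ = \sum_(k < N) N%:R); last first.
  apply: eq_bigr => k _; rewrite exchange_big /= (bigD1 k) //=.
  under eq_bigr do rewrite subrr cos0.
  rewrite sumr_const card_ord [X in _ + X]big1 ?addr0 // => l lk.
  have [kl|kl] := ltnP k l.
    rewrite -[RHS](@sum_cos_nodes N (l - k) t).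
      apply: eq_bigr => j _; rewrite -cosN; congr cos.
      by rewrite natrB ?(ltnW kl) //; ring.
    by rewrite subn_gt0 kl (leq_ltn_trans (leq_subr _ _)).
  have {}kl : (l < k)%N by rewrite ltn_neqAle kl andbT.
  rewrite -[RHS](@sum_cos_nodes N (k - l) t).
    apply: eq_bigr => j _; congr cos.
    by rewrite natrB ?(ltnW kl) //; ring.
  by rewrite subn_gt0 kl (leq_ltn_trans (leq_subr _ _)).
by rewrite sumr_const card_ord -mulr_natr expr2 invfM; field.
Qed.

Lemma sum_vers_fejer N t : (0 < N)%N ->
  \sum_(j < N) fejer N (t - node N j) * (1 - cos (t - node N j)) <= 2 / N%:R.
Proof.
move=> N0; have Nn0 : (N%:R : R) != 0 by rewrite pnatr_eq0 -lt0n.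
apply: (@le_trans _ _ (\sum_(j < N) 2 * N%:R ^- 2)).
  by apply: ler_sum => j _; rewrite mulrC vers_fejer.
rewrite sumr_const card_ord -mulr_natr le_eqVlt; apply/orP; left; apply/eqP.
by field.
Qed.

End Fejer.

Section UniformContinuity.
Context {R : realType}.

(** Heine-Cantor with only x confined to K, so that y may leave the fundamental box. *)
Lemma compact_unif_continuous (U : pseudoMetricType R) (f : U -> R) (K : set U) :
  compact K -> continuous f -> forall e : R, 0 < e ->
  exists2 d : R, 0 < d & forall x y, K x -> ball x d y -> `|f x - f y| < e.
Proof.
move=> /compact_near_coveringP cK cf e e0.
have [|N _ HN] := cK nat \oo
    (fun n x => forall y, ball x n.+1%:R^-1 y -> `|f x - f y| < e) _.
  move=> x Kx; have e20 : 0 < e / 2 by rewrite divr_gt0.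
  have := cf x => /cvgrPdist_lt/(_ _ e20)/nbhs_ballP[r /= r0 rP].
  have r20 : 0 < r / 2 by rewrite divr_gt0.
  exists (ball x (r / 2), [set n | n.+1%:R^-1 < r / 2]) => /=.
    split; first exact: nbhsx_ballx.
    exact: near_infty_natSinv_lt (PosNum r20).
  move=> [x' n] /= [xx' nr] y x'y.
  have h1 : `|f x - f x'| < e / 2 by apply: rP; apply: le_ball xx'; lra.
  have h2 : `|f x - f y| < e / 2.
    apply: rP; have -> : r = r / 2 + r / 2 by field.
    by apply: (ball_triangle xx'); apply: le_ball x'y; exact: ltW.
  have -> : f x' - f y = (f x - f y) - (f x - f x') by ring.
  by apply: le_lt_trans (ler_normB _ _) _; lra.
exists N.+1%:R^-1; first by rewrite invr_gt0.
by move=> x y Kx; apply: HN => //=.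
Qed.

End UniformContinuity.

Section TrigApprox.
Context {R : realType} (a b c : R).
Hypotheses (ha : 0 < a) (hb : 0 < b) (hc : 0 < c).
Notation I := (int * int * int)%type.
Notation trig := (trig a b c).
Implicit Types (f g h : R * R * R -> R) (x y : R * R * R).

(** A list entry holds a coefficient, a frequency and a phase. *)
Definition trig_poly h := exists s : seq (R * (I * R)),
  forall x, h x = \sum_(p <- s) p.1 * trig p.2.1 p.2.2 x.

Lemma trig_poly_ext g h : g =1 h -> trig_poly g -> trig_poly h.
Proof. by move=> gh [s sP]; exists s => x; rewrite -gh. Qed.

Lemma trig_poly_trig z th : trig_poly (trig z th).
Proof. by exists [:: (1, (z, th))] => x; rewrite big_seq1 mul1r. Qed.

Lemma trig_polyD g h : trig_poly g -> trig_poly h -> trig_poly (fun x => g x + h x).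
Proof. by move=> [s sP] [r rP]; exists (s ++ r) => x; rewrite big_cat /= sP rP. Qed.

Lemma trig_polyZ k g : trig_poly g -> trig_poly (fun x => k * g x).
Proof.
move=> [s sP]; exists [seq (k * p.1, p.2) | p <- s] => x.
by rewrite sP mulr_sumr big_map; apply: eq_bigr => p _; rewrite mulrA.
Qed.

Lemma trig_poly_sum (K : Type) (s : seq K) (g : K -> R * R * R -> R) :
  (forall k, trig_poly (g k)) -> trig_poly (fun x => \sum_(k <- s) g k x).
Proof.
move=> gP; elim: s => [|k s IH]; first by exists [::] => x; rewrite !big_nil.
by apply: trig_poly_ext (trig_polyD (gP k) IH) => x; rewrite big_cons.
Qed.

Lemma trig_polyM g h : trig_poly g -> trig_poly h -> trig_poly (fun x => g x * h x).
Proof.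
move=> [s sP] [r rP].
apply: (@trig_poly_ext (fun x => \sum_(p <- s) \sum_(p' <- r)
    (p.1 * p'.1 / 2) * (trig (p.2.1 - p'.2.1) (p.2.2 - p'.2.2) x +
                        trig (p.2.1 + p'.2.1) (p.2.2 + p'.2.2) x))).
  move=> x; rewrite sP rP big_distrlr /=; apply: eq_bigr => p _; apply: eq_bigr => p' _.
  by rewrite mulrACA trigM; ring.
apply: trig_poly_sum => p; apply: trig_poly_sum => p'; apply: trig_polyZ.
by apply: trig_polyD; exact: trig_poly_trig.
Qed.

Lemma trig_poly_fejer N p (X : R * R * R -> R) (zk : int -> I) :
  (forall k x, dot (dual_vec a b c (zk k)) x = k%:~R * X x) ->
  trig_poly (fun x => fejer N (X x - p)).
Proof.
move=> XP; apply: trig_polyZ; apply: trig_poly_sum => k; apply: trig_poly_sum => l.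
apply: (trig_poly_ext _ (trig_poly_trig (zk (Posz k - Posz l)) (l%:R * p - k%:R * p))) => x.
by rewrite /trig XP rmorphB /=; congr cos; rewrite -!pmulrn; ring.
Qed.

(** Rounds s / (2 pi e) to a nearest integer. *)
Lemma shift_small (e s : R) : 0 < e -> exists k : int, `|s + 2 * pi * (e * k%:~R)| <= pi * e.
Proof.
move=> e0; pose P := 2 * pi * e.
have P0 : 0 < P by rewrite !mulr_gt0 ?pi_gt0.
have /andP[] := floor_itv (s / P + 1 / 2); set k := Num.floor _ => k1 k2.
exists (- k); rewrite mulrNz.
have -> : s + 2 * pi * (e * - k%:~R) = P * (s / P - k%:~R).
  by rewrite mulrBr [P * (s / P)]mulrC divfK ?gt_eqF // /P; ring.
rewrite intrD in k2.
rewrite normrM (gtr0_norm P0) (_ : pi * e = P * (1 / 2)); last by rewrite /P; field.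
by rewrite ler_pM2l // ler_norml; apply/andP; split; lra.
Qed.

Lemma shift_box (e s : R) : 0 < e -> exists k : int, 0 <= s + 2 * pi * (e * k%:~R) <= 2 * pi * e.
Proof.
move=> e0; have [k] := shift_small (s - pi * e) e0.
rewrite ler_norml => /andP[k1 k2]; exists k; apply/andP; split; lra.
Qed.

(** 1 - cos is even and increasing on [0, pi], so its value at d / e is a lower bound. *)
Lemma vers_lb (e d : R) : 0 < e -> 0 < d -> d <= pi * e -> exists2 sg : R, 0 < sg &
  forall s, d <= `|s| -> `|s| <= pi * e -> sg <= 1 - cos (s / e).
Proof.
move=> e0 d0 de.
have pie : 0 <= d / e <= pi.
  by apply/andP; split; [exact: divr_ge0 (ltW d0) (ltW e0)|rewrite ler_pdivrMr].
have cde : cos (d / e) < 1.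
  by rewrite -cos0 ltr_cos ?in_itv /= ?lexx ?pi_ge0 // divr_gt0.
exists (1 - cos (d / e)); first by rewrite subr_gt0.
move=> s ds se; rewrite lerD2l lerN2.
have -> : cos (s / e) = cos (`|s| / e).
  by have [//|s0] := ger0P s; rewrite mulNr cosN.
rewrite leNgt ltr_cos ?in_itv /= ?pie //; first by rewrite -leNgt ler_pM2r ?invr_gt0.
by rewrite divr_ge0 ?(ltW e0) //= ler_pdivrMr.
Qed.

(** A smooth periodic substitute for the squared distance on the torus. *)
Definition versx x y : R := (1 - cos ((x.1.1 - y.1.1) / a)) +
  (1 - cos ((x.1.2 - y.1.2) / b)) + (1 - cos ((x.2 - y.2) / c)).

Lemma cos_shift (e s : R) (k : int) : 0 < e ->
  cos ((s + 2 * pi * (e * k%:~R)) / e) = cos (s / e).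
Proof.
move=> e0; rewrite -[RHS](cosD_int k); congr cos; field; lra.
Qed.

Section Periodic.
Variable f : R * R * R -> R.
Hypothesis cf : continuous f.
Hypothesis pf : forall m x, f (x + period a b c m) = f x.

Let K : set (R * R * R) := (`[0, 2 * pi * a] `*` `[0, 2 * pi * b]) `*` `[0, 2 * pi * c].

Let cK : compact K.
Proof. by apply: compact_setX; [apply: compact_setX|]; exact: segment_compact. Qed.

Let shiftK x : exists m, K (x + period a b c m).
Proof.
have [k1 h1] := shift_box x.1.1 ha; have [k2 h2] := shift_box x.1.2 hb.
have [k3 h3] := shift_box x.2 hc.
by exists (k1, k2, k3); split; [split|]; rewrite /= in_itv.
Qed.

Lemma periodic_bounded : exists2 M : R, 0 <= M & forall x, `|f x| <= M.
Proof.
have /compact_bounded[M [_ MP]] : compact (f @` K).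
  by apply: continuous_compact => //; exact: continuous_subspaceT.
exists (`|M| + 1) => [|x]; first by rewrite addr_ge0.
have [m Km] := shiftK x; rewrite -(pf m).
apply: MP; first by rewrite (le_lt_trans (ler_norm M)) // ltrDl.
by exists (x + period a b c m).
Qed.

(** Move x into the closed box and y to a representative closest to x in each coordinate. If all
    coordinates are within d, uniform continuity applies; otherwise one summand of [versx] is
    bounded below and M absorbs twice the sup norm of f. *)
Lemma periodic_modulus (e : R) : 0 < e -> exists2 M : R, 0 <= M &
  forall x y, `|f x - f y| <= e + M * versx x y.
Proof.
move=> e0; have [M0 M00 M0P] := periodic_bounded.
have [d1 d10 d1P] := compact_unif_continuous cK cf e0.
pose d := Num.min d1 (Num.min (pi * a) (Num.min (pi * b) (pi * c))).
have d0 : 0 < d by rewrite !lt_min d10 !mulr_gt0 ?pi_gt0.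
have [dd1 [da [db dc]]] : d <= d1 /\ d <= pi * a /\ d <= pi * b /\ d <= pi * c.
  by rewrite /d !ge_min !lexx !orbT.
have [sa sa0 saP] := vers_lb ha d0 da.
have [sb sb0 sbP] := vers_lb hb d0 db.
have [sc sc0 scP] := vers_lb hc d0 dc.
pose M := 2 * M0 / sa + 2 * M0 / sb + 2 * M0 / sc.
have Ma : 0 <= 2 * M0 / sa by rewrite divr_ge0 ?mulr_ge0 ?(ltW sa0).
have Mb : 0 <= 2 * M0 / sb by rewrite divr_ge0 ?mulr_ge0 ?(ltW sb0).
have Mc : 0 <= 2 * M0 / sc by rewrite divr_ge0 ?mulr_ge0 ?(ltW sc0).
exists M; first by rewrite !addr_ge0.
move=> x0 y0.
have [m Kx] := shiftK x0; rewrite -(pf m x0); set x := x0 + period a b c m in Kx *.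
have [k1 h1] := shift_small (y0.1.1 - x.1.1) ha.
have [k2 h2] := shift_small (y0.1.2 - x.1.2) hb.
have [k3 h3] := shift_small (y0.2 - x.2) hc.
rewrite -(pf (k1, k2, k3) y0); set y := y0 + _.
have vE : versx x0 y0 = versx y x.
  have opp (u v w : R) : cos ((u - v) / w) = cos ((v - u) / w).
    by rewrite -cosN -mulNr opprB.
  have sh (u v w : R) (k k' : int) : 0 < w ->
      cos ((u + 2 * pi * (w * k%:~R) - (v + 2 * pi * (w * k'%:~R))) / w) = cos ((u - v) / w).
    move=> w0; rewrite -[RHS](cos_shift (u - v) (k - k') w0) rmorphB /=; congr cos; congr (_ / _); ring.
  by rewrite /versx (opp x0.1.1) (opp x0.1.2) (opp x0.2) /x /y /= !sh.
rewrite vE /versx.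
have v0 (u : R) : 0 <= 1 - cos u by rewrite subr_ge0 cos_le1.
have va := v0 ((y.1.1 - x.1.1) / a); have vb := v0 ((y.1.2 - x.1.2) / b).
have vc := v0 ((y.2 - x.2) / c).
have ya : y.1.1 - x.1.1 = y0.1.1 - x.1.1 + 2 * pi * (a * k1%:~R) by rewrite /y /=; ring.
have yb : y.1.2 - x.1.2 = y0.1.2 - x.1.2 + 2 * pi * (b * k2%:~R) by rewrite /y /=; ring.
have yc : y.2 - x.2 = y0.2 - x.2 + 2 * pi * (c * k3%:~R) by rewrite /y /=; ring.
rewrite -ya in h1; rewrite -yb in h2; rewrite -yc in h3.
have fxy : `|f x - f y| <= 2 * M0.
  by apply: le_trans (ler_normB _ _) _; have := M0P x; have := M0P y; lra.
have fin (sg v : R) : 0 < sg -> sg <= v -> 2 * M0 <= 2 * M0 / sg * v.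
  by move=> sg0 sgv; rewrite mulrAC ler_pdivlMr // ler_wpM2l // mulr_ge0.
have [h1'|h1'] := leP d `|y.1.1 - x.1.1|.
  have := fin _ _ sa0 (saP _ h1' h1); rewrite /M; nra.
have [h2'|h2'] := leP d `|y.1.2 - x.1.2|.
  have := fin _ _ sb0 (sbP _ h2' h2); rewrite /M; nra.
have [h3'|h3'] := leP d `|y.2 - x.2|.
  have := fin _ _ sc0 (scP _ h3' h3); rewrite /M; nra.
have : `|f x - f y| < e.
  apply: d1P => //; rewrite /ball /= /prod_ball /ball /= /prod_ball /ball /=.
  by rewrite !(distrC x.1.1) !(distrC x.1.2) !(distrC x.2); split; [split|]; apply: lt_le_trans dd1.
have : 0 <= M * (1 - cos ((y.1.1 - x.1.1) / a) + (1 - cos ((y.1.2 - x.1.2) / b)) + (1 - cos ((y.2 - x.2) / c))).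
  by rewrite mulr_ge0 // !addr_ge0.
lra.
Qed.

Lemma weighted_mean N (w v : 'I_N -> R) (X M : R) : \sum_j w j = 1 ->
  \sum_j w j * (X + M * v j) = X + M * \sum_j w j * v j.
Proof.
move=> w1; rewrite -[X in RHS]mulr1 -w1 !mulr_sumr -big_split /=.
by apply: eq_bigr => j _; ring.
Qed.

(** T averages samples of f at the nodes with product Fejer weights, which are nonnegative and sum
    to 1. Hence |f - T| is at most the average of e / 2 + M [versx], and each of the three versines
    averages to at most 2 / N. *)
Lemma trig_poly_dense (e : R) : 0 < e -> exists2 T, trig_poly T & forall x, `|f x - T x| <= e.
Proof.
move=> e0; have e20 : 0 < e / 2 by rewrite divr_gt0.
have [M M0 MP] := periodic_modulus e20.
(* N > 12 M / e makes the total versine error 3 M (2 / N) at most e / 2. *)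
pose N := (Num.truncn (12 * M / e)).+1.
have N0 : (0 < N)%N by [].
have NM : 6 * M / N%:R <= e / 2.
  rewrite ler_pdivrMr ?ltr0n //.
  have : 12 * M / e < N%:R by rewrite truncnS_gt.
  by rewrite ltr_pdivrMr // => h; lra.
pose pt (j k l : nat) : R * R * R := (a * node N j, b * node N k, c * node N l).
pose Ka x (j : 'I_N) := fejer N (x.1.1 / a - node N j).
pose Kb x (j : 'I_N) := fejer N (x.1.2 / b - node N j).
pose Kc x (j : 'I_N) := fejer N (x.2 / c - node N j).
exists (fun x => \sum_j Ka x j * \sum_k Kb x k * \sum_l Kc x l * f (pt j k l)).
  have pa j : trig_poly (Ka^~ j).
    apply: (trig_poly_fejer N (node N j) (X := fun x => x.1.1 / a) (zk := fun k => (k, 0, 0))) => k x.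
    by rewrite /dot /=; field; rewrite !gt_eqF.
  have pb j : trig_poly (Kb^~ j).
    apply: (trig_poly_fejer N (node N j) (X := fun x => x.1.2 / b) (zk := fun k => (0, k, 0))) => k x.
    by rewrite /dot /=; field; rewrite !gt_eqF.
  have pc j : trig_poly (Kc^~ j).
    apply: (trig_poly_fejer N (node N j) (X := fun x => x.2 / c) (zk := fun k => (0, 0, k))) => k x.
    by rewrite /dot /=; field; rewrite !gt_eqF.
  apply: trig_poly_sum => j; apply: trig_polyM => //.
  apply: trig_poly_sum => k; apply: trig_polyM => //.
  apply: trig_poly_sum => l; apply: (trig_poly_ext _ (trig_polyZ (f (pt j k l)) (pc l))) => x.
  by rewrite mulrC.
move=> x.
have a1 : \sum_j Ka x j = 1 by exact: sum_fejer_nodes.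
have b1 : \sum_j Kb x j = 1 by exact: sum_fejer_nodes.
have c1 : \sum_j Kc x j = 1 by exact: sum_fejer_nodes.
have -> : f x - \sum_j Ka x j * (\sum_k Kb x k * (\sum_l Kc x l * f (pt j k l))) =
    \sum_j Ka x j * (\sum_k Kb x k * (\sum_l Kc x l * (f x - f (pt j k l)))).
  have step (w : 'I_N -> R) (g : 'I_N -> R) : \sum_j w j = 1 ->
      \sum_j w j * (f x - g j) = f x - \sum_j w j * g j.
    move=> w1; under eq_bigr do rewrite mulrBr; rewrite sumrB -mulr_suml w1 mul1r //.
  under [RHS]eq_bigr do under eq_bigr do rewrite step //.
  under [RHS]eq_bigr do rewrite step //.
  by rewrite step.
pose va (j : 'I_N) : R := 1 - cos (x.1.1 / a - node N j).
pose vb (j : 'I_N) : R := 1 - cos (x.1.2 / b - node N j).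
pose vc (j : 'I_N) : R := 1 - cos (x.2 / c - node N j).
have vE (j k l : 'I_N) : versx x (pt j k l) = va j + vb k + vc l.
  by rewrite /versx /va /vb /vc /pt /=; congr (1 - cos _ + (1 - cos _) + (1 - cos _)); field; rewrite gt_eqF.
have nsum (w g g' : 'I_N -> R) : (forall j, 0 <= w j) -> (forall j, `|g j| <= g' j) ->
    `|\sum_j w j * g j| <= \sum_j w j * g' j.
  move=> w0 gg'; apply: (le_trans (ler_norm_sum _ _ _)); apply: ler_sum => j _.
  by rewrite normrM ger0_norm // ler_wpM2l.
have Ka0 j : 0 <= Ka x j by exact: fejer_ge0.
have Kb0 j : 0 <= Kb x j by exact: fejer_ge0.
have Kc0 j : 0 <= Kc x j by exact: fejer_ge0.
pose A := \sum_j Ka x j * va j; pose B := \sum_j Kb x j * vb j; pose C := \sum_j Kc x j * vc j.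
(* The three averages are removed one after another; [weighted_mean] trades the means A, B, C for va
   j, vb k, vc l. *)
apply: (@le_trans _ _ (e / 2 + M * C + M * B + M * A)).
  rewrite /A -weighted_mean //; apply: (nsum) => // j.
  rewrite (_ : e / 2 + M * C + M * B + M * va j = (e / 2 + M * va j + M * C) + M * B); last by ring.
  rewrite /B -weighted_mean //; apply: (nsum) => // k.
  rewrite (_ : e / 2 + M * va j + M * C + M * vb k = (e / 2 + M * va j + M * vb k) + M * C); last by ring.
  rewrite /C -weighted_mean //; apply: (nsum) => // l.
  by apply: le_trans (MP _ _) _; rewrite vE; lra.
have AN : A <= 2 / N%:R by exact: sum_vers_fejer.
have BN : B <= 2 / N%:R by exact: sum_vers_fejer.
have CN : C <= 2 / N%:R by exact: sum_vers_fejer.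
have := ler_wpM2l M0 AN; have := ler_wpM2l M0 BN; have := ler_wpM2l M0 CN.
move: NM; rewrite -!mulrA; lra.
Qed.

End Periodic.
End TrigApprox.

(** * Equidistribution *)

Lemma normc_le {R : realType} (z : R[i]) :
  ComplexField.Normc.normc z <= `|complex.Re z| + `|complex.Im z|.
Proof.
case: z => u v /=; rewrite -(@ger0_norm _ (`|u| + `|v|)) ?addr_ge0 //.
rewrite -sqrtr_sqr; apply: ler_wsqrtr.
rewrite sqrrD -!normrX !(ger0_norm (sqr_ge0 _)) addrAC lerDl.
by rewrite mulrn_wge0 // mulr_ge0.
Qed.

Section Equidistribution.
Context {R : realType} (a b c : R).
Hypotheses (ha : 0 < a) (hb : 0 < b) (hc : 0 < c).
Variables (x0 : R * R * R) (tau : R) (G : R -> R * R * R -> R[i]).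
Notation I := (int * int * int)%type.
Notation q := (nsq a b c).
Notation A := (area a b c).
Notation J := (box_int a b c).
Notation trig := (trig a b c).
Notation Reg := (regular a b c tau).
Implicit Types (f h : R * R * R -> R) (l e : R).
Notation integrable := (box_integrable a b c).

Hypothesis greenG : forall l, new q tau l -> is_green a b c x0 l (G l).

Let F0 := within Reg (pinfty_nbhs R).
Let A0 : 0 < A := area_gt0 ha hb hc.

Let offR l : Reg l -> off q l. Proof. by case=> -[]. Qed.
Let greenR l : Reg l -> is_green a b c x0 l (G l).
Proof. by case=> /greenG. Qed.

Notation dens := (fun l => density (G l)).

Lemma box_int_density_gt0 l : Reg l -> 0 < J (dens l).
Proof.
move=> rl; rewrite (box_int_density ha hb hc (offR rl) (greenR rl)).
have k0 : 0 < 1 / (8 * pi ^+ 3) :> R.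
  by rewrite divr_gt0 // mulr_gt0 // exprn_gt0 // pi_gt0.
rewrite mulr_gt0 ?exprn_gt0 // mulr_gt0 //.
apply: (resolvent2_gt0 (0 : I) (nsq_ge0 a b c) (levelP ha hb hc) (card_level ha hb hc)).
exact: offR.
Qed.

Let integrable_dens l : Reg l -> integrable (dens l).
Proof. by move=> rl; exact: (box_integrable_density (greenR rl)). Qed.

Let dens_ge0 l x : 0 <= dens l x. Proof. exact: sqr_ge0. Qed.

Definition bounded_measurable h := measurable_fun (box a b c) h /\
  exists2 M : R, 0 <= M & forall x, `|h x| <= M.

Lemma box_integrable_bounded_measurable h g : bounded_measurable h -> integrable g ->
  integrable (fun x => h x * g x).
Proof.
move=> [mh [M M0 hM]] ig.
apply: (box_integrable_dominated _ (box_integrableZ M (box_integrable_norm ig))) => [|x _].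
  by apply: measurable_funM => //; apply/measurable_EFinP; exact: measurable_int ig.
by rewrite normrM ler_wpM2r.
Qed.

Lemma box_integrable_bounded h : bounded_measurable h -> integrable h.
Proof.
move=> bh; have := box_integrable_bounded_measurable bh (box_integrable_cst ha hb hc 1).
by under eq_fun do rewrite mulr1.
Qed.

Lemma bounded_measurableD h f : bounded_measurable h -> bounded_measurable f ->
  bounded_measurable (fun x => h x + f x).
Proof.
move=> [mh [M M0 hM]] [mf [N N0 fN]]; split; first exact: measurable_funD.
by exists (M + N) => [|x]; [exact: addr_ge0|rewrite (le_trans (ler_normD _ _)) ?lerD].
Qed.

Lemma bounded_measurableZ k h : bounded_measurable h -> bounded_measurable (fun x => k * h x).
Proof.
move=> [mh [M M0 hM]]; split; first by apply: measurable_funM => //; exact: measurable_cst.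
by exists (`|k| * M) => [|x]; [exact: mulr_ge0|rewrite normrM ler_wpM2l].
Qed.

Lemma bounded_measurable_trig z th : bounded_measurable (trig z th).
Proof.
by split; [exact: measurable_trig|exists 1 => // x; exact: trig_le1].
Qed.

Lemma bounded_measurable0 : bounded_measurable (fun=> 0).
Proof. by split; [exact: measurable_cst|exists 0 => // x; rewrite normr0]. Qed.

Lemma trig_poly_bounded h : trig_poly a b c h -> bounded_measurable h.
Proof.
move=> [s /funext ->]; elim: s => [|p s IH].
  by under eq_fun do rewrite big_nil; exact: bounded_measurable0.
under eq_fun do rewrite big_cons.
apply: bounded_measurableD => //; apply: bounded_measurableZ.
exact: bounded_measurable_trig.
Qed.

(** Measurability is inherited from approximating trigonometric polynomials, boundedness from
    compactness of the closed box. *)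
Lemma continuous_periodic_bounded f : continuous f ->
  (forall m x, f (x + period a b c m) = f x) -> bounded_measurable f.
Proof.
move=> cf pf; split; last exact: (periodic_bounded ha hb hc cf pf).
have h n : exists T, trig_poly a b c T /\ forall x, `|f x - T x| <= n.+1%:R^-1.
  have n0 : 0 < n.+1%:R^-1 :> R by [].
  by have [T ? ?] := trig_poly_dense ha hb hc cf pf n0; exists T.
have [T TP] := choice h.
apply: (measurable_fun_cvg (h := T)) => [n|x _].
  by have [/trig_poly_bounded[]] := TP n.
apply/cvgrPdist_lt => e e0; have := near_infty_natSinv_lt (PosNum e0).
by apply: filterS => n; apply: le_lt_trans; have [] := TP n.
Qed.

(** The difference between the means of h under the density and under volume; dividing by the mass
    of [dens l] performs the normalization. *)
Definition discrepancy h l := J (fun x => h x * dens l x) / J (dens l) - J h / A.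

Lemma discrepancyD h f l : Reg l -> bounded_measurable h -> bounded_measurable f ->
  discrepancy (fun x => h x + f x) l = discrepancy h l + discrepancy f l.
Proof.
move=> rl bh bf; rewrite /discrepancy (box_intD (box_integrable_bounded bh) (box_integrable_bounded bf)).
have -> : J (fun x => (h x + f x) * dens l x) =
    J (fun x => h x * dens l x) + J (fun x => f x * dens l x).
  rewrite -box_intD; [|exact/box_integrable_bounded_measurable/integrable_dens..].
  by congr (box_int _ _ _); apply/funext => x; rewrite mulrDl.
by ring.
Qed.

Lemma discrepancyZ k h l : Reg l -> bounded_measurable h ->
  discrepancy (fun x => k * h x) l = k * discrepancy h l.
Proof.
move=> rl bh; rewrite /discrepancy (box_intZ k (box_integrable_bounded bh)).
have -> : J (fun x => k * h x * dens l x) = k * J (fun x => h x * dens l x).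
  rewrite -box_intZ; last exact/box_integrable_bounded_measurable/integrable_dens.
  by congr (box_int _ _ _); apply/funext => x; rewrite mulrA.
by ring.
Qed.

Lemma discrepancy_le h l e : Reg l -> bounded_measurable h -> (forall x, `|h x| <= e) ->
  `|discrepancy h l| <= e + e.
Proof.
move=> rl bh he; have D0 := box_int_density_gt0 rl.
rewrite /discrepancy; apply: (le_trans (ler_normB _ _)); apply: lerD.
  rewrite normrM normfV (gtr0_norm D0) ler_pdivrMr //.
  have ih := box_integrable_bounded_measurable bh (integrable_dens rl).
  apply: (le_trans (box_int_norm ih)); rewrite -(box_intZ _ (integrable_dens rl)).
  apply: box_int_le; [exact: box_integrable_norm|exact/box_integrableZ/integrable_dens|].
  by move=> x _; rewrite normrM (ger0_norm (dens_ge0 _ _)) ler_wpM2r.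
rewrite normrM normfV (gtr0_norm A0) ler_pdivrMr //.
have ih := box_integrable_bounded bh.
apply: (le_trans (box_int_norm ih)); rewrite -box_int_cst.
by apply: box_int_le; [exact: box_integrable_norm|exact: box_integrable_cst|move=> x _].
Qed.

Lemma near_regular : \forall l \near F0, Reg l.
Proof. exact: withinT. Qed.

Lemma root32_near (K : R) : \forall l \near F0, K <= root32 l.
Proof.
apply: cvg_within; have := nbhs_pinfty_ge (num_real (`|K| ^+ 32)).
apply: filterS => l Kl; apply: (le_trans (ler_norm K)).
by rewrite root32_ge // (le_trans _ Kl).
Qed.

(** For z = 0 both means equal cos th. Otherwise the volume mean vanishes and [cross_sum] bounds the
    other by [Ccross] / t, provided t is large enough for the cube to contain z. *)
Lemma discrepancy_trig z th e : 0 < e -> \forall l \near F0, `|discrepancy (trig z th) l| < e.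
Proof.
move=> e0; have [->|z0] := eqVneq z 0.
  apply: filterS near_regular => l rl; have D0 := box_int_density_gt0 rl.
  rewrite /discrepancy box_int_trig0.
  have -> : J (fun x => trig 0 th x * dens l x) = cos th * J (dens l).
    rewrite -(box_intZ _ (integrable_dens rl)); congr (box_int _ _ _); apply/funext => x.
    by rewrite trig0.
  by rewrite !mulfK ?gt_eqF // subrr normr0.
have C0 := Ccross_ge0 ha hb hc.
apply: filterS3 near_regular (root32_near (`|z.1.1|%N + `|z.1.2|%N + `|z.2|%N)%:R)
  (root32_near (Ccross a b c / e + 1)) => l rl zl el.
have D0 := box_int_density_gt0 rl.
have r0 : 0 < root32 l by apply: lt_le_trans el; rewrite ltr_wpDl // divr_ge0 // ltW.
have zc : z \in cube (Num.truncn (root32 l)).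
  have : (`|z.1.1|%N + `|z.1.2|%N + `|z.2|%N <= Num.truncn (root32 l))%N.
    by rewrite truncn_ge_nat // ltW.
  rewrite mem_cube; move: `|z.1.1|%N `|z.1.2|%N `|z.2|%N (Num.truncn _) => i j k n; lia.
rewrite /discrepancy box_int_trig // mul0r subr0 normrM normfV (gtr0_norm D0) ltr_pdivrMr //.
have := box_int_trig_density ha hb hc (offR rl) (greenR rl) th
  (fun F => cross_sum ha hb hc rl F z0 zc).
move=> /le_lt_trans; apply; rewrite ltr_pM2r // ltr_pdivrMr // mulrC -ltr_pdivrMr //.
by apply: lt_le_trans el; rewrite ltrDl.
Qed.

Lemma discrepancy_trig_poly h e : trig_poly a b c h -> 0 < e ->
  \forall l \near F0, `|discrepancy h l| < e.
Proof.
move=> [s /funext ->]; elim: s e => [|p s IH] e e0.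
  apply: filterS near_regular => l rl; under eq_fun do rewrite big_nil.
  apply: (@le_lt_trans _ _ (0 + 0)); last by rewrite addr0.
  by apply: discrepancy_le => //; [exact: bounded_measurable0|move=> x; rewrite normr0].
have e1 : 0 < e / 2 by rewrite divr_gt0.
(* Adding 1 keeps the denominator positive when the coefficient p.1 vanishes. *)
have e2 : 0 < e / 2 / (`|p.1| + 1) by rewrite divr_gt0 // ltr_wpDl.
apply: filterS3 near_regular (IH _ e1) (discrepancy_trig p.2.1 p.2.2 e2) => l rl hs hp.
under eq_fun do rewrite big_cons.
rewrite discrepancyD ?discrepancyZ //; try exact: bounded_measurable_trig.
- apply: (le_lt_trans (ler_normD _ _)); rewrite normrM.
  move: hp; rewrite ltr_pdivlMr ?ltr_wpDl // => hp.
  have : 0 <= `|discrepancy (trig p.2.1 p.2.2) l| by [].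
  by move: hs hp; lra.
- by apply: bounded_measurableZ; exact: bounded_measurable_trig.
by apply: trig_poly_bounded; exists s.
Qed.

(** Approximation within e / 4 changes each of the two means by at most e / 4, leaving e / 2 for the
    trigonometric polynomial. *)
Lemma discrepancy_continuous f e : continuous f ->
  (forall m x, f (x + period a b c m) = f x) -> 0 < e ->
  \forall l \near F0, `|discrepancy f l| < e.
Proof.
move=> cf pf e0; have e4 : 0 < e / 4 by rewrite divr_gt0.
have e2 : 0 < e / 2 by rewrite divr_gt0.
have [T tT fT] := trig_poly_dense ha hb hc cf pf e4.
have bf := continuous_periodic_bounded cf pf; have bT := trig_poly_bounded tT.
apply: filterS2 near_regular (discrepancy_trig_poly tT e2) => l rl hT.
have bfT : bounded_measurable (fun x => f x + -1 * T x).
  by apply: bounded_measurableD => //; exact: bounded_measurableZ.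
have E : discrepancy f l = discrepancy (fun x => f x + -1 * T x) l + discrepancy T l.
  by rewrite discrepancyD ?discrepancyZ //; [ring|exact: bounded_measurableZ].
have : `|discrepancy (fun x => f x + -1 * T x) l| <= e / 4 + e / 4.
  by apply: discrepancy_le => // x; rewrite mulN1r.
rewrite E => h; apply: (le_lt_trans (ler_normD _ _)); lra.
Qed.

Lemma sqr_normc_normalize l x : Reg l ->
  ComplexField.Normc.normc (normalize a b c (G l) x) ^+ 2 = (J (dens l))^-1 * dens l x.
Proof.
move=> rl; have D0 := box_int_density_gt0 rl.
have -> : J (dens l) = L2_norm a b c (G l) ^+ 2.
  rewrite /L2_norm sqr_sqrtr //; exact: ltW.
rewrite /normalize /density !sqr_normc -fmorphV; move: (L2_norm _ _ _ _) => k.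
by case: (G l x) => u v /=; rewrite !mulr0 subr0 add0r -exprVn; ring.
Qed.

Lemma discrepancy_torus_int (f : R * R * R -> R[i]) l : Reg l ->
  bounded_measurable (fun x => complex.Re (f x)) ->
  bounded_measurable (fun x => complex.Im (f x)) ->
  torus_int a b c (fun x => f x *
     (ComplexField.Normc.normc (normalize a b c (G l) x) ^+ 2)%:C)
     - (1 / A)%:C * torus_int a b c f =
  discrepancy (fun x => complex.Re (f x)) l +i* discrepancy (fun x => complex.Im (f x)) l.
Proof.
move=> rl bR bI.
have step (h : R * R * R -> R) : bounded_measurable h ->
    J (fun x => h x * ((J (dens l))^-1 * dens l x)) - 1 / A * J h = discrepancy h l.
  move=> bh; rewrite /discrepancy mul1r (mulrC A^-1) (mulrC _ (J (dens l))^-1); congr (_ - _).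
  rewrite -(box_intZ _ (box_integrable_bounded_measurable bh (integrable_dens rl))).
  by congr (box_int _ _ _); apply/funext => x; rewrite mulrCA.
rewrite -(step _ bR) -(step _ bI) /torus_int.
have -> : (fun x => complex.Re (f x * (ComplexField.Normc.normc
      (normalize a b c (G l) x) ^+ 2)%:C)) =
    (fun x => complex.Re (f x) * ((J (dens l))^-1 * dens l x)).
  apply/funext => x; rewrite (sqr_normc_normalize x rl).
  by case: (f x) => u v /=; rewrite mulr0 subr0.
have -> : (fun x => complex.Im (f x * (ComplexField.Normc.normc
      (normalize a b c (G l) x) ^+ 2)%:C)) =
    (fun x => complex.Im (f x) * ((J (dens l))^-1 * dens l x)).
  apply/funext => x; rewrite (sqr_normc_normalize x rl).
  by case: (f x) => u v /=; rewrite mulr0 add0r.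
by apply/eqP; rewrite eq_complex /= !mul0r subr0 addr0 !eqxx.
Qed.

Lemma equidistribution (f : R * R * R -> R[i]) : torus_smooth a b c f ->
  ComplexField.Normc.normc
    (torus_int a b c (fun x => f x *
       (ComplexField.Normc.normc (normalize a b c (G l) x) ^+ 2)%:C)
     - (1 / A)%:C * torus_int a b c f) @[l --> within Reg (pinfty_nbhs R)] --> (0 : R).
Proof.
move=> [pf sR sI].
(* The empty list of derivatives yields continuity of the real and imaginary parts. *)
have [cR _] := sR [::]; have [cI _] := sI [::].
have pR m x : complex.Re (f (x + period a b c m)) = complex.Re (f x) by rewrite pf.
have pI m x : complex.Im (f (x + period a b c m)) = complex.Im (f x) by rewrite pf.
apply/cvgrPdist_lt => e e0; have e2 : 0 < e / 2 by rewrite divr_gt0.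
apply: filterS3 near_regular (discrepancy_continuous cR pR e2) (discrepancy_continuous cI pI e2) => l rl hR hI.
rewrite sub0r normrN discrepancy_torus_int //; [|exact: continuous_periodic_bounded..].
rewrite ger0_norm ?sqrtr_ge0 //; apply: le_lt_trans (normc_le _) _ => /=; lra.
Qed.

End Equidistribution.

Theorem theorem1p3 (R : realType) (a b c : R)
    (ha : 0 < a) (hb : 0 < b) (hc : 0 < c)
    (hindep : lin_indep_Q (1 / a ^+ 2) (1 / b ^+ 2) (1 / c ^+ 2))
    (htype : irrational_of_finite_type (b ^+ 2 / a ^+ 2) \/
             irrational_of_finite_type (c ^+ 2 / a ^+ 2) \/
             irrational_of_finite_type (c ^+ 2 / b ^+ 2))
    (x0 : R * R * R) (phi : R) (hphi1 : - pi < phi) (hphi2 : phi < pi) :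
  exists Lambda_inf : set R,
    density_one Lambda_inf (new_eigenvalues a b c phi) /\
    forall G : R -> R * R * R -> R[i],
      (forall lambda, new_eigenvalues a b c phi lambda ->
         is_green a b c x0 lambda (G lambda)) ->
      forall f : R * R * R -> R[i], torus_smooth a b c f ->
        ComplexField.Normc.normc
          (torus_int a b c (fun x => f x *
             (ComplexField.Normc.normc
                (normalize a b c (G lambda) x) ^+ 2)%:C)
           - (1 / area a b c)%:C * torus_int a b c f)
          @[lambda --> within Lambda_inf (pinfty_nbhs R)] --> (0 : R).
Proof.
(* With this value [new_eigenvalues a b c phi] is convertible to [new (nsq a b c) tau]; the witness
   is chosen before [G] and [f]. *)
pose tau := c0 a b c * tan (phi / 2).
exists (regular a b c tau); split; first exact: (regular_density ha hb hc tau hindep).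
by move=> G greenG f; exact: (equidistribution ha hb hc greenG).
Qed.
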